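(* Let $y_{\mathrm{ext}}\in\mathbb R^d\setminus Y$, set $Y_{\mathrm{ext}}:=Y\cup\{y_{\mathrm{ext}}\}$, and define $c_{\mathrm{ext}}:X\times Y_{\mathrm{ext}}\to[0,+\infty)$ by $c_{\mathrm{ext}}(x,y)=c(x,y)$ if $y\in Y$ and $c_{\mathrm{ext}}(x,y_{\mathrm{ext}})=0$. Let $P>0$ be a uniform upper bound on the set $\mathcal S=\{\bar p_\psi\mid\psi\in\mathcal C(Y)\}$. Let $\nu\in\mathcal P(Y)$ and define $$\mu_{\mathrm{ext}}:=\mathcal L^d|_{B\times[0,P]},\qquad \nu_{\mathrm{ext}}:=\nu+(P-1)\delta_{y_{\mathrm{ext}}}.$$ For $\bar p\in\mathcal P_{\mathrm{ac}}(B)$, $\psi\in\mathcal C(Y)$ and $\gamma\in\mathcal P(X\times Y)$, define $$\gamma_{\mathrm{ext}}:=\gamma+\bigl(\mathcal L^d|_{\{(s,p):\,s\in B,\ \bar p(s)\le p\le P\}}\bigr)\otimes\delta_{y_{\mathrm{ext}}},\qquad \psi_{\mathrm{ext}}(y):=\begin{cases}\psi(y)&\text{if }y\in Y,\\-\tau_\psi&\text{if }y=y_{\mathrm{ext}}.\end{cases}$$ Then the following two sets of conditions are equivalent: (1) $\bar p\in\arg\min_{\mathcal P_{\mathrm{ac}}(B)}F_\nu$, $\ \psi\in\arg\max_{\mathcal C(Y)}G_\nu$, and $\gamma\in\arg\min_{\tilde\gamma\in\Gamma(\mu_{\bar p},\nu)}\int_{X\times Y}c\,\mathrm d\tilde\gamma$;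 (2) $\bar p=\max_{y\in Y}q\bigl(\cdot,y,\psi_{\mathrm{ext}}(y)-\psi_{\mathrm{ext}}(y_{\mathrm{ext}})\bigr)$, $\ \psi_{\mathrm{ext}}$ is a Kantorovich potential from $\mu_{\mathrm{ext}}$ to $\nu_{\mathrm{ext}}$ (for the cost $c_{\mathrm{ext}}$), and $\gamma_{\mathrm{ext}}\in\arg\min_{\tilde\gamma\in\Gamma(\mu_{\mathrm{ext}},\nu_{\mathrm{ext}})}\int_{X\times Y_{\mathrm{ext}}}c_{\mathrm{ext}}\,\mathrm d\tilde\gamma$.
   Context: Setting. Let $d\ge 2$, let $B\subset\mathbb R^{d-1}$ be compact with non-empty interior, let $X:=B\times[0,+\infty)$ with points written $x=(s,p)$, and let $Y\subset\mathbb R^d$ be non-empty and compact. The cost $c:X\times Y\to[0,+\infty)$ satisfies: (A) $c$ is locally Lipschitz; (B) for all $s\in B$ and $y\in Y$ the function $c((s,\cdot),y):[0,+\infty)\to[0,+\infty)$ is strictly increasing and unbounded; (C) the set of functions $\{c((\cdot,p),y):B\to[0,+\infty)\mid p\in[0,+\infty),\,y\in Y\}$ is equicontinuous. Notation. $\mathcal C(A)$ is the space of continuous real functions on $A$; $\mathcal P(A)$ is the set of Borel probability measures on $A$; $\mathcal P_{\mathrm{ac}}(B)$ is the set of those on $B$ absolutely continuous with respect to Lebesgue measure $\mathcal L^{d-1}$, identified with their densities (as elements of $L^1(B)$). $\mathcal L^d|_A$ is the restriction of Lebesgue measure to $A$, and $\delta_y$ is the Dirac mass at $y$. For $\bar p\in\mathcal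 P_{\mathrm{ac}}(B)$ let $X_{\bar p}:=\{(s,p)\in X: p\le\bar p(s)\}$ and $\mu_{\bar p}:=\mathcal L^d|_{X_{\bar p}}$, a probability measure on $X$. $\Gamma(\mu,\nu)$ is the set of non-negative Borel measures on the product space with marginals $\mu$ and $\nu$. $F_\nu$ is defined on $\mathcal P_{\mathrm{ac}}(B)$ by $F_\nu(\bar p):=\mathcal T_c(\mu_{\bar p},\nu):=\inf_{\gamma\in\Gamma(\mu_{\bar p},\nu)}\int_{X\times Y}c\,\mathrm d\gamma$. For $\psi\in\mathcal C(Y)$, $\psi^c(x):=\inf_{y\in Y}\{c(x,y)-\psi(y)\}$ for $x\in X$, $K(\psi;\mu,\nu):=\int_X\psi^c\,\mathrm d\mu+\int_Y\psi\,\mathrm d\nu$, and $G_\nu(\psi):=\inf_{\bar p\in\mathcal P_{\mathrm{ac}}(B)}K(\psi;\mu_{\bar p},\nu)$. A Kantorovich potential from $\mu_{\mathrm{ext}}$ to $\nu_{\mathrm{ext}}$ for $c_{\mathrm{ext}}$ is a maximiser over $\varphi\in\mathcal C(Y_{\mathrm{ext}})$ of $\int_X\varphi^{c_{\mathrm{ext}}}\,\mathrm d\mu_{\mathrm{ext}}+\int_{Y_{\mathrm{ext}}}\varphi\,\mathrm d\nu_{\mathrm{ext}}$, where $\varphi^{c_{\mathrm{ext}}}(x):=\inf_{y\in Y_{\mathrm{ext}}}\{c_{\mathrm{ext}}(x,y)-\varphi(y)\}$. Measures on $X\times Y$ and on $(B\times[0,P])\times Y_{\mathrm{ext}}$ are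 regarded as measures on $X\times Y_{\mathrm{ext}}$. Define $q:B\times Y\times\mathbb R\to[0,+\infty)$ by $q(s,y,\sigma):=c((s,\cdot),y)^{-1}(\sigma)$ if $\sigma\ge c((s,0),y)$, and $q(s,y,\sigma):=0$ otherwise. For each $\psi\in\mathcal C(Y)$ there is a unique constant $\tau_\psi\in\mathbb R$ such that $\bar p_\psi:B\to\mathbb R$, $\bar p_\psi(s):=\max_{y\in Y}q(s,y,\psi(y)+\tau_\psi)$, is a probability density on $B$; this defines $\tau_\psi$ and $\bar p_\psi$. The set $\mathcal S=\{\bar p_\psi\mid\psi\in\mathcal C(Y)\}$ is uniformly bounded.
   Formalization: The mass of ν_ext at y_ext is P·L^{d-1}(B) − 1 instead of P − 1 (the same when L^{d-1}(B) = 1); with P − 1 and L^{d-1}(B) ≠ 1 the measures μ_ext and ν_ext have different masses, so (2) fails while (1) can hold. *)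

(* Defs.v *)
From HB Require Import structures.
From mathcomp Require Import all_boot all_order all_algebra.
From mathcomp Require Import all_classical all_reals all_analysis.
From mathcomp Require Import measurable_realfun.

Set Implicit Arguments.
Unset Strict Implicit.
Unset Printing Implicit Defensive.

Import Order.TTheory GRing.Theory Num.Theory.
Import numFieldNormedType.Exports.

Local Open Scope classical_set_scope.
Local Open Scope ring_scope.

Definition borel_mx_display : measure_display.
Proof. exact: default_measure_display. Qed.

Section borel_matrix.
Context (R : realType) (m n : nat).

Let borel : set (set 'M[R]_(m, n)) := <<s [set A | open A] >>.

Let borel0 : borel set0. Proof. exact: sigma_algebra0. Qed.

Let borelC A : borel A -> borel (~` A). Proof. exact: sigma_algebraC. Qed.

Let borel_bigcup (F : (set 'M[R]_(m, n))^nat) :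
  (forall i, borel (F i)) -> borel (\bigcup_i F i).
Proof. exact: sigma_algebra_bigcup. Qed.

HB.instance Definition _ := @isMeasurable.Build borel_mx_display
  'M[R]_(m, n) borel borel0 borelC borel_bigcup.

End borel_matrix.

Section measurable_rV.
Context (R : realType) (n : nat).

Lemma open_rV_measurable (A : set 'rV[R]_n) : open A -> measurable A.
Proof. by move=> oA; exact: sub_sigma_algebra. Qed.

Let ratbox (ab : 'rV[rat]_n * 'rV[rat]_n) : set 'rV[R]_n :=
  [set x | forall i, ratr (ab.1 ord0 i) < x ord0 i < ratr (ab.2 ord0 i)].

Let open_ratbox (A : set 'rV[R]_n) : open A ->
  A = \bigcup_(ab in [set ab | ratbox ab `<=` A]) ratbox ab.
Proof.
move=> oA; apply/seteqP; split=> [x Ax|x [ab /= sub]]; last exact: sub.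
have [e /= e0 exA] : exists2 e, 0 < e & ball x e `<=` A.
  by have /nbhs_ballP[e e0 xeA] := open_nbhs_nbhs (conj oA Ax); exists e.
have lq i : {q : rat | x ord0 i - e < ratr q < x ord0 i}.
  apply: cid; have /rat_in_itvoo[q] : x ord0 i - e < x ord0 i.
    by rewrite ltrBlDr ltrDl.
  by rewrite in_itv/= => qx; exists q.
have rq i : {q : rat | x ord0 i < ratr q < x ord0 i + e}.
  apply: cid; have /rat_in_itvoo[q] : x ord0 i < x ord0 i + e by rewrite ltrDl.
  by rewrite in_itv/= => qx; exists q.
exists (\row_i sval (lq i), \row_i sval (rq i)) => /=.
  move=> y xy; apply: exA; split => // i j; rewrite ord1 {i}.
  have := xy j; rewrite !mxE /= => /andP[ly yr].
  have /andP[l1 l2] := svalP (lq j); have /andP[r1 r2] := svalP (rq j).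
  rewrite /ball/= ltr_distlC; apply/andP; split.
    exact: lt_trans ly.
  exact: lt_trans r2.
move=> i; rewrite !mxE /=.
have /andP[_ ->] := svalP (lq i).
by have /andP[-> _] := svalP (rq i).
Qed.

Lemma measurable_fun_rV d (T : measurableType d) (f : T -> 'rV[R]_n) :
  (forall i, measurable_fun setT (fun t => f t ord0 i : measurableTypeR R)) ->
  measurable_fun setT f.
Proof.
move=> mf; apply: (@measurability _ _ _ _ setT f [set A | open A]) => //.
move=> _ [A /= oA <-]; rewrite setTI (open_ratbox oA) preimage_bigcup.
rewrite bigcup_mkcond; apply: countable_bigcupT_measurable => [|ab].
  exact: countableP.
case: ifPn => // _.
rewrite (_ : _ @^-1` _ = \bigcap_(i : 'I_n) ((fun t => f t ord0 i) @^-1`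
  `]ratr (ab.1 ord0 i), ratr (ab.2 ord0 i)[)); last first.
  apply/seteqP; split=> [t /= ft i _|t ft i]; first by rewrite /= in_itv/= ft.
  by have := ft i Logic.I; rewrite /= in_itv.
apply: fin_bigcap_measurable => [|i _]; first exact: finite_finset. rewrite -[X in measurable X]setTI.
by apply: mf => //; exact: measurable_itv.
Qed.

End measurable_rV.

Section lebesgue_rV.
Context {R : realType}.

Definition row_cons k (z : 'rV[R]_k * measurableTypeR R) : 'rV[R]_k.+1 :=
  row_mx (z.2 : R)%:M z.1 : 'rV[R]_(1 + k).

Lemma row_cons0 k (z : 'rV[R]_k * measurableTypeR R) :
  row_cons z ord0 ord0 = z.2.
Proof.
by rewrite /row_cons mxE; case: splitP => [j _|//]; rewrite !ord1 mxE.
Qed.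

Lemma row_consS k (z : 'rV[R]_k * measurableTypeR R) i :
  row_cons z ord0 (lift ord0 i) = z.1 ord0 i.
Proof.
rewrite /row_cons mxE; case: splitP => [j|j /eqP]; first by rewrite ord1.
by rewrite /= /bump/= !add1n eqSS => /eqP /val_inj ->.
Qed.

Lemma measurable_coord_rV n (i : 'I_n) :
  measurable_fun setT (fun x : 'rV[R]_n => x ord0 i : measurableTypeR R).
Proof.
apply: (measurability _ (RGenOInfty.measurableE R)).
move=> _ [_ [a ->] <-]; rewrite setTI; apply: open_rV_measurable.
have /continuousP : continuous (fun x : 'rV[R]_n => x ord0 i).
  exact: coord_continuous.
by apply; exact: interval_open.
Qed.

Lemma measurable_row_cons k : measurable_fun setT (@row_cons k).
Proof.
apply: measurable_fun_rV => i; have [j ->|->] := unliftP ord0 i.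
  under eq_fun do rewrite row_consS.
  exact: (measurableT_comp (measurable_coord_rV j) measurable_fst).
under eq_fun do rewrite row_cons0.
exact: measurable_snd.
Qed.

Fixpoint lebesgue_rV n : set 'rV[R]_n -> \bar R :=
  if n is k.+1 then
    pushforward (lebesgue_rV (n := k) \x lebesgue_measure)%E (@row_cons k)
  else \d_(0 : 'rV[R]_0).

Let lebesgue_rV_measure n :
  exists m : {measure set 'rV[R]_n -> \bar R}, m = @lebesgue_rV n :> (_ -> _).
Proof.
elim: n => [|n [m IH]] /=; first by eexists.
rewrite -IH.
by exists (@measure_function_pushforward__canonical__measure_function_Measure
  _ _ _ _ _ [the measure _ _ of m \x lebesgue_measure]%E _ (@measurable_row_cons n)).
Qed.

Section measure_n.
Variable n : nat.

Let leb0 : @lebesgue_rV n set0 = 0%E.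
Proof. by have [m <-] := lebesgue_rV_measure n. Qed.

Let leb_ge0 A : (0 <= @lebesgue_rV n A)%E.
Proof. by have [m <-] := lebesgue_rV_measure n. Qed.

Let leb_sigma_additive : semi_sigma_additive (@lebesgue_rV n).
Proof.
have [m <-] := lebesgue_rV_measure n; exact: measure_semi_sigma_additive.
Qed.

HB.instance Definition _ := isMeasure.Build _ _ _ (@lebesgue_rV n)
  leb0 leb_ge0 leb_sigma_additive.

End measure_n.

Let measurable_rV_box n (a b : 'rV[R]_n) :
  measurable [set x : 'rV[R]_n | forall i, x ord0 i \in `[a ord0 i, b ord0 i]].
Proof.
rewrite (_ : mkset _ = \bigcap_(i : 'I_n)
  ((fun x : 'rV[R]_n => x ord0 i) @^-1` `[a ord0 i, b ord0 i])); last first.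
  by apply/seteqP; split=> [x xab i _|x xab i]; [exact: xab|exact: (xab i)].
apply: fin_bigcap_measurable => [|i _]; first exact: finite_finset.
rewrite -[X in measurable X]setTI.
by apply: (measurable_coord_rV i) => //; exact: measurable_itv.
Qed.

Lemma lebesgue_rV_box n (a b : 'rV[R]_n) : (forall i, a ord0 i <= b ord0 i) ->
  lebesgue_rV [set x | forall i, x ord0 i \in `[a ord0 i, b ord0 i]] =
  (\prod_i (b ord0 i - a ord0 i))%:E.
Proof.
elim: n => [|n IH] in a b *; move=> ab /=.
  by rewrite big_ord0 diracE mem_set// => -[].
rewrite big_ord_recl mulrC EFinM.
pose a' : 'rV[R]_n := \row_i a ord0 (lift ord0 i).
pose b' : 'rV[R]_n := \row_i b ord0 (lift ord0 i).
rewrite /pushforward.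
rewrite [X in (_ \x _)%E X](_ : _ =
  [set x : 'rV[R]_n | forall i, x ord0 i \in `[a' ord0 i, b' ord0 i]] `*`
  `[a ord0 ord0, b ord0 ord0]%classic); last first.
  apply/seteqP; split=> [z /= zab|z /= [zab z0] i].
    split=> [i|]; last by have := zab ord0; rewrite row_cons0.
    by have := zab (lift ord0 i); rewrite row_consS !mxE.
  have [j ->|->] := unliftP ord0 i; last by rewrite row_cons0.
  by have := zab j; rewrite row_consS !mxE.
rewrite product_measure1E/=; last 2 first.
- exact: measurable_rV_box.
- exact: measurable_itv.
rewrite IH => [|i]; last by rewrite !mxE.
rewrite lebesgue_measure_itv/= lte_fin; congr (_ * _)%E.
  by congr EFin; apply: eq_bigr => i _; rewrite !mxE.
have := ab ord0; rewrite le_eqVlt => /predU1P[->|->]; last by rewrite EFinB.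
by rewrite ltxx subrr.
Qed.

End lebesgue_rV.

Section arg_extrema.
Context (T : Type) (R : realType).

Definition argmin (A : set T) (f : T -> \bar R) : set T :=
  [set a | A a /\ forall b, A b -> (f a <= f b)%E].

Definition argmax (A : set T) (f : T -> \bar R) : set T :=
  [set a | A a /\ forall b, A b -> (f b <= f a)%E].

End arg_extrema.

(* mu|_D; the zero measure is a junk value for non-measurable D *)
Definition restrict_measure d (T : measurableType d) (R : realType)
    (mu : {measure set T -> \bar R}) (D : set T) : {measure set T -> \bar R} :=
  match pselect (measurable D) with
  | left mD => [the measure _ _ of mrestr mu mD]
  | right _ => [the measure _ _ of mzero]
  end.

(* Functions and measures on X and Y are given on the ambient types T1 and T2;
   only their values on X and Y matter *)
Section transport.
Local Open Scope ereal_scope.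
Context d1 d2 (T1 : measurableType d1) (T2 : measurableType d2) (R : realType).
Variables (X : set T1) (Y : set T2) (c : T1 -> T2 -> R).
Implicit Types (mu : {measure set T1 -> \bar R}) (nu : {measure set T2 -> \bar R}).

Definition couplings mu nu : set {measure set (T1 * T2) -> \bar R} :=
  [set g | (forall A, measurable A -> g (A `*` setT) = mu A) /\
           (forall A, measurable A -> g (setT `*` A) = nu A)].

Definition plan_cost (g : {measure set (T1 * T2) -> \bar R}) : \bar R :=
  \int[g]_(z in X `*` Y) (c z.1 z.2)%:E.

Definition optimal_plans mu nu := argmin (couplings mu nu) plan_cost.

Definition transport_cost mu nu : \bar R :=
  ereal_inf [set plan_cost g | g in couplings mu nu].

Definition c_transform (psi : T2 -> R) (x : T1) : R :=
  inf [set (c x y - psi y)%R | y in Y].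

Definition kantorovich mu nu (psi : T2 -> R) : \bar R :=
  \int[mu]_(x in X) (c_transform psi x)%:E + \int[nu]_(y in Y) (psi y)%:E.

End transport.

(* X = B x [0, +oo[; a point x = (s, p) of R^(d-1) x R stands for a point of
   R^d, and L^d is the corresponding product measure *)
Notation "'Rs[ R ]_ d" := ('rV[R]_d.-1 * measurableTypeR R)%type
  (at level 8, d at level 2, format "''Rs[' R ]_ d").

Section free_surface.
Context (R : realType) (d : nat).
Variables (B : set 'rV[R]_d.-1) (Y : set 'rV[R]_d).
Variable c : 'rV[R]_d.-1 * R -> 'rV[R]_d -> R.

Definition cylinder : set 'Rs[R]_d := B `*` [set p : R | 0 <= p].

Definition Cont (A : set 'rV[R]_d) : set ('rV[R]_d -> R) :=
  [set psi | {within A, continuous psi}].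

Definition volume : {measure set 'Rs[R]_d -> \bar R} :=
  [the measure _ _ of (@lebesgue_rV R d.-1 \x @lebesgue_measure R)%E].

(* Densities on B; two of them that agree almost everywhere on B represent the
   same measure *)
Definition Pac : set ('rV[R]_d.-1 -> R) :=
  [set p : 'rV[R]_d.-1 -> R |
    [/\ measurable_fun B p, forall s, B s -> 0 <= p s &
      (\int[@lebesgue_rV R d.-1]_(s in B) (p s)%:E = 1)%E]].

Definition subgraph (p : 'rV[R]_d.-1 -> R) : set 'Rs[R]_d :=
  [set x | cylinder x /\ (x.2 : R) <= p x.1].

Definition mu_surface (p : 'rV[R]_d.-1 -> R) : {measure set 'Rs[R]_d -> \bar R} :=
  restrict_measure volume (subgraph p).

Definition F_primal (nu : {measure set 'rV[R]_d -> \bar R})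
    (p : 'rV[R]_d.-1 -> R) : \bar R :=
  transport_cost cylinder Y c (mu_surface p) nu.

Definition G_dual (nu : {measure set 'rV[R]_d -> \bar R})
    (psi : 'rV[R]_d -> R) : \bar R :=
  ereal_inf [set kantorovich cylinder Y c (mu_surface p) nu psi | p in Pac].

(* The xget is the inverse of the increasing function p |-> c (s, p) y on
   [0, +oo[ *)
Definition q (s : 'rV[R]_d.-1) (y : 'rV[R]_d) (sigma : R) : R :=
  if c (s, 0) y <= sigma
  then xget 0 [set p | 0 <= p /\ c (s, p) y = sigma] else 0.

(* For sigma continuous on the compact set Y the supremum is attained *)
Definition max_q (sigma : 'rV[R]_d -> R) (s : 'rV[R]_d.-1) : R :=
  sup [set q s y (sigma y) | y in Y].

(* The t below is unique when psi is continuous on Y *)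
Definition tau (psi : 'rV[R]_d -> R) : R :=
  xget 0 [set t | Pac (max_q (fun y => psi y + t))].

Definition p_bar (psi : 'rV[R]_d -> R) : 'rV[R]_d.-1 -> R :=
  max_q (fun y => psi y + tau psi).

Section extension.
Variables (y_ext : 'rV[R]_d) (P : R).

Definition ext_Y : set 'rV[R]_d := Y `|` [set y_ext].

Definition ext_c (x : 'rV[R]_d.-1 * R) (y : 'rV[R]_d) : R :=
  if y == y_ext then 0 else c x y.

Definition ext_mu : {measure set 'Rs[R]_d -> \bar R} :=
  restrict_measure volume (B `*` [set p : R | 0 <= p <= P]).

(* The mass at y_ext is P L(B) - 1, the only value for which ext_mu and ext_nu
   have the same total mass; it is P - 1 when L(B) = 1. It is non-negative as
   soon as P bounds some probability density on B, so the truncation is inert *)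
Definition ext_mass : R := Num.max 0 (P * fine (@lebesgue_rV R d.-1 B) - 1).

Lemma ext_mass_ge0 : 0 <= ext_mass.
Proof. by rewrite le_max lexx. Qed.

Definition ext_nu (nu : {measure set 'rV[R]_d -> \bar R}) :
    {measure set 'rV[R]_d -> \bar R} :=
  [the measure _ _ of measure_add nu (mscale (NngNum ext_mass_ge0) \d_y_ext)].

Definition supergraph (p : 'rV[R]_d.-1 -> R) : set 'Rs[R]_d :=
  [set x | B x.1 /\ p x.1 <= (x.2 : R) <= P].

Definition ext_gamma (p : 'rV[R]_d.-1 -> R)
    (gamma : {measure set ('Rs[R]_d * 'rV[R]_d) -> \bar R}) :
    {measure set ('Rs[R]_d * 'rV[R]_d) -> \bar R} :=
  [the measure _ _ of measure_add gamma
    [the measure _ _ of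
      (restrict_measure volume (supergraph p) \x \d_y_ext)%E]].

Definition ext_psi (psi : 'rV[R]_d -> R) (y : 'rV[R]_d) : R :=
  if y == y_ext then - tau psi else psi y.

End extension.

End free_surface.

(* Main.v *)
From HB Require Import structures.
Require Import Defs.
From mathcomp Require Import all_boot all_order all_algebra.
From mathcomp Require Import all_classical all_reals all_analysis.
From mathcomp Require Import measurable_realfun.
From mathcomp Require Import lra ring.

(** Let f be the c-transform of psi, tau its threshold, E the sublevel f <= tau
    in X, and S the slab B x [0, P].

    The dual functional. As the cost increases strictly with the depth p, the
    sublevel E is, up to a null set, the subgraph of p_bar psi ([le_max_q],
    [volume_subgraph_max_q]); it has volume 1. Among the subsets of X of volume
    1, the sublevel E minimizes the integral of f, and it is the only one up to
    null sets. Hence G psi is the value at p_bar psi ([G_dualE]), and a density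
    p for which the infimum is reached is p_bar psi ([dual_value_eq]).

    The extended dual functional. The point y_ext receives at no cost the part
    of the slab above the surface. The extended c-transform of phi is the
    minimum of the c-transform of phi on Y and of t = - phi y_ext. Its integral
    over S is at most the integral of the former over E plus t times the volume
    of S \ E, with equality when t is the threshold. As the volume of S \ E is
    the mass of ext_nu at y_ext, the extended Kantorovich functional at phi is
    at most G phi, with equality at the functions ext_psi psi; so psi maximizes
    G if and only if ext_psi psi is a Kantorovich potential ([argmax_ext]).

    No duality gap. If ext_psi psi is a potential, some plan of the extended
    problem is carried by the set where the dual constraint is saturated
    ([kantorovich_attained]). Saturation forces this plan to send E to Y and
    S \ E to y_ext, so its restriction to X x Y is a plan for p_bar psi, of cost
    at most G psi ([F_primal_le_G_dual]). With weak duality, F (p_bar psi) =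
    G psi is the minimum of F.

    The equivalence. The plan ext_gamma is a coupling exactly when gamma is one,
    and both have the same cost ([ext_gamma_couplings], [ext_gamma_cost]). Each
    implication is now a chain of inequalities between G psi, F p and the cost
    of gamma.

    Attained duality is proved on a product of two compact sets. Let Theta u be
    the infimum of the sums of an integral of f and one of h such that
    u (x, y) <= f x + h y; it is a sublinear functional of the bounded function
    u, and the dual value for the cost c is - Theta (- c). By the Hahn-Banach
    theorem Theta dominates a linear functional that equals it at - c; on
    indicators, this is a finitely additive set function with the right
    marginals, because it is determined on the sums f x + h y. The regularity of
    the marginals and compactness make it countably additive on rectangles
    ([coupling_of_finitely_additive]). It vanishes near the points where the
    constraint is not saturated, because it vanishes on the slack. *)

Set Implicit Arguments.
Unset Strict Implicit.
Unset Printing Implicit Defensive.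

Import Order.TTheory GRing.Theory Num.Theory.
Import numFieldNormedType.Exports.

Local Open Scope classical_set_scope.
Local Open Scope ring_scope.


(** * Hahn-Banach theorem *)

Section hahn_banach.
Context (R : realType) (V : lmodType R) (W : set V).
Hypotheses (W0 : W 0) (WD : forall u v, W u -> W v -> W (u + v))
  (WZ : forall a u, W u -> W (a *: u)).

Let WN u : W u -> W (- u).
Proof. by move=> /(WZ (-1)); rewrite scaleN1r. Qed.

Definition sublinear_on (p : V -> R) :=
  (forall u v, W u -> W v -> p (u + v) <= p u + p v) /\
  (forall a u, 0 <= a -> W u -> p (a *: u) = a * p u).

Let sub0 p : sublinear_on p -> p 0 = 0.
Proof. by move=> [_ /(_ 0 0 (lexx _) W0)]; rewrite scale0r mul0r. Qed.

Let subN p u : sublinear_on p -> W u -> - p (- u) <= p u.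
Proof.
move=> sp Wu; rewrite lerNl -subr_ge0 opprK -(sub0 sp) -[X in p X](subrr u).
by rewrite addrC; apply: sp.1 => //; exact: WN.
Qed.

(** The lowering of p along v. *)
Let tilt (p : V -> R) v u := inf [set p (u + t *: v) - t * p v | t in [set t | 0 <= t]].

Let tilt_lb p v u t : sublinear_on p -> W v -> W u -> 0 <= t ->
  - p (- u) <= p (u + t *: v) - t * p v.
Proof.
move=> sp Wv Wu t0; rewrite lerBrDl -(sp.2 _ _ t0 Wv) lerBlDl.
rewrite -[in leLHS](addKr u (t *: v)).
by apply: sp.1; [exact: WN|apply: WD => //; exact: WZ].
Qed.

Let tilt_le p v u t : sublinear_on p -> W v -> W u -> 0 <= t ->
  tilt p v u <= p (u + t *: v) - t * p v.
Proof.
move=> sp Wv Wu t0; apply: ge_inf; last by exists t.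
by exists (- p (- u)) => _ [s s0 <-]; exact: tilt_lb.
Qed.

Let tilt_ge p v u x : (forall t, 0 <= t -> x <= p (u + t *: v) - t * p v) ->
  x <= tilt p v u.
Proof.
move=> h; apply: lb_le_inf; first by exists (p (u + 0 *: v) - 0 * p v), 0 => /=.
by move=> _ [s s0 <-]; exact: h.
Qed.

Let tilt_leid p v u : sublinear_on p -> W v -> W u -> tilt p v u <= p u.
Proof.
by move=> sp Wv Wu; apply: le_trans (tilt_le sp Wv Wu (lexx 0)) _; rewrite scale0r addr0 mul0r subr0.
Qed.

Let tilt_sublinear p v : sublinear_on p -> W v -> sublinear_on (tilt p v).
Proof.
move=> sp Wv; have D u u' : W u -> W u' -> tilt p v (u + u') <= tilt p v u + tilt p v u'.
  move=> Wu Wu'; rewrite -lerBlDl; apply: tilt_ge => t t0; rewrite lerBlDl -lerBlDr.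
  apply: tilt_ge => s s0; rewrite lerBlDr.
  apply: le_trans (tilt_le sp Wv (WD Wu Wu') (addr_ge0 s0 t0)) _.
  rewrite mulrDl opprD addrACA lerD2r scalerDl addrACA.
  by apply: sp.1; apply: WD => //; exact: WZ.
split=> // a u; rewrite le_eqVlt => /predU1P[<- Wu|a0 Wu].
  rewrite scale0r mul0r; apply/eqP; rewrite eq_le.
  rewrite (le_trans (tilt_leid sp Wv W0)) ?(sub0 sp)//=.
  apply: tilt_ge => t t0; apply: le_trans (tilt_lb sp Wv W0 t0).
  by rewrite oppr0 sub0 ?oppr0.
have le b w : 0 < b -> W w -> b * tilt p v w <= tilt p v (b *: w).
  move=> b0 Ww; apply: tilt_ge => t t0; rewrite -ler_pdivlMl//.
  have tb : 0 <= b^-1 * t by rewrite mulr_ge0// invr_ge0 ltW.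
  apply: le_trans (tilt_le sp Wv Ww tb) _; rewrite mulrBr mulrA lerD2r.
  rewrite -sp.2; [|by rewrite invr_ge0 ltW|by apply: WD; exact: WZ].
  by rewrite scalerDr !scalerA mulVf ?scale1r// gt_eqF.
apply/eqP; rewrite eq_le le// andbT.
have := le _ (a *: u) (_ : 0 < a^-1) (WZ a Wu); rewrite invr_gt0 => /(_ a0).
by rewrite scalerA mulVf ?gt_eqF// scale1r ler_pdivrMl.
Qed.

(** A minimal sublinear functional q is linear: lowering q along v, that is
    replacing q by u |-> inf_t (q (u + t v) - t q v), gives a sublinear
    functional below q, hence q itself, and this says q u + q v <= q (u + v).
    Zorn's lemma gives a minimal functional below the one obtained by lowering
    p along v0. *)
Theorem hahn_banach (p : V -> R) v0 : sublinear_on p -> W v0 ->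
  exists L : V -> R, [/\ forall u, W u -> L u <= p u,
    forall u v, W u -> W v -> L (u + v) = L u + L v,
    forall a u, W u -> L (a *: u) = a * L u & L v0 = p v0].
Proof.
move=> sp Wv0; pose p0 := tilt p v0.
have sp0 : sublinear_on p0 by exact: tilt_sublinear.
pose T := {q : V -> R | sublinear_on q /\ forall u, W u -> q u <= p0 u}.
pose le (q q' : T) := `[< forall u, W u -> sval q' u <= sval q u >].
have t0 : T by exists p0.
have [||A Atot|q qmax] := @ZL_preorder T t0 le.
- by move=> q; apply/asboolP.
- by move=> q r s /asboolP qr /asboolP rs; apply/asboolP => u Wu; apply: le_trans (rs _ Wu) (qr _ Wu).
- have [[q0 Aq0]|/set0P/negP/negPn/eqP->] := pselect (A !=set0); last by exists t0 => s [].
  pose m u := inf [set sval q u | q in A].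
  have lbm u : W u -> lbound [set sval q u | q in A] (- p0 (- u)).
    move=> Wu _ [q _ <-]; have [sq qp] := svalP q.
    by apply: le_trans (subN sq Wu); rewrite lerN2 qp//; exact: WN.
  have mle u q : W u -> A q -> m u <= sval q u.
    by move=> Wu Aq; apply: ge_inf; [exists (- p0 (- u)); exact: lbm|exists q].
  have mge u x : (forall q, A q -> x <= sval q u) -> x <= m u.
    by move=> h; apply: lb_le_inf; [exists (sval q0 u), q0|move=> _ [q Aq <-]; exact: h].
  have sm : sublinear_on m.
    split=> [u v Wu Wv|a u].
      rewrite -lerBlDl; apply: (mge) => q Aq; rewrite lerBlDl -lerBlDr.
      apply: (mge) => r Ar; rewrite lerBlDr.
      have [/asboolP qr|/asboolP rq] := Atot _ _ Aq Ar.
        apply: le_trans (mle _ r (WD Wu Wv) Ar) _.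
        apply: le_trans ((svalP r).1.1 _ _ Wu Wv) _.
        by rewrite lerD2l; exact: qr.
      apply: le_trans (mle _ q (WD Wu Wv) Aq) _.
      apply: le_trans ((svalP q).1.1 _ _ Wu Wv) _.
      by rewrite lerD2r; exact: rq.
    rewrite le_eqVlt => /predU1P[<- Wu|a0 Wu].
      rewrite scale0r mul0r; apply/eqP; rewrite eq_le.
      rewrite (le_trans (mle _ _ W0 Aq0)) ?(sub0 (svalP q0).1)//=.
      by apply: (mge) => q Aq; rewrite (sub0 (svalP q).1).
    apply/eqP; rewrite eq_le; apply/andP; split.
      rewrite -ler_pdivrMl//; apply: (mge) => q Aq; rewrite ler_pdivrMl//.
      by rewrite -((svalP q).1.2 _ _ (ltW a0) Wu); apply: mle => //; exact: WZ.
    by apply: (mge) => q Aq; rewrite ((svalP q).1.2 _ _ (ltW a0) Wu) ler_pM2l// mle.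
  have mp u : W u -> m u <= p0 u.
    by move=> Wu; apply: le_trans (mle _ _ Wu Aq0) _; exact: (svalP q0).2.
  by exists (exist _ m (conj sm mp)) => q Aq; apply/asboolP => u Wu; exact: mle.
have [sq qp] := svalP q; set L := sval q in sq qp.
have LD u v : W u -> W v -> L (u + v) = L u + L v.
  move=> Wu Wv; apply/eqP; rewrite eq_le sq.1//=.
  have tp u' : W u' -> tilt L v u' <= p0 u'.
    by move=> Wu'; apply: le_trans (tilt_leid sq Wv Wu') (qp _ Wu').
  have := qmax (exist _ (tilt L v) (conj (tilt_sublinear sq Wv) tp)).
  have -> : le q (exist _ (tilt L v) (conj (tilt_sublinear sq Wv) tp)).
    by apply/asboolP => u' Wu'; exact: tilt_leid.
  move=> /(_ isT)/asboolP/(_ _ Wu)/= h.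
  have := le_trans h (tilt_le sq Wv Wu ler01).
  by rewrite scale1r mul1r lerBrDr.
have LN u : W u -> L (- u) = - L u.
  move=> Wu; apply/eqP; rewrite -addr_eq0 -LD//; last exact: WN.
  by rewrite addNr sub0.
exists L; split => //.
- by move=> u Wu; apply: le_trans (qp _ Wu) _; exact: tilt_leid.
- move=> a u Wu; have [a0|a0] := leP 0 a; first exact: sq.2.
  rewrite -[a]opprK scaleNr LN; last exact: WZ.
  by rewrite sq.2 ?oppr_ge0 ?(ltW a0)// -mulNr.
apply/eqP; rewrite eq_le; apply/andP; split.
  by apply: le_trans (qp _ Wv0) _; exact: tilt_leid.
have := le_trans (qp _ (WN Wv0)) (tilt_le sp Wv0 (WN Wv0) ler01).
by rewrite LN// scale1r addNr sub0// mul1r sub0r lerN2.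
Qed.

End hahn_banach.

(** * Regularity of finite Borel measures *)

(** The type of the points of a space that is at the same time measurable and
    pseudometric; the statement that the two structures agree, that is that
    the sigma-algebra is the Borel one, is the hypothesis borel_sets below. *)
HB.structure Definition MetricMeasurable (R : numDomainType) d :=
  {T of PseudoMetric R T & Measurable d T}.

Definition borel_sets d (T : measurableType d) (O : set (set T)) :=
  d.-measurable = <<s O >>.

Lemma cvge_near_lt (R : realType) (u : (\bar R)^nat) (l M : \bar R) :
  u n @[n --> \oo] --> l -> (l < M)%E -> \forall n \near \oo, (u n < M)%E.
Proof.
move=> ul lM; apply: (ul [set x | x < M]%E); apply: open_nbhs_nbhs; split => //.
exact: open_ereal_lt_ereal.
Qed.

Section regularity.
Context (R : realType) d (T : MetricMeasurable.type R d).
Hypothesis borelT : borel_sets (@open T).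
Variable mu : {measure set T -> \bar R}.
Hypothesis fin_mu : (mu setT < +oo)%E.

Let open_mT (A : set T) : open A -> measurable A.
Proof. by move=> oA; rewrite borelT; exact: sub_sigma_algebra. Qed.

Let closed_mT (A : set T) : closed A -> measurable A.
Proof. by move=> cA; rewrite -[A]setCK; apply: measurableC; apply: open_mT; exact: closed_openC. Qed.

Let fin (A : set T) : measurable A -> (mu A < +oo)%E.
Proof. by move=> mA; apply: le_lt_trans fin_mu; apply: le_measure; rewrite ?inE. Qed.

Let regular (A : set T) := forall e : R, 0 < e -> exists F U : set T,
  [/\ closed F, open U, F `<=` A, A `<=` U & (mu (U `\` F) < e%:E)%E].

Let regularC A : regular A -> regular (~` A).
Proof.
move=> rA e e0; have [F [U [cF oU FA AU mUF]]] := rA e e0.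
exists (~` U), (~` F); split.
- by rewrite closedC.
- exact: closed_openC.
- exact: subsetC.
- exact: subsetC.
by rewrite setDE setCK setIC -setDE.
Qed.

(** A closed set is the intersection of its open 1/n-neighbourhoods, whose
    measures tend to that of the set since mu is finite. *)
Let regular_closed A : closed A -> regular A.
Proof.
move=> cA e e0; pose U n : set T := (\bigcup_(x in A) ball x (n.+1%:R^-1 : R))^°.
have oU n : open (U n) by exact: open_interior.
have AU n : A `<=` U n.
  move=> x Ax; apply/nbhs_ballP; exists n.+1%:R^-1 => /=; first by rewrite invr_gt0.
  by move=> y xy; exists x.
have ndU : nonincreasing_seq (fun n => U n `\` A).
  move=> m n mn; apply/subsetPset => x [Ux nA]; split => //.
  apply: (interiorS _ Ux) => y [z Az zy]; exists z => //.
  by apply: le_ball zy; rewrite lef_pV2 ?posrE// ler_nat.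
have capU : \bigcap_n (U n `\` A) = set0.
  apply/seteqP; split=> // x h; have [_ ] := h 0%N Logic.I; apply.
  suff: closure A x by rewrite -(closure_id A).1.
  move=> B /nbhs_ballP[r /= r0 rB].
  near \oo => n; have [/interior_subset[y Ay yx] _] := h n Logic.I.
  exists y; split => //; apply: rB; apply: ball_sym; apply: le_ball yx.
  by apply: ltW; near: n; exact: (near_infty_natSinv_lt (PosNum r0)).
have mU n : measurable (U n `\` A) by apply: measurableD; [exact: open_mT|exact: closed_mT].
have := @nonincreasing_cvg_mu _ _ _ mu (fun n => U n `\` A) (fin (mU 0%N)) mU.
have e0' : (0 < e%:E)%E by rewrite lte_fin.
rewrite capU measure0 => /(_ measurable0 ndU) cv0.
have [n _ /(_ n (leqnn n))/= h] := cvge_near_lt cv0 e0'.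
by exists A, (U n); split=> //; exact: h.
Unshelve. all: by end_near. Qed.

(** A countable union of closed sets need not be closed: the inner set is a
    finite union, whose measure is close enough by continuity of mu. *)
Let regular_bigcup (A : (set T)^nat) : (forall n, regular (A n)) -> regular (\bigcup_n A n).
Proof.
move=> rA e e0.
have e2 n : 0 < (e / 2) / (2 ^ n.+1)%:R :> R by rewrite !divr_gt0// ltr0n expn_gt0.
have /choice[F /choice[U FU]] := fun n => rA n _ (e2 n).
have cF n : closed (F n) by have [] := FU n.
have oU n : open (U n) by have [] := FU n.
pose V n := \bigcup_k U k `\` \bigcup_(k < n) F k.
have cVF n : closed (\bigcup_(k < n) F k).
  by rewrite bigcup_mkord; apply: closed_bigsetU.
have mV n : measurable (V n).
  by apply: measurableD; [apply: open_mT; exact: bigcup_open|exact: closed_mT].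
have ndV : nonincreasing_seq V.
  move=> m n mn; apply/subsetPset; apply: setDS => x [k /= km Fk].
  by exists k => //=; exact: leq_trans mn.
have capV : \bigcap_n V n = \bigcup_k U k `\` \bigcup_k F k.
  apply/seteqP; split=> [x h|x [Ux nF] n _]; last first.
    by split => // -[k _ Fk]; apply: nF; exists k.
  by split=> [|[k _ Fk]]; [have [] := h 0%N Logic.I|have [_] := h k.+1 Logic.I; apply; exists k => /=].
have mcV : measurable (\bigcap_n V n) by exact: bigcap_measurable.
have lt : (mu (\bigcap_n V n) < e%:E)%E.
  apply: (@le_lt_trans _ _ (\sum_(n <oo) ((e / 2) / (2 ^ n.+1)%:R)%:E)%E); last first.
    apply: (@le_lt_trans _ _ (e / 2)%:E); last by rewrite lte_fin; lra.
    by apply: epsilon_trick0; rewrite divr_ge0// ltW.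
  apply: (@le_trans _ _ (\sum_(n <oo) mu (U n `\` F n))%E); last first.
    by apply: lee_nneseries => // n _; have [_ _ _ _ /ltW] := FU n.
  apply: measure_sigma_subadditive => //.
    by move=> n; apply: measurableD; [exact: open_mT|exact: closed_mT].
  rewrite capV => x [[k _ Uk] nF]; exists k => //; split => // Fk.
  by apply: nF; exists k.
have := @nonincreasing_cvg_mu _ _ _ mu V (fin (mV 0%N)) mV mcV ndV.
move=> cvV; have [n _ /(_ n (leqnn n))/= h] := cvge_near_lt cvV lt.
exists (\bigcup_(k < n) F k), (\bigcup_k U k); split => //.
- exact: bigcup_open.
- by move=> x [k _ Fk]; exists k => //; have [_ _ + _ _] := FU k; exact.
- by move=> x [k _ Ak]; exists k => //; have [_ _ _ + _] := FU k; exact.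
Qed.

(** Finite Borel measures on a metric space are regular: the sets that can be
    squeezed between a closed and an open set of almost the same measure form
    a sigma-algebra that contains the closed sets. *)
Theorem borel_regular A : measurable A -> forall e : R, 0 < e ->
  exists F U : set T,
  [/\ closed F, open U, F `<=` A, A `<=` U & (mu (U `\` F) < e%:E)%E].
Proof.
rewrite borelT; move: A; apply: smallest_sub.
  split=> [|A rA|A rA].
  - by apply: regular_closed; exact: closed0.
  - by rewrite setTD; exact: regularC.
  - exact: regular_bigcup.
by move=> A oA; rewrite -[A]setCK; apply: regularC; apply: regular_closed; rewrite closedC.
Qed.

End regularity.

(** * Couplings from finitely additive set functions *)

(** An alias of the product type that carries the semiring of the measurable
    rectangles instead of the product sigma-algebra, so that Caratheodory
    extension applies to a set function defined on the rectangles. *)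
Definition rectangle d1 d2 (T1 : measurableType d1) (T2 : measurableType d2) : Type :=
  (T1 * T2)%type.

Definition rectangle_display : measure_display -> measure_display -> measure_display.
Proof. by move=> d1 d2; exact: default_measure_display. Qed.

Section rectangles.
Context d1 d2 (T1 : measurableType d1) (T2 : measurableType d2).

Definition rectangles : set (set (T1 * T2)) :=
  [set A `*` B | A in measurable & B in measurable].

Lemma rectangleX A B : measurable A -> measurable B -> rectangles (A `*` B).
Proof. by move=> mA mB; exists A => //; exists B. Qed.

Let rect0 : rectangles set0.
Proof. by exists set0 => //; exists set0 => //; rewrite setX0. Qed.

Let rectI : setI_closed rectangles.
Proof.
move=> _ _ [A mA [B mB <-]] [A' mA' [B' mB' <-]]; rewrite -setXI.
by apply: rectangleX; exact: measurableI.
Qed.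

Let rectD : semi_setD_closed rectangles.
Proof.
move=> _ _ [A mA [B mB <-]] [A' mA' [B' mB' <-]].
exists [set (A `\` A') `*` B; (A `&` A') `*` (B `\` B')]; split.
- exact: finite_set2.
- move=> _ [->|->]; apply: rectangleX => //.
  + exact: measurableD.
  + exact: measurableI.
  + exact: measurableD.
- apply/seteqP; split=> [[x y] /= [[Ax By] nAB]|[x y] [_ /= [->|->]] /=].
  + have [A'x|nA'x] := pselect (A' x).
      by exists ((A `&` A') `*` (B `\` B')); [right|split => //=; split => // B'y; exact: nAB].
    by exists ((A `\` A') `*` B); [left|].
  + by move=> [[Ax nA'x] By]; split => // -[].
  + by move=> [[Ax A'x] [By nB'y]]; split => // -[].
- move=> _ _ [->|->] [->|->] //= [[x y]] /= [[]] /=.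
  + by move=> [_ nA] _ [[_ /nA]].
  + by move=> [_ A'x] _ [[_ /(_ A'x)]].
Qed.

HB.instance Definition _ := Pointed.on (rectangle T1 T2).
HB.instance Definition _ := @isSemiRingOfSets.Build (rectangle_display d1 d2)
  (rectangle T1 T2) rectangles rect0 rectI rectD.

End rectangles.

Section finitely_additive_coupling.
Context (R : realType) d1 d2 (T1 : MetricMeasurable.type R d1) (T2 : MetricMeasurable.type R d2).
Hypotheses (borelT1 : borel_sets (@open T1)) (borelT2 : borel_sets (@open T2)).
Variables (mu : {measure set T1 -> \bar R}) (nu : {measure set T2 -> \bar R}).
Hypotheses (fin_mu : (mu setT < +oo)%E) (fin_nu : (nu setT < +oo)%E).
Variables (K1 : set T1) (K2 : set T2).
Hypotheses (cK1 : compact K1) (cK2 : compact K2).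
Variable l : set (T1 * T2) -> R.
Hypotheses (l_ge0 : forall S, 0 <= l S)
  (lU : forall S S', S `&` S' = set0 -> l (S `|` S') = l S + l S')
  (lK : forall S, l S = l (S `&` K1 `*` K2))
  (l_fst : forall A, measurable A -> (l (A `*` setT))%:E = mu A)
  (l_snd : forall A, measurable A -> (l (setT `*` A))%:E = nu A).

Let l0 : l set0 = 0.
Proof. by have := lU (setI0 set0); rewrite setU0; lra. Qed.

Let le_l S S' : S `<=` S' -> l S <= l S'.
Proof.
move=> SS'; by rewrite -(setDUK SS') lU ?lerDl// setDIK.
Qed.

Let le_lU S S' : l (S `|` S') <= l S + l S'.
Proof.
have -> : S `|` S' = S `|` (S' `\` S).
  by apply/seteqP; split=> x; [move=> [Sx|S'x]; have [|nS] := pselect (S x); by [left|right]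
    |move=> [|[]]; by [left|right]].
by rewrite lU ?lerD2l; [apply: le_l; exact: subDsetl|rewrite setDIK].
Qed.

(** Passing from a rectangle to a smaller one loses no more than the marginal
    measures of what is removed from the two sides. *)
Let le_lX A B A' B' : measurable A -> measurable B -> measurable A' -> measurable B' ->
  ((l (A `*` B))%:E <= (l ((A' `&` K1) `*` (B' `&` K2)))%:E + mu (A `\` A') + nu (B `\` B'))%E.
Proof.
move=> mA mB mA' mB'; have mAD := measurableD mA mA'; have mBD := measurableD mB mB'.
rewrite -l_fst// -l_snd// -!EFinD lee_fin lK.
apply: le_trans (lerD (le_lU _ _) (lexx _)); apply: le_trans (le_lU _ _).
apply: le_l => -[x y] [/= [Ax By] [Kx Ky]].
have [A'x|] := pselect (A' x); last by move=> nA; left; right.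
by have [B'y|] := pselect (B' y); [left; left|move=> nB; right].
Qed.

Let le_l_bigcup n (F : nat -> set (T1 * T2)) :
  l (\bigcup_(k < n) F k) <= \sum_(0 <= k < n) l (F k).
Proof.
elim: n => [|n IH]; first by rewrite bigcup_mkord big_ord0 l0 big_nil.
rewrite bigcup_mkord big_ord_recr/= big_nat_recr//= -bigcup_mkord.
by apply: le_trans (le_lU _ _) _; rewrite lerD2r.
Qed.

Let lE : set (rectangle T1 T2) -> \bar R := fun S => (l S)%:E.

Let lE_ge0 S : (0 <= lE S)%E. Proof. by rewrite lee_fin. Qed.

Let lE_additive : measure_function.semi_additive lE.
Proof.
move=> F n _ tF _; elim: n => [|n IH]; first by rewrite !big_ord0 /lE l0.
rewrite !big_ord_recr/= -IH /lE lU ?EFinD//.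
rewrite -bigcup_mkord setI_bigcupl bigcup0// => i /= iltn.
by move/trivIsetP: tF => /(_ i n Logic.I Logic.I); apply; rewrite neq_ltn iltn.
Qed.

HB.instance Definition _ := isContent.Build _ _ _ lE lE_ge0 lE_additive.

Let open_mT1 (A : set T1) : open A -> measurable A.
Proof. by move=> oA; rewrite borelT1; exact: sub_sigma_algebra. Qed.

Let open_mT2 (A : set T2) : open A -> measurable A.
Proof. by move=> oA; rewrite borelT2; exact: sub_sigma_algebra. Qed.

Let closed_mT1 (A : set T1) : closed A -> measurable A.
Proof. by move=> cA; rewrite -[A]setCK; apply: measurableC; apply: open_mT1; exact: closed_openC. Qed.

Let closed_mT2 (A : set T2) : closed A -> measurable A.
Proof. by move=> cA; rewrite -[A]setCK; apply: measurableC; apply: open_mT2; exact: closed_openC. Qed.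

Let openX (A : set T1) (B : set T2) : open A -> open B -> open (A `*` B).
Proof.
move=> oA oB; rewrite openE => -[x y] [/= Ax By].
by exists (A, B) => //; split => /=; exact: open_nbhs_nbhs.
Qed.

(** Countable subadditivity on rectangles is where compactness enters: by
    regularity of the marginals, the covered rectangle may be replaced by a
    compact one and the covering rectangles by open ones, at an arbitrarily
    small cost, and then finitely many of them suffice. *)
Let lE_subadditive : measurable_subset_sigma_subadditive lE.
Proof.
move=> S F mF [A mA [B mB <-]] sub.
have /choice[A_ /choice[B_ AB]] n : exists X Y,
    [/\ d1.-measurable X, d2.-measurable Y & X `*` Y = F n].
  by have [X mX [Y mY E]] := mF n; exists X, Y.
apply/lee_addgt0Pr => _/posnumP[e].
(* Each side of the compact approximation of S costs e/4, and the open
   approximations of the F n cost the sum of the dl n, that is e/2. *)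
have e4 : 0 < e%:num / 4 :> R by [].
have [C1 [V1 [cC1 oV1 C1A AV1 mu1]]] := borel_regular borelT1 fin_mu mA e4.
have [C2 [V2 [cC2 oV2 C2B BV2 nu2]]] := borel_regular borelT2 fin_nu mB e4.
have mAC : (mu (A `\` C1) <= (e%:num / 4)%:E)%E.
  apply: le_trans (ltW mu1); apply: le_measure; rewrite ?inE; last exact: setSD.
    by apply: measurableD => //; exact: closed_mT1.
  by apply: measurableD; [exact: open_mT1|exact: closed_mT1].
have mBC : (nu (B `\` C2) <= (e%:num / 4)%:E)%E.
  apply: le_trans (ltW nu2); apply: le_measure; rewrite ?inE; last exact: setSD.
    by apply: measurableD => //; exact: closed_mT2.
  by apply: measurableD; [exact: open_mT2|exact: closed_mT2].
pose dl n : R := (e%:num / 2) / (2 ^ n.+1)%:R.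
have dl0 n : 0 < dl n / 2 by rewrite !divr_gt0// ltr0n expn_gt0.
have /choice[U1 hU1] n : exists U, [/\ open U, A_ n `<=` U & (mu (U `\` A_ n) <= (dl n / 2)%:E)%E].
  have [mAn _ _] := AB n.
  have [G [U [cG oU GA AU h]]] := borel_regular borelT1 fin_mu mAn (dl0 n).
  exists U; split => //; apply: le_trans (ltW h); apply: le_measure; rewrite ?inE.
  - by apply: measurableD => //; exact: open_mT1.
  - by apply: measurableD; [exact: open_mT1|exact: closed_mT1].
  - exact: setDS.
have /choice[U2 hU2] n : exists U, [/\ open U, B_ n `<=` U & (nu (U `\` B_ n) <= (dl n / 2)%:E)%E].
  have [_ mBn _] := AB n.
  have [G [U [cG oU GA AU h]]] := borel_regular borelT2 fin_nu mBn (dl0 n).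
  exists U; split => //; apply: le_trans (ltW h); apply: le_measure; rewrite ?inE.
  - by apply: measurableD => //; exact: open_mT2.
  - by apply: measurableD; [exact: open_mT2|exact: closed_mT2].
  - exact: setDS.
have lU_le n : ((l (U1 n `*` U2 n))%:E <= lE (F n) + (dl n)%:E)%E.
  have [oU1 _ h1] := hU1 n; have [oU2 _ h2] := hU2 n; have [mAn mBn FE] := AB n.
  apply: le_trans (le_lX (open_mT1 oU1) (open_mT2 oU2) mAn mBn) _.
  have -> : dl n = dl n / 2 + dl n / 2 by rewrite -splitr.
  rewrite EFinD addeA; apply: leeD => //; apply: leeD => //.
  rewrite /lE -FE lee_fin; apply: le_l; apply: setSX; exact: subIsetl.
pose C := (C1 `&` K1) `*` (C2 `&` K2).
have cC : compact C by apply: compact_setX; rewrite setIC; exact: compact_closedI.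
have [n _ /(_ _ (leqnn n))/= Cn] : \forall n \near \oo,
    C `<=` (fun z => exists2 k, (k < n)%N & (U1 k `*` U2 k) z).
  move/compact_near_coveringP : cC; apply => -[x y] [/= [C1x _] [C2y _]].
  have [k _] := sub (x, y) (conj (C1A _ C1x) (C2B _ C2y)).
  have [_ _ <-] := AB k => -[/= Ax By].
  exists (U1 k `*` U2 k, [set n | (k < n)%N]) => /=.
    split; last exact: nbhs_infty_gt.
    have [oU1 AU1 _] := hU1 k; have [oU2 BU2 _] := hU2 k.
    by apply: open_nbhs_nbhs; split; [exact: openX|split; [exact: AU1|exact: BU2]].
  by move=> [z n] /= [Uz kn]; exists k.
apply: le_trans (le_lX mA mB (closed_mT1 cC1) (closed_mT2 cC2)) _.
apply: (@le_trans _ _ ((l C)%:E + (e%:num / 4)%:E + (e%:num / 4)%:E)%E).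
  by apply: leeD => //; apply: leeD.
have -> : ((l C)%:E + (e%:num / 4)%:E + (e%:num / 4)%:E = (l C)%:E + (e%:num / 2)%:E)%E.
  by rewrite -!EFinD; congr EFin; lra.
have -> : (\sum_(0 <= n <oo) lE (F n) + (e%:num)%:E = \sum_(0 <= n <oo) lE (F n) + (e%:num / 2)%:E + (e%:num / 2)%:E)%E.
  by rewrite -addeA -EFinD -splitr.
apply: leeD => //; apply: le_trans (epsilon_trick _ _ _) => //.
apply: (@le_trans _ _ (\sum_(0 <= k < n) (l (U1 k `*` U2 k))%:E)%E).
  by rewrite sumEFin lee_fin; apply: le_trans (le_l_bigcup _ _); exact: le_l.
apply: (@le_trans _ _ (\sum_(0 <= k < n) (lE (F k) + (dl k)%:E))%E).
  by apply: lee_sum => k _.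
apply: nneseries_lim_ge => k _ _; rewrite adde_ge0// lee_fin ltW//.
by rewrite !divr_gt0// ltr0n expn_gt0.
Qed.

HB.instance Definition _ :=
  Content_SigmaSubAdditive_isMeasure.Build _ _ _ lE lE_subadditive.

(** A finitely additive set function whose marginals are Borel measures and
    that is carried by a compact rectangle is the trace on the rectangles of
    a measure. *)
Theorem coupling_of_finitely_additive :
  exists g : {measure set (T1 * T2) -> \bar R},
    forall A B, measurable A -> measurable B -> g (A `*` B) = (l (A `*` B))%:E.
Proof.
pose G : {measure set (g_sigma_algebraType (@measurable _ (rectangle T1 T2))) -> \bar R} :=
  [the measure _ _ of measure_extension lE].
have mid : measurable_fun setT (id : g_sigma_algebraType (@measurable _ (rectangle T1 T2)) -> T1 * T2).
  move=> _ Y; rewrite setTI measurable_prod_measurableType => h; exact: h.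
exists (@measure_function_pushforward__canonical__measure_function_Measure
  _ _ _ _ _ G _ mid) => A B mA mB.
rewrite /= /pushforward /=; change (measure_extension lE (A `*` B) = lE (A `*` B)).
by apply: measurable_mu_extE; exact: rectangleX.
Qed.

End finitely_additive_coupling.

(** * Infima over a compact set *)

Section compact_infimum.
Context (R : realType).

Lemma within_continuousP (T : topologicalType) (D : set T) (f : T -> R) :
  {within D, continuous f} <->
  forall x, D x -> forall e, 0 < e -> \forall x' \near x, D x' -> `|f x - f x'| < e.
Proof.
split=> [/subspace_continuousP cf x Dx e e0|cf].
  by have /cvgrPdist_lt/(_ _ e0) := cf x Dx.
apply/subspace_continuousP => x Dx; apply/cvgrPdist_lt => e e0.
exact: cf.
Qed.

Lemma compact_continuous_bounded (T : topologicalType) (K : set T) (f : T -> R) :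
  compact K -> {within K, continuous f} -> exists M, forall x, K x -> `|f x| <= M.
Proof.
move=> cK cf; have [->|/set0P K0] := eqVneq K set0; first by exists 0.
have [a _ amax] := compact_EVT_max K0 cK cf.
have [b _ bmin] := compact_EVT_min K0 cK cf.
exists (`|f a| + `|f b|) => x Kx; rewrite ler_norml; apply/andP; split.
  apply: le_trans (bmin _ (mem_set Kx)); rewrite lerNl.
  by apply: le_trans (ler_norm _) _; rewrite normrN lerDr.
apply: le_trans (amax _ (mem_set Kx)) _; apply: le_trans (ler_norm _) _.
by rewrite lerDl.
Qed.

Variables (T1 T2 : topologicalType) (D : set T1) (K : set T2) (c : T1 -> T2 -> R).
Hypotheses (cK : compact K) (K0 : K !=set0).
Hypothesis cc : {within D `*` K, continuous (fun z => c z.1 z.2)}.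

(** Tube lemma: over a compact K, joint continuity in (x, y) gives continuity
    in x uniformly in y. *)
Lemma uniformly_near x : D x -> forall e, 0 < e ->
  \forall x' \near x, D x' -> forall y, K y -> `|c x y - c x' y| < e.
Proof.
move=> Dx e e0; have e2 : 0 < e / 2 by rewrite divr_gt0.
have : near_covering_within K by apply/near_covering_withinP/compact_near_coveringP.
move=> /(_ _ (nbhs x) (fun x' y => D x' -> `|c x y - c x' y| < e))-/(_ _ _)h.
have {}h : \forall x' \near x, K `<=` (fun y => D x' -> `|c x y - c x' y| < e).
  apply: h => y Ky; have [[V U] /= [Vy Ux] UV] := (within_continuousP _ _).1 cc (x, y) (conj Dx Ky) _ e2.
  exists (U, V) => //= -[y' x'] /= [Uy' Vx'] Ky' Dx'.
  have h1 := UV (x', y') (conj Vx' Uy') (conj Dx' Ky').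
  have h2 := UV (x, y') (conj (nbhs_singleton Vy) Uy') (conj Dx Ky').
  rewrite (_ : _ - _ = (c x y - c x' y') - (c x y - c x y')); last by lra.
  by rewrite (splitr e); apply: le_lt_trans (ler_normB _ _) _; exact: ltrD.
by apply: filterS h => x' h Dx' y Ky; exact: h.
Qed.

Lemma continuous_slice x : D x -> {within K, continuous (c x)}.
Proof.
move=> Dx; apply/within_continuousP => y Ky e e0.
have [[V U] /= [Vx Uy] UV] := (within_continuousP _ _).1 cc (x, y) (conj Dx Ky) _ e0.
apply: filterS Uy => y' Uy' Ky'.
exact: (UV (x, y') (conj (nbhs_singleton Vx) Uy') (conj Dx Ky')).
Qed.

(** The functions c(., y) - g y are equicontinuous at each point, uniformly in
    y by the tube lemma, so their infimum is continuous. *)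
Lemma continuous_inf (g : T2 -> R) :
  (forall x, D x -> has_lbound [set c x y - g y | y in K]) ->
  {within D, continuous (fun x => inf [set c x y - g y | y in K])}.
Proof.
move=> lb; apply/within_continuousP => x Dx e e0.
have le a b : D a -> D b -> (forall y, K y -> `|c a y - c b y| < e / 2) ->
    inf [set c a y - g y | y in K] - inf [set c b y - g y | y in K] <= e / 2.
  move=> Da Db h; rewrite lerBlDr -lerBlDl; apply: lb_le_inf.
    by have [y Ky] := K0; exists (c b y - g y), y.
  move=> _ [y Ky <-]; rewrite lerBlDl.
  apply: (@le_trans _ _ (c a y - g y)); first by apply: ge_inf; [exact: lb|exists y].
  by have := h _ Ky; rewrite ltr_norml => /andP[_]; lra.
have e2 : 0 < e / 2 by rewrite divr_gt0.
apply: filterS (uniformly_near Dx e2) => x' h Dx'.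
apply: (@le_lt_trans _ _ (e / 2)); last by lra.
rewrite ler_norml; apply/andP; split; last exact: (le x x' Dx Dx' (h Dx')).
rewrite lerNl opprB; apply: le => // y Ky; rewrite distrC; exact: h.
Qed.

Lemma inf_attained x (g : T2 -> R) : D x -> {within K, continuous g} ->
  exists2 y, K y & inf [set c x y - g y | y in K] = c x y - g y /\
    forall y', K y' -> c x y - g y <= c x y' - g y'.
Proof.
move=> Dx cg.
have cxg : {within K, continuous (fun y => c x y - g y)}.
  by move=> y; apply: cvgB; [exact: (continuous_slice Dx)|exact: cg].
have [y /set_mem Ky ymin] := compact_EVT_min K0 cK cxg.
have ymin' y' : K y' -> c x y - g y <= c x y' - g y' by move=> /mem_set/ymin.
exists y => //; split => //.
apply/eqP; rewrite eq_le; apply/andP; split.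
  apply: ge_inf; last by exists y.
  by exists (c x y - g y) => _ [y' Ky' <-]; exact: ymin'.
apply: lb_le_inf; first by exists (c x y - g y), y.
by move=> _ [y' Ky' <-]; exact: ymin'.
Qed.

End compact_infimum.

Section borel_measurability.
Context (R : realType) d (T : MetricMeasurable.type R d).
Hypothesis borelT : borel_sets (@open T).

Lemma borel_open (A : set T) : open A -> measurable A.
Proof. by move=> oA; rewrite borelT; exact: sub_sigma_algebra. Qed.

Lemma borel_closed (A : set T) : closed A -> measurable A.
Proof. by move=> cA; rewrite -[A]setCK; apply: measurableC; apply: borel_open; exact: closed_openC. Qed.

Lemma within_continuous_measurable (D : set T) (f : T -> R) : measurable D ->
  {within D, continuous f} -> measurable_fun D f.
Proof.
move=> mD cf; apply: (measurability _ (RGenOInfty.measurableE R)).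
move=> _ [_ [a ->] <-].
have /continuousP/(_ `]a, +oo[%classic) : continuous (f : subspace D -> R) by [].
move=> /(_ (rray_open a))/open_subspaceP[V oV VE].
by rewrite setIC -VE; apply: measurableI => //; exact: borel_open.
Qed.

End borel_measurability.

(** * Attained Kantorovich duality *)

(** Being null is a local property on a compact set: finitely many of the given
    neighbourhoods cover it. *)
Lemma compact_negligible (R : realType) d (T : MetricMeasurable.type R d)
    d' (T' : MetricMeasurable.type R d') (mu : {measure set (T * T') -> \bar R})
    (K N : set (T * T')) : compact K ->
  (forall z, K z -> exists2 U, nbhs z U & mu.-negligible (U `&` N)) ->
  mu.-negligible (K `&` N).
Proof.
move=> cK loc.
(* The filter of the properties that hold of all large enough null sets:
   near-covering along it is the extraction of a finite subcover. *)
pose F : set_system (set (T * T')) := fun Q => exists2 Z, mu.-negligible Z &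
  forall Z', mu.-negligible Z' -> Z `<=` Z' -> Q Z'.
have FF : Filter F.
  split.
  - by exists set0 => //; exact: negligible_set0.
  - move=> P Q [Z nZ ZP] [Z' nZ' ZQ]; exists (Z `|` Z'); first exact: negligibleU.
    by move=> Y nY ZY; split; [apply: ZP|apply: ZQ] => // z Zz; apply: ZY; [left|right].
  - by move=> P Q PQ [Z nZ ZP]; exists Z => // Y nY ZY; apply: PQ; exact: ZP.
have := (compact_near_coveringP _).1 cK _ F (fun Z z => N z -> Z z) FF.
case=> [z Kz|Z nZ /(_ _ nZ (@subset_refl _ Z)) KZ].
  have [U Uz nU] := loc z Kz.
  exists (U, [set Z | U `&` N `<=` Z]) => /=.
    by split => //; exists (U `&` N).
  by move=> [z' Z] /= [Uz' UZ] Nz'; exact: UZ.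
by apply: negligibleS nZ => z [Kz Nz]; exact: KZ.
Qed.

Section kantorovich_attained.
Context (R : realType) d1 d2 (T1 : MetricMeasurable.type R d1) (T2 : MetricMeasurable.type R d2).
Hypotheses (borelT1 : borel_sets (@open T1)) (borelT2 : borel_sets (@open T2)).
Variables (mu : {measure set T1 -> \bar R}) (nu : {measure set T2 -> \bar R}).
Hypotheses (fin_mu : (mu setT < +oo)%E) (fin_nu : (nu setT < +oo)%E).
Variables (K1 : set T1) (K2 : set T2).
Hypotheses (cK1 : compact K1) (cK2 : compact K2) (mK1 : measurable K1)
  (mK2 : measurable K2) (K10 : K1 !=set0) (K20 : K2 !=set0).
Hypotheses (muK1 : mu (~` K1) = 0%E) (nuK2 : nu (~` K2) = 0%E).
Variable c : T1 -> T2 -> R.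
Hypothesis c_ge0 : forall x y, K1 x -> K2 y -> 0 <= c x y.
Hypothesis cc : {within K1 `*` K2, continuous (fun z => c z.1 z.2)}.

Let integrable1 (f : T1 -> R) := mu.-integrable K1 (EFin \o f).
Let integrable2 (h : T2 -> R) := nu.-integrable K2 (EFin \o h).
Let J (f : T1 -> R) (h : T2 -> R) := \int[mu]_(x in K1) f x + \int[nu]_(y in K2) h y.

Let cont_integrable1 f : {within K1, continuous f} -> integrable1 f.
Proof.
move=> cf; apply: measurable_bounded_integrable => //.
- by apply: le_lt_trans fin_mu; apply: le_measure; rewrite ?inE.
- exact: within_continuous_measurable.
have [M fM] := compact_continuous_bounded cK1 cf.
exists M; split; first exact: num_real.
by move=> x /ltW Mx y Ky; apply: le_trans Mx; exact: fM.
Qed.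

Let cont_integrable2 f : {within K2, continuous f} -> integrable2 f.
Proof.
move=> cf; apply: measurable_bounded_integrable => //.
- by apply: le_lt_trans fin_nu; apply: le_measure; rewrite ?inE.
- exact: within_continuous_measurable.
have [M fM] := compact_continuous_bounded cK2 cf.
exists M; split; first exact: num_real.
by move=> x /ltW Mx y Ky; apply: le_trans Mx; exact: fM.
Qed.

Let ccT : {within K2 `*` K1, continuous (fun z => c z.2 z.1)}.
Proof.
apply/within_continuousP => -[y x] [/= Ky Kx] e e0.
have [[V U] /= [Vx Uy] UV] := (within_continuousP _ _).1 cc (x, y) (conj Kx Ky) _ e0.
exists (U, V) => //= -[y' x'] [/= Uy' Vx'] [Ky' Kx'].
exact: (UV (x', y') (conj Vx' Uy') (conj Kx' Ky')).
Qed.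

Let c_bounded : exists M, forall x y, K1 x -> K2 y -> `|c x y| <= M.
Proof.
have [M h] := compact_continuous_bounded (compact_setX cK1 cK2) cc.
by exists M => x y Kx Ky; exact: (h (x, y)).
Qed.

Let ctr_lb h x : {within K2, continuous h} -> K1 x ->
  has_lbound [set c x y - h y | y in K2].
Proof.
move=> ch Kx; have [y Ky [_ ymin]] := inf_attained cK2 K20 cc Kx ch.
by exists (c x y - h y) => _ [y' Ky' <-]; exact: ymin.
Qed.

Let ctr_cont h : {within K2, continuous h} -> {within K1, continuous (c_transform K2 c h)}.
Proof. by move=> ch; apply: continuous_inf => // x Kx; exact: ctr_lb. Qed.

Let ctr_le h x y : {within K2, continuous h} -> K1 x -> K2 y ->
  c_transform K2 c h x + h y <= c x y.
Proof.
by move=> ch Kx Ky; rewrite -lerBrDr; apply: ge_inf; [exact: ctr_lb|exists y].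
Qed.

Let kantorovichE h : {within K2, continuous h} ->
  kantorovich K1 K2 c mu nu h = (J (c_transform K2 c h) h)%:E.
Proof.
move=> ch; rewrite /kantorovich /J EFinD /Rintegral !fineK//.
- by apply: integrable_fin_num => //; exact: cont_integrable2.
- by apply: integrable_fin_num => //; apply: cont_integrable1; exact: ctr_cont.
Qed.

Variable phi : T2 -> R.
Hypothesis cphi : {within K2, continuous phi}.
Hypothesis phi_max : forall h, {within K2, continuous h} ->
  (kantorovich K1 K2 c mu nu h <= kantorovich K1 K2 c mu nu phi)%E.

Let m := J (c_transform K2 c phi) phi.

(** Replacing h by the largest function compatible with f makes it continuous
    and increases J, and replacing f by the c-transform increases J again. *)
Let J_le_max f h : integrable1 f -> integrable2 h ->
  (forall x y, K1 x -> K2 y -> f x + h y <= c x y) -> J f h <= m.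
Proof.
move=> If Ih fh; have [M cM] := c_bounded; have [y0 Ky0] := K20.
pose h' y := inf [set c x y - f x | x in K1].
have lb y : K2 y -> has_lbound [set c x y - f x | x in K1].
  move=> Ky; exists (h y0 - M) => _ [x Kx <-].
  have := fh x y0 Kx Ky0; have := c_ge0 Kx Ky; have := cM x y0 Kx Ky0.
  by rewrite ler_norml => /andP[_]; lra.
have ch' : {within K2, continuous h'}.
  exact: (@continuous_inf _ _ _ K2 K1 (fun y x => c x y) cK1 K10 ccT f lb).
have hh' y : K2 y -> h y <= h' y.
  move=> Ky; apply: lb_le_inf; first by have [x Kx] := K10; exists (c x y - f x), x.
  by move=> _ [x Kx <-]; rewrite lerBrDl; exact: fh.
have ff' x : K1 x -> f x <= c_transform K2 c h' x.
  move=> Kx; apply: lb_le_inf; first by exists (c x y0 - h' y0), y0.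
  move=> _ [y Ky <-]; rewrite lerBrDl -lerBrDr; apply: ge_inf; first exact: lb.
  by exists x.
apply: (@le_trans _ _ (J (c_transform K2 c h') h')).
  apply: lerD; apply: le_Rintegral => //.
  - by apply: cont_integrable1; exact: ctr_cont.
  - exact: cont_integrable2.
by have := phi_max ch'; rewrite !kantorovichE// lee_fin.
Qed.

(** Functions of two variables with values in the regular module R^o, so that
    they form an lmodType; W is the subspace of the functions that are bounded
    on K1 x K2, which contains the indicators of all sets. *)
Let V := (T1 * T2 -> R^o)%type.
Let ev (u : V) x y : R := u (x, y).
Let W : set V := [set u | exists M, forall x y, K1 x -> K2 y -> `|ev u x y| <= M].

Let W0 : W 0.
Proof. by exists 0 => x y _ _; rewrite normr0. Qed.

Let WD u v : W u -> W v -> W (u + v).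
Proof.
move=> [M uM] [N vN]; exists (M + N) => x y Kx Ky.
by apply: le_trans (ler_normD _ _) _; apply: lerD; [exact: uM|exact: vN].
Qed.

Let WZ (a : R) u : W u -> W (a *: u).
Proof.
by move=> [M uM]; exists (`|a| * M) => x y Kx Ky; rewrite normrM ler_wpM2l//; exact: uM.
Qed.

Let dominating (u : V) : set ((T1 -> R) * (T2 -> R)) :=
  [set f | [/\ integrable1 f.1, integrable2 f.2 &
    forall x y, K1 x -> K2 y -> ev u x y <= f.1 x + f.2 y]].

Let Theta (u : V) := inf [set J f.1 f.2 | f in dominating u].

Let JD f h f' h' : integrable1 f -> integrable2 h -> integrable1 f' -> integrable2 h' ->
  J (fun x => f x + f' x) (fun y => h y + h' y) = J f h + J f' h'.
Proof. by move=> *; rewrite /J !RintegralD// addrACA. Qed.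

Let JZ a f h : integrable1 f -> integrable2 h ->
  J (fun x => a * f x) (fun y => a * h y) = a * J f h.
Proof. by move=> *; rewrite /J !RintegralZl// mulrDr. Qed.

Let integrable1Z a f : integrable1 f -> integrable1 (fun x => a * f x).
Proof. by move=> If; exact: (integrableZl mK1 a If). Qed.

Let integrable2Z a f : integrable2 f -> integrable2 (fun x => a * f x).
Proof. by move=> If; exact: (integrableZl mK2 a If). Qed.

Let integrable1D f g : integrable1 f -> integrable1 g -> integrable1 (fun x => f x + g x).
Proof. by move=> If Ig; exact: (integrableD mK1 If Ig). Qed.

Let integrable2D f g : integrable2 f -> integrable2 g -> integrable2 (fun x => f x + g x).
Proof. by move=> If Ig; exact: (integrableD mK2 If Ig). Qed.

Let cst1 a : integrable1 (fun=> a).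
Proof. by apply: cont_integrable1; apply: continuous_subspaceT => x; exact: cst_continuous. Qed.

Let cst2 a : integrable2 (fun=> a).
Proof. by apply: cont_integrable2; apply: continuous_subspaceT => x; exact: cst_continuous. Qed.

Let J0 : J (fun=> 0) (fun=> 0) = 0.
Proof. by rewrite /J !Rintegral_cst// !mul0r addr0. Qed.

Let Theta_lb u : W u -> has_lbound [set J f.1 f.2 | f in dominating u].
Proof.
move=> [M uM]; exists (- (m + J (fun=> M) (fun=> 0))) => _ [[f h] /= [If Ih fh] <-].
have : J (fun x => -1 * f x + -1 * M) (fun y => -1 * h y + -1 * 0) <= m.
  apply: J_le_max.
  - by apply: integrable1D; exact: integrable1Z.
  - by apply: integrable2D; exact: integrable2Z.
  - move=> x y Kx Ky; have /= := fh _ _ Kx Ky; have := c_ge0 Kx Ky; have := uM _ _ Kx Ky.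
    by rewrite ler_norml => /andP[]; lra.
by rewrite JD ?JZ//; [lra|exact: integrable1Z|exact: integrable2Z].
Qed.

Let Theta_le u f h : W u -> integrable1 f -> integrable2 h ->
  (forall x y, K1 x -> K2 y -> ev u x y <= f x + h y) -> Theta u <= J f h.
Proof. by move=> Wu If Ih fh; apply: ge_inf; [exact: Theta_lb|exists (f, h)]. Qed.

Let Theta_ge u b : W u -> (forall f h, integrable1 f -> integrable2 h ->
  (forall x y, K1 x -> K2 y -> ev u x y <= f x + h y) -> b <= J f h) -> b <= Theta u.
Proof.
move=> [M uM] H; apply: lb_le_inf.
  exists (J (fun=> M) (fun=> 0)), (fun=> M, fun=> 0) => //; split => //= x y Kx Ky.
  by rewrite addr0 (le_trans (ler_norm _))// uM.
by move=> _ [[f h] [/= If Ih fh] <-]; exact: H.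
Qed.

Let Theta_sublinear : sublinear_on W Theta.
Proof.
have TD u v : W u -> W v -> Theta (u + v) <= Theta u + Theta v.
  move=> Wu Wv; rewrite -lerBlDl; apply: Theta_ge => // f h If Ih fh.
  rewrite lerBlDl -lerBlDr; apply: Theta_ge => // f' h' If' Ih' fh'.
  rewrite lerBlDr -JD//; apply: Theta_le; [exact: WD|exact: integrable1D|exact: integrable2D|].
  move=> x y Kx Ky; have := fh _ _ Kx Ky; have := fh' _ _ Kx Ky.
  by rewrite (_ : ev (u + v) x y = ev u x y + ev v x y)//; lra.
have TZ_le a u : 0 < a -> W u -> a * Theta u <= Theta (a *: u).
  move=> a0 Wu; apply: Theta_ge; first exact: WZ.
  move=> f h If Ih fh; rewrite -ler_pdivlMl// -JZ//.
  apply: Theta_le => //; [exact: integrable1Z|exact: integrable2Z|].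
  move=> x y Kx Ky; rewrite -mulrDr ler_pdivlMl//; exact: fh.
have TZ a u : 0 < a -> W u -> Theta (a *: u) = a * Theta u.
  move=> a0 Wu; apply/eqP; rewrite eq_le TZ_le// andbT -ler_pdivrMl//.
  apply: le_trans (TZ_le _ _ _ _) _; rewrite ?invr_gt0//; first exact: WZ.
  by rewrite scalerA mulVf ?gt_eqF// scale1r.
split=> // a u; rewrite le_eqVlt => /predU1P[<- _|a0]; last exact: TZ.
rewrite scale0r mul0r; have := TZ 2 0 (ltr0n _ 2) W0.
by rewrite scaler0; lra.
Qed.

Let cost : V := fun z => c z.1 z.2.

Let Wcost : W cost.
Proof. by have [M cM] := c_bounded; exists M => x y; exact: cM. Qed.

Let WN u : W u -> W (- u).
Proof. by move=> /(WZ (-1)); rewrite scaleN1r. Qed.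

Section functional.
Variable L : V -> R.
Hypotheses (L_Theta : forall u, W u -> L u <= Theta u)
  (LD : forall u v, W u -> W v -> L (u + v) = L u + L v)
  (LZ : forall a u, W u -> L (a *: u) = a * L u)
  (L_cost : L cost <= m).

Let LN u : W u -> L (- u) = - L u.
Proof. by move=> Wu; rewrite -scaleN1r LZ// mulN1r. Qed.

Let L_le0 u : W u -> (forall x y, K1 x -> K2 y -> ev u x y <= 0) -> L u <= 0.
Proof.
move=> Wu u0; apply: le_trans (L_Theta Wu) _; rewrite -J0.
by apply: Theta_le => // x y Kx Ky; rewrite addr0 u0.
Qed.

Let L_le u v : W u -> W v -> (forall x y, K1 x -> K2 y -> ev u x y <= ev v x y) -> L u <= L v.
Proof.
move=> Wu Wv uv; rewrite -subr_le0 -LN// -LD//; last exact: WN.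
by apply: L_le0 => [|x y Kx Ky]; [apply: WD => //; exact: WN|rewrite [ev _ _ _]/(ev u x y - ev v x y) subr_le0 uv].
Qed.

Let oplus f h : V := fun z => (f z.1 + h z.2 : R).

(** On a sum f(x) + h(y) the functional L is determined, because there Theta is
    odd: this gives the marginals of the set function l below. *)
Let L_sum f h : W (oplus f h) -> integrable1 f -> integrable2 h ->
  L (oplus f h) = J f h.
Proof.
move=> Wfh If Ih; apply/eqP; rewrite eq_le; apply/andP; split.
  by apply: le_trans (L_Theta Wfh) _; exact: Theta_le.
rewrite -lerN2 -LN// -[- J _ _]mulN1r -JZ//; apply: le_trans (L_Theta (WN Wfh)) _.
apply: Theta_le => //; [exact: WN|exact: integrable1Z|exact: integrable2Z|].
by move=> x y Kx Ky; rewrite -mulrDr mulN1r.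
Qed.

Let l (S : set (T1 * T2)) := L (\1_S : V).

Let Windic S : W (\1_S : V).
Proof. by exists 1 => x y _ _; rewrite /ev indicE; case: (_ \in _); rewrite ?normr1 ?normr0. Qed.

Let l_ge0 S : 0 <= l S.
Proof. by rewrite -oppr_le0 -LN//; apply: L_le0 => [|x y _ _]; [exact: WN|rewrite /ev oppr_le0 indicE]. Qed.

Let lU S S' : S `&` S' = set0 -> l (S `|` S') = l S + l S'.
Proof.
move=> SS'; rewrite /l -LD//; congr L; apply/funext => z.
change (\1_(S `|` S') z = \1_S z + \1_S' z :> R); rewrite !indicE in_setU.
have [zS|] := boolP (z \in S); last by rewrite add0r.
have [zS'|] := boolP (z \in S'); last by rewrite addr0.
by have : (S `&` S') z; [split; exact: set_mem|rewrite SS'].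
Qed.

Let lK S : l S = l (S `&` K1 `*` K2).
Proof.
by apply/eqP; rewrite eq_le; apply/andP; split; apply: L_le => // x y Kx Ky;
  rewrite /ev !indicE in_setI (mem_set (conj Kx Ky : (K1 `*` K2) (x, y))) andbT.
Qed.

Let l_fst A : measurable A -> (l (A `*` setT))%:E = mu A.
Proof.
move=> mA.
have IA : integrable1 \1_A.
  apply: measurable_bounded_integrable => //.
  - by apply: le_lt_trans fin_mu; apply: le_measure; rewrite ?inE.
  - exists 1; split; first exact: num_real.
    move=> x /ltW Mx y Ky; apply: le_trans Mx; rewrite indicE.
    by case: (_ \in _); rewrite ?normr1 ?normr0.
have E : (\1_(A `*` setT) : V) = oplus \1_A (fun=> 0).
  apply/funext => -[x y]; rewrite /oplus /= addr0 !indicE; congr (_%:R); congr nat_of_bool.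
  by apply/idP/idP => /set_mem h; apply/mem_set; [case: h|split].
rewrite /l E L_sum//; last by rewrite -E.
rewrite /J Rintegral_cst// mul0r addr0 /Rintegral fineK; last exact: integrable_fin_num.
rewrite integral_indic//.
apply/eqP; rewrite eq_le; apply/andP; split.
  by apply: le_measure; rewrite ?inE//; exact: measurableI.
rewrite -[in leLHS](setUIDK A K1); apply: le_trans (measureU2 _ _ _) _.
- exact: measurableI.
- exact: measurableD.
rewrite [X in (_ + X)%E](_ : _ = 0%E) ?adde0//.
apply/eqP; rewrite -measure_le0 -muK1; apply: le_measure; rewrite ?inE.
- exact: measurableD.
- exact: measurableC.
- by move=> x [].
Qed.
Let l_snd A : measurable A -> (l (setT `*` A))%:E = nu A.
Proof.
move=> mA.
have IA : integrable2 \1_A.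
  apply: measurable_bounded_integrable => //.
  - by apply: le_lt_trans fin_nu; apply: le_measure; rewrite ?inE.
  - exists 1; split; first exact: num_real.
    move=> x /ltW Mx y Ky; apply: le_trans Mx; rewrite indicE.
    by case: (_ \in _); rewrite ?normr1 ?normr0.
have E : (\1_(setT `*` A) : V) = oplus (fun=> 0) \1_A.
  apply/funext => -[x y]; rewrite /oplus /= add0r !indicE; congr (_%:R); congr nat_of_bool.
  by apply/idP/idP => /set_mem h; apply/mem_set; [case: h|split].
rewrite /l E L_sum//; last by rewrite -E.
rewrite /J Rintegral_cst// mul0r add0r /Rintegral fineK; last exact: integrable_fin_num.
rewrite integral_indic//.
apply/eqP; rewrite eq_le; apply/andP; split.
  by apply: le_measure; rewrite ?inE//; exact: measurableI.
rewrite -[in leLHS](setUIDK A K2); apply: le_trans (measureU2 _ _ _) _.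
- exact: measurableI.
- exact: measurableD.
rewrite [X in (_ + X)%E](_ : _ = 0%E) ?adde0//.
apply/eqP; rewrite -measure_le0 -nuK2; apply: le_measure; rewrite ?inE.
- exact: measurableD.
- exact: measurableC.
- by move=> x [].
Qed.

Let slack : V := fun z => (c z.1 z.2 - (c_transform K2 c phi z.1 + phi z.2) : R).

Let slack_ge0 x y : K1 x -> K2 y -> 0 <= ev slack x y.
Proof. by move=> Kx Ky; rewrite subr_ge0; exact: ctr_le. Qed.

Let slack_cont : {within K1 `*` K2, continuous (slack : T1 * T2 -> R)}.
Proof.
apply/within_continuousP => -[x y] [/= Kx Ky] e e0.
have e3 : 0 < e / 3 by rewrite divr_gt0.
have h1 := (within_continuousP _ _).1 cc (x, y) (conj Kx Ky) _ e3.
have h2 := (within_continuousP _ _).1 (ctr_cont cphi) x Kx _ e3.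
have h3 := (within_continuousP _ _).1 cphi y Ky _ e3.
have h23 : \forall z \near (x, y), (K1 z.1 -> `|c_transform K2 c phi x - c_transform K2 c phi z.1| < e / 3) /\
    (K2 z.2 -> `|phi y - phi z.2| < e / 3).
  exists ([set x' | K1 x' -> `|c_transform K2 c phi x - c_transform K2 c phi x'| < e / 3],
    [set y' | K2 y' -> `|phi y - phi y'| < e / 3]); first by split.
  by move=> [x' y'] /= [].
apply: filterS2 h1 h23 => -[x' y'] /= b1 [b2 b3] [Kx' Ky'].
have := b1 (conj Kx' Ky'); have := b2 Kx'; have := b3 Ky'.
by rewrite /slack /= !ltr_norml => /andP[? ?] /andP[? ?] /andP[? ?]; lra.
Qed.

Let L_slack : L slack <= 0.
Proof.
have Wphi : W (oplus (c_transform K2 c phi) phi).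
  have [M hM] := compact_continuous_bounded cK1 (ctr_cont cphi).
  have [N hN] := compact_continuous_bounded cK2 cphi.
  exists (M + N) => x y Kx Ky; apply: le_trans (ler_normD _ _) _.
  by apply: lerD; [exact: hM|exact: hN].
rewrite (_ : slack = cost - oplus (c_transform K2 c phi) phi)//.
rewrite LD ?LN ?L_sum//; last exact: WN.
- by rewrite subr_le0.
- by apply: cont_integrable1; exact: ctr_cont.
- exact: cont_integrable2.
Qed.

Let Wslack : W slack.
Proof.
have [M hM] := compact_continuous_bounded (compact_setX cK1 cK2) slack_cont.
by exists M => x y Kx Ky; exact: (hM (x, y)).
Qed.

(** Around a point where the slack is positive it is bounded below on an open
    rectangle, and L slack <= 0 forces this rectangle to be a null set. *)
Lemma coupling_of_functional :
  exists g : {measure set (T1 * T2) -> \bar R}, couplings mu nu g /\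
    g.-negligible ((K1 `*` K2) `&`
      [set z | c_transform K2 c phi z.1 + phi z.2 < c z.1 z.2]).
Proof.
have [g gE] := coupling_of_finitely_additive borelT1 borelT2 fin_mu fin_nu
  cK1 cK2 l_ge0 lU lK l_fst l_snd.
exists g; split; first by split=> A mA; rewrite gE//; [exact: l_fst|exact: l_snd].
have cK : compact (K1 `*` K2) by exact: compact_setX.
have negl n : g.-negligible ((K1 `*` K2) `&` [set z | K1 z.1 /\ K2 z.2 /\ n.+1%:R^-1 <= ev slack z.1 z.2]).
  have : 0 < n.+1%:R^-1 :> R by rewrite invr_gt0.
  (* Where the slack is at most a/2 the set is locally empty. *)
  move: (n.+1%:R^-1) => a a0; apply: compact_negligible => // -[x y] [/= Kx Ky].
  have n0 : 0 < a / 2 by rewrite divr_gt0.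
  have [sxy|sxy] := ltP (a / 2) (ev slack x y); last first.
    have := (within_continuousP _ _).1 slack_cont (x, y) (conj Kx Ky) _ n0.
    move=> near_lt; exists [set z | (K1 `*` K2) z -> `|ev slack x y - ev slack z.1 z.2| < a / 2].
      by apply: filterS near_lt => -[].
    rewrite (_ : _ `&` _ = set0); first exact: negligible_set0.
    apply/seteqP; split=> // -[x' y'] [/= /(_ (conj _ _))h [Kx' [Ky']]].
    have := h Kx' Ky'; move: sxy; rewrite ltr_norml => ? /andP[? ?] ?.
    lra.
  have d0 : 0 < ev slack x y / 2 by rewrite divr_gt0// (lt_trans n0).
  have [[U0 V0] /= [Ux Vy] UV] := (within_continuousP _ _).1 slack_cont (x, y) (conj Kx Ky) _ d0.
  have [U [oU Ux' UU]] : exists U, [/\ open U, U x & U `<=` U0].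
    by exists (U0^°); split; [exact: open_interior|exact: Ux|exact: interior_subset].
  have [V' [oV Vy' VV]] : exists V, [/\ open V, V y & V `<=` V0].
    by exists (V0^°); split; [exact: open_interior|exact: Vy|exact: interior_subset].
  have mU := borel_open borelT1 oU; have mV := borel_open borelT2 oV.
  exists (U `*` V').
    by exists (U, V') => //; split; exact: open_nbhs_nbhs.
  apply: (negligibleS (@subIsetl _ (U `*` V') _)).
  apply/negligibleP; first exact: measurableX.
  transitivity (l (U `*` V'))%:E; first exact: gE.
  congr EFin; apply/eqP; rewrite eq_le l_ge0 andbT.
  rewrite -(pmulr_rle0 _ d0) -LZ//; apply: le_trans L_slack.
  apply: L_le => //; first exact: WZ.
  move=> x' y' Kx' Ky'.
  have -> : ev ((ev slack x y / 2) *: (\1_(U `*` V') : V)) x' y' =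
    ev slack x y / 2 * \1_(U `*` V') (x', y') by [].
  rewrite indicE; have [/set_mem[/= Ux'' Vy'']|_] := boolP (_ \in _); last by rewrite /= mulr0 slack_ge0.
  have : `|ev slack x y - ev slack x' y'| < ev slack x y / 2.
    exact: (UV (x', y') (conj (UU _ Ux'') (VV _ Vy'')) (conj Kx' Ky')).
  by rewrite /= mulr1 ltr_norml => /andP[? ?]; lra.
apply: negligibleS (negligible_bigcup negl) => -[x y] [[/= Kx Ky] lt].
have s0 : 0 < ev slack x y by rewrite /ev /slack/= subr_gt0.
have [n _ /(_ _ (leqnn n))/= h] := near_infty_natSinv_lt (PosNum s0).
by exists n => //; split => //=; split => //; split => //; exact: ltW.
Qed.

End functional.

(** Attained Kantorovich duality: if phi is optimal for the dual problem, some
    coupling is carried by the set where the constraint is saturated. The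
    functional Theta, which maps u to the opposite of the value of the dual
    problem with cost -u, is sublinear; a linear functional below it and equal
    to it at -c is a finitely additive optimal plan. *)
Theorem kantorovich_attained :
  exists g : {measure set (T1 * T2) -> \bar R}, couplings mu nu g /\
    g.-negligible ((K1 `*` K2) `&`
      [set z | c_transform K2 c phi z.1 + phi z.2 < c z.1 z.2]).
Proof.
have [L [L_Theta LD LZ LE]] := hahn_banach W0 WD WZ Theta_sublinear (WN Wcost).
apply: (coupling_of_functional L_Theta LD LZ).
rewrite -lerN2 -[- L _]mulN1r -LZ// scaleN1r LE.
apply: Theta_ge => [|f h If Ih fh]; first exact: WN.
rewrite -lerN2 opprK -[- J _ _]mulN1r -JZ//; apply: J_le_max; [exact: integrable1Z|exact: integrable2Z|].
by move=> x y Kx Ky; have fhc : - c x y <= f x + h y := fh _ _ Kx Ky; lra.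
Qed.

End kantorovich_attained.

(** * Borel sets of finite-dimensional products *)

HB.instance Definition _ (R : realType) m n := Measurable.on 'M[R]_(m, n).
HB.instance Definition _ (R : realType) := PseudoMetric.on (measurableTypeR R).
HB.instance Definition _ (R : realType) := Measurable.on (measurableTypeR R).
HB.instance Definition _ (R : realType) d1 d2 (T1 : MetricMeasurable.type R d1)
  (T2 : MetricMeasurable.type R d2) := Measurable.on (T1 * T2)%type.

Section borel_spaces.
Context (R : realType).

Lemma borel_rV n : borel_sets (@open 'rV[R]_n).
Proof. by []. Qed.

Lemma borel_R : borel_sets (@open (measurableTypeR R)).
Proof.
rewrite /borel_sets eqEsubset; split.
  rewrite (RGenOInfty.measurableE R); apply: smallest_sub.
    exact: smallest_sigma_algebra.
  by move=> _ [a ->]; apply: sub_sigma_algebra; exact: rray_open.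
apply: smallest_sub; first exact: sigma_algebra_measurable.
by move=> A oA; exact: open_measurable.
Qed.

(** The projections are continuous, so the product sigma-algebra is always
    contained in the Borel one; the other inclusion, which rests on separability,
    is taken as a hypothesis. *)
Lemma borel_prod d1 d2 (T1 : MetricMeasurable.type R d1) (T2 : MetricMeasurable.type R d2) :
  borel_sets (@open T1) -> borel_sets (@open T2) ->
  (forall A : set (T1 * T2), open A -> measurable A) -> borel_sets (@open (T1 * T2)%type).
Proof.
move=> b1 b2 oM; rewrite /borel_sets eqEsubset; split; last first.
  by apply: smallest_sub => //; exact: sigma_algebra_measurable.
pose G := g_sigma_algebraType (@open (T1 * T2)%type).
have mG (f1 : G -> T1) : (forall B, open B -> open (f1 @^-1` B : set (T1 * T2))) ->
    measurable_fun setT f1.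
  move=> of1; apply: (measurability _ b1) => _ [B oB <-].
  by rewrite setTI; apply: sub_sigma_algebra; exact: of1.
have mG' (f2 : G -> T2) : (forall B, open B -> open (f2 @^-1` B : set (T1 * T2))) ->
    measurable_fun setT f2.
  move=> of2; apply: (measurability _ b2) => _ [B oB <-].
  by rewrite setTI; apply: sub_sigma_algebra; exact: of2.
rewrite measurable_prod_measurableType; apply: smallest_sub.
  exact: smallest_sigma_algebra.
move=> _ [A mA [B mB <-]].
have -> : A `*` B = (setT `&` (fst : G -> T1) @^-1` A) `&` (setT `&` (snd : G -> T2) @^-1` B).
  by rewrite !setTI.
apply: (@measurableI _ G).
- by apply: mG => // C oC; apply: open_comp => // z _; exact: cvg_fst.
- by apply: mG' => // C oC; apply: open_comp => // z _; exact: cvg_snd.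
Qed.

(** Pulling an open set back to R^n along the retraction g, and then to T along
    the measurable section f, transfers the measurability of open sets from R^n
    to a product identified with it. *)
Lemma open_measurable_retract d (T : MetricMeasurable.type R d) n
    (f : T -> 'rV[R]_n) (g : 'rV[R]_n -> T) :
  measurable_fun setT f -> continuous g -> cancel f g ->
  forall A : set T, open A -> measurable A.
Proof.
move=> mf cg fg A oA; have -> : A = setT `&` f @^-1` (g @^-1` A).
  by rewrite setTI; apply/seteqP; split=> x /=; rewrite fg.
apply: mf => //; apply: open_rV_measurable.
by have /continuousP := cg; exact.
Qed.

Lemma continuous_rV (T : topologicalType) n (f : T -> 'rV[R]_n) :
  (forall i, continuous (fun x => f x ord0 i)) -> continuous f.
Proof.
move=> cf x; apply/cvg_ballP => e e0.
have : \forall y \near x, forall i, ball (f x ord0 i) e (f y ord0 i).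
  by apply: filter_forall => i; have /cvg_ballP := cf i x; exact.
by apply: filterS => y h; split=> // i j; rewrite ord1.
Qed.

Definition uncons k (v : 'rV[R]_k.+1) : 'rV[R]_k * measurableTypeR R :=
  (\row_i v ord0 (lift ord0 i), v ord0 ord0).

Lemma row_consK k : cancel (@row_cons R k) (@uncons k).
Proof.
case=> s t; congr pair; last by rewrite row_cons0.
by apply/rowP => i; rewrite mxE row_consS.
Qed.

Lemma continuous_pair (T U V : topologicalType) (f : T -> U) (g : T -> V) :
  continuous f -> continuous g -> continuous (fun x => (f x, g x)).
Proof. by move=> cf cg x; exact: cvg_pair (cf x) (cg x). Qed.

Lemma continuous_uncons k : continuous (@uncons k).
Proof.
apply: (continuous_pair _ (@coord_continuous _ _ _ _ _)).
apply: (@continuous_rV _ _ (fun v : 'rV[R]_k.+1 => \row_i v ord0 (lift ord0 i))) => i.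
under eq_fun do rewrite mxE.
exact: coord_continuous.
Qed.

Lemma borel_rV_R k : borel_sets (@open ('rV[R]_k * measurableTypeR R)%type).
Proof.
apply: borel_prod; [exact: borel_rV|exact: borel_R|].
apply: (@open_measurable_retract _ _ _ (@row_cons R k) (@uncons k)).
- exact: measurable_row_cons.
- exact: continuous_uncons.
- exact: row_consK.
Qed.

Lemma borel_rV_R_rV k n :
  borel_sets (@open ('rV[R]_k * measurableTypeR R * 'rV[R]_n)%type).
Proof.
apply: borel_prod; [exact: borel_rV_R|exact: borel_rV|].
pose f (z : 'rV[R]_k * measurableTypeR R * 'rV[R]_n) := row_mx (row_cons z.1) z.2.
pose g (v : 'rV[R]_(k.+1 + n)) := (uncons (lsubmx v), rsubmx v).
apply: (@open_measurable_retract _ _ _ f g).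
- apply: measurable_fun_rV => i; rewrite -[i]splitK; case: (fintype.split i) => j /=.
    rewrite (_ : (fun _ => _) = (fun v : 'rV[R]_k.+1 => v ord0 j) \o (@row_cons R k) \o fst).
      apply: measurableT_comp; last exact: measurable_fst.
      by apply: measurableT_comp; [exact: measurable_coord_rV|exact: measurable_row_cons].
    by apply/funext => z; rewrite /f /= row_mxEl.
  rewrite (_ : (fun _ => _) = (fun v : 'rV[R]_n => v ord0 j) \o snd).
    by apply: measurableT_comp; [exact: measurable_coord_rV|exact: measurable_snd].
  by apply/funext => z; rewrite /f /= row_mxEr.
- apply: continuous_pair.
    move=> v; apply: (@continuous_comp _ _ _ lsubmx (@uncons k)); last exact: continuous_uncons.
    move: v; apply: (@continuous_rV _ _ (fun v : 'rV[R]_(k.+1 + n) => lsubmx v)) => i.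
    by under eq_fun do rewrite mxE; exact: coord_continuous.
  apply: (@continuous_rV _ _ (fun v : 'rV[R]_(k.+1 + n) => rsubmx v)) => i.
  by under eq_fun do rewrite mxE; exact: coord_continuous.
- by case=> x y; rewrite /f /g row_mxKl row_mxKr row_consK.
Qed.

End borel_spaces.

(** * Weak duality and complementary slackness *)

Section integral_shift.
Local Open Scope ereal_scope.
Context (R : realType) d (T : measurableType d) (mu : {measure set T -> \bar R}).
Variables (D : set T) (f : T -> R) (M : R).
Hypotheses (mD : measurable D) (fin_D : mu D < +oo) (mf : measurable_fun D f).
Hypotheses (M0 : (0 <= M)%R) (fM : forall x, D x -> (0 <= f x + M)%R).

(** Adding a constant to a function that is bounded below commutes with the
    integral even when the function is not integrable. *)
Lemma integral_shift :
  \int[mu]_(x in D) (f x + M)%:E = \int[mu]_(x in D) (f x)%:E + M%:E * mu D.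
Proof.
have mfM : measurable_fun D (fun x => (f x + M)%:E).
  by apply/measurable_EFinP; exact: measurable_funD.
have Icst : mu.-integrable D (cst M%:E).
  by apply/integrableP; split=> //=; rewrite integral_cst// lte_mul_pinfty.
have If_ : forall g, (g = fun x => (f x)%:E) -> \int[mu]_(x in D) (f x + M)%:E < +oo ->
   mu.-integrable D g.
  move=> _ -> h; have IfM : mu.-integrable D (fun x => (f x + M)%:E).
    apply/integrableP; split => //; apply: le_lt_trans h.
    by apply: ge0_le_integral => // [|x Dx]; [exact: measurableT_comp|rewrite /= ger0_norm// fM].
  rewrite (_ : (fun x => _) = (fun x => (f x + M)%:E) \- cst M%:E); first exact: integrableB.
  by apply/funext => x /=; rewrite EFinD addeK.
have [h|h] := ltP (\int[mu]_(x in D) (f x + M)%:E) +oo.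
  have If := If_ _ erefl h.
  by under eq_integral do rewrite EFinD; rewrite integralD// integral_cst.
have -> : \int[mu]_(x in D) (f x + M)%:E = +oo by apply/eqP; rewrite -leye_eq.
have mfp : measurable_fun D (fun x => (f x)%:E)^\+ by apply: measurable_funepos; exact/measurable_EFinP.
have mfn : measurable_fun D (fun x => (f x)%:E)^\- by apply: measurable_funeneg; exact/measurable_EFinP.
have fp : \int[mu]_(x in D) (fun x => (f x)%:E)^\+ x = +oo.
  apply/eqP; rewrite -leye_eq.
  have : \int[mu]_(x in D) (f x + M)%:E <= \int[mu]_(x in D) ((fun x => (f x)%:E)^\+ x + cst M%:E x).
    apply: ge0_le_integral => //; first exact: emeasurable_funD.
    by move=> x Dx; rewrite EFinD leeD2r// funeposE le_max lexx.
  rewrite ge0_integralD// integral_cst//.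
  move=> /(le_trans h); rewrite leye_eq; case: (\int[mu]_(x in D) _) => //= r.
  rewrite (_ : M%:E * mu D = (fine (M%:E * mu D))%:E)//.
  by rewrite fineK// ge0_fin_numE ?mule_ge0// lte_mul_pinfty.
have fn : \int[mu]_(x in D) (fun x => (f x)%:E)^\- x < +oo.
  apply: (@le_lt_trans _ _ (\int[mu]_(x in D) cst M%:E x)); last first.
    by rewrite integral_cst// lte_mul_pinfty.
  apply: ge0_le_integral => // x Dx; rewrite funenegE /= -EFin_max lee_fin.
  by rewrite ge_max M0 andbT; have := fM Dx; lra.
have fn0 : 0 <= \int[mu]_(x in D) (fun x => (f x)%:E)^\- x by exact: integral_ge0.
rewrite integralE fp; move: fn fn0; case: (\int[mu]_(x in D) _) => // r _ _.
rewrite addye// addye//; rewrite gt_eqF//.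
by apply: lt_le_trans (_ : 0 <= _); [rewrite ltNy0|exact: mule_ge0].
Qed.

End integral_shift.

Section plans.
Local Open Scope ereal_scope.
Context (R : realType) d1 d2 (T1 : measurableType d1) (T2 : measurableType d2).
Variables (mu : {measure set T1 -> \bar R}) (nu : {measure set T2 -> \bar R}).
Variables (X : set T1) (Y : set T2) (g : {measure set (T1 * T2) -> \bar R}).
Hypotheses (mX : measurable X) (mY : measurable Y) (muX : mu (~` X) = 0)
  (nuY : nu (~` Y) = 0) (fin_mu : mu setT < +oo) (coupling_g : couplings mu nu g).

Let mXY : measurable (X `*` Y). Proof. exact: measurableX. Qed.

Let g1 A : measurable A -> g (A `*` setT) = mu A. Proof. exact: coupling_g.1. Qed.

Let g2 A : measurable A -> g (setT `*` A) = nu A. Proof. exact: coupling_g.2. Qed.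

Lemma coupling_massE : nu setT = mu setT.
Proof. by rewrite -g1// -g2. Qed.

Lemma marginal1_integral (h : T1 -> R) : measurable_fun X h ->
  (forall x, X x -> (0 <= h x)%R) ->
  \int[g]_(z in X `*` Y) (h z.1)%:E = \int[mu]_(x in X) (h x)%:E.
Proof.
move=> mh h0.
have mhE : measurable_fun X (fun x => (h x)%:E) by exact/measurable_EFinP.
transitivity (\int[pushforward g fst]_(x in X) (h x)%:E); last first.
  apply: (@eq_measure_integral _ _ _ _ mu
    (@measure_function_pushforward__canonical__measure_function_Measure
    _ _ _ _ _ g _ measurable_fst)) => A mA _.
  by rewrite /= /pushforward -g1//; congr (g _); apply/seteqP; split=> x //= [].
rewrite (@ge0_integral_pushforward _ _ _ _ _ fst measurable_fst g X (fun x => (h x)%:E))//; last first.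
  by move=> x /set_mem Xx; rewrite lee_fin h0.
have mXT : measurable (fst @^-1` X : set (T1 * T2)).
  by rewrite -[X in measurable X]setTI; exact: measurable_fst.
rewrite [RHS](@ge0_negligible_integral _ _ _ g _ (setT `*` ~` Y))//.
- congr (integral _ _ _); apply/seteqP; split=> [[x y]/= [Xx Yy]|[x y] /= [Xx nY]].
    by split => // -[].
  by split => //=; apply: contrapT => nYy; exact: nY.
- by apply: measurableX => //; exact: measurableC.
- apply: (measurable_comp mX) => //; first by move=> _ [z Xz <-].
  by apply: measurable_funS measurable_fst.
- by move=> z Xz; rewrite lee_fin h0.
- by rewrite g2 ?nuY//; exact: measurableC.
Qed.

Lemma marginal2_integral (h : T2 -> R) : measurable_fun Y h ->
  (forall x, Y x -> (0 <= h x)%R) ->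
  \int[g]_(z in X `*` Y) (h z.2)%:E = \int[nu]_(x in Y) (h x)%:E.
Proof.
move=> mh h0.
have mhE : measurable_fun Y (fun x => (h x)%:E) by exact/measurable_EFinP.
transitivity (\int[pushforward g snd]_(x in Y) (h x)%:E); last first.
  apply: (@eq_measure_integral _ _ _ _ nu
    (@measure_function_pushforward__canonical__measure_function_Measure
    _ _ _ _ _ g _ measurable_snd)) => A mA _.
  by rewrite /= /pushforward -g2//; congr (g _); apply/seteqP; split=> x //= [].
rewrite (@ge0_integral_pushforward _ _ _ _ _ snd measurable_snd g Y (fun x => (h x)%:E))//; last first.
  by move=> x /set_mem Xx; rewrite lee_fin h0.
have mYT : measurable (snd @^-1` Y : set (T1 * T2)).
  by rewrite -[X in measurable X]setTI; exact: measurable_snd.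
rewrite [RHS](@ge0_negligible_integral _ _ _ g _ (~` X `*` setT))//.
- congr (integral _ _ _); apply/seteqP; split=> [[x y]/= [Xx Yy]|[x y] /= [Yy nX]].
    by split => // -[].
  by split => //=; apply: contrapT => nXx; exact: nX.
- by apply: measurableX => //; exact: measurableC.
- apply: (measurable_comp mY) => //; first by move=> _ [z Xz <-].
  by apply: measurable_funS measurable_snd.
- by move=> z Xz; rewrite lee_fin h0.
- by rewrite g1 ?muX//; exact: measurableC.
Qed.

Variables (c : T1 -> T2 -> R) (f : T1 -> R) (psi : T2 -> R) (M : R).
Hypotheses (c_ge0 : forall x y, X x -> Y y -> (0 <= c x y)%R)
  (mc : measurable_fun (X `*` Y) (fun z => c z.1 z.2))
  (mf : measurable_fun X f) (mpsi : measurable_fun Y psi) (M0 : (0 <= M)%R)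
  (fM : forall x, X x -> (- M <= f x)%R) (psiM : forall y, Y y -> (`|psi y| <= M)%R).

Let fin_X : mu X < +oo.
Proof. by apply: le_lt_trans fin_mu; apply: le_measure; rewrite ?inE. Qed.

Let full_measure d (T : measurableType d) (m : {measure set T -> \bar R}) A :
  measurable A -> m (~` A) = 0 -> m A = m setT.
Proof.
move=> mA mcA; have mCA := measurableC mA.
by rewrite -(setUv A) measureU ?setICr// [X in _ + X]mcA adde0.
Qed.

Let massE : nu Y = mu X.
Proof. by rewrite (full_measure mY nuY) (full_measure mX muX) coupling_massE. Qed.

Let Ipsi : nu.-integrable Y (EFin \o psi).
Proof.
apply: measurable_bounded_integrable => //; first by rewrite massE.
exists M; split; first exact: num_real.
by move=> x /ltW Mx y Yy; apply: le_trans Mx; exact: psiM.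
Qed.

Let f_sum := fun z : T1 * T2 => ((f z.1 + M)%R)%:E.
Let c_sum := fun z : T1 * T2 => (c z.1 z.2)%:E + ((- psi z.2 + M)%R)%:E.

Let mfst : measurable_fun (X `*` Y) (fun z : T1 * T2 => f z.1).
Proof.
apply: (measurable_comp mX) => //; first by move=> _ [z [] ? ? <-].
by apply: measurable_funS measurable_fst.
Qed.

Let msnd : measurable_fun (X `*` Y) (fun z : T1 * T2 => psi z.2).
Proof.
apply: (measurable_comp mY) => //; first by move=> _ [z [] ? ? <-].
by apply: measurable_funS measurable_snd.
Qed.

Let mf_sum : measurable_fun (X `*` Y) f_sum.
Proof. by apply/measurable_EFinP; exact: measurable_funD. Qed.

Let psiM0 y : Y y -> (0 <= - psi y + M)%R.
Proof. by move=> /psiM; rewrite ler_norml => /andP[_]; lra. Qed.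

Let mpsi_sum : measurable_fun (X `*` Y) (fun z : T1 * T2 => ((- psi z.2 + M)%R)%:E).
Proof.
by apply/measurable_EFinP; apply: measurable_funD => //; exact: measurableT_comp.
Qed.

Let mc_sum : measurable_fun (X `*` Y) c_sum.
Proof. by apply: emeasurable_funD => //; exact/measurable_EFinP. Qed.

Let int_f_sum : \int[g]_(z in X `*` Y) f_sum z =
  \int[mu]_(x in X) (f x)%:E + M%:E * mu X.
Proof.
rewrite -integral_shift//; last by move=> x /fM; lra.
rewrite -marginal1_integral//; first exact: measurable_funD.
by move=> x /fM; lra.
Qed.

Let int_c_sum : \int[g]_(z in X `*` Y) c_sum z =
  plan_cost X Y c g + (- (\int[nu]_(y in Y) (psi y)%:E) + M%:E * mu X).
Proof.
rewrite ge0_integralD//; last 3 first.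
- by move=> -[x y] [/= Xx Yy]; rewrite lee_fin c_ge0.
- exact/measurable_EFinP.
- by move=> -[x y] [/= Xx Yy]; rewrite lee_fin psiM0.
congr (_ + _); rewrite (marginal2_integral (h := fun y => (- psi y + M)%R))//; last first.
  by apply: measurable_funD => //; exact: measurableT_comp.
rewrite integral_shift// ?massE//; last exact: measurableT_comp.
congr (_ + _); rewrite -integralN//.
exact: (integrable_add_def mY Ipsi).
Qed.

Let cancel_mass a b : a + M%:E * mu X <= b + (- (\int[nu]_(y in Y) (psi y)%:E) + M%:E * mu X) ->
  a + \int[nu]_(y in Y) (psi y)%:E <= b.
Proof.
have : \int[nu]_(y in Y) (psi y)%:E \is a fin_num by exact: integrable_fin_num.
have : M%:E * mu X \is a fin_num.
  by rewrite ge0_fin_numE ?mule_ge0// lte_mul_pinfty.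
case: (M%:E * mu X) => // k _; case: (\int[nu]_(y in Y) _) => // r _.
by case: a => [a| |]; case: b => [b| |]; rewrite //= ?leey ?leNye// -!EFinD !lee_fin; lra.
Qed.

Let cancel_mass' a b : b + (- (\int[nu]_(y in Y) (psi y)%:E) + M%:E * mu X) <= a + M%:E * mu X ->
  b <= a + \int[nu]_(y in Y) (psi y)%:E.
Proof.
have : \int[nu]_(y in Y) (psi y)%:E \is a fin_num by exact: integrable_fin_num.
have : M%:E * mu X \is a fin_num.
  by rewrite ge0_fin_numE ?mule_ge0// lte_mul_pinfty.
case: (M%:E * mu X) => // k _; case: (\int[nu]_(y in Y) _) => // r _.
by case: a => [a| |]; case: b => [b| |]; rewrite //= ?leey ?leNye// -!EFinD !lee_fin; lra.
Qed.

(** Integrate f(x) + psi(y) <= c(x, y) against the plan g. The integral of f may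
    be infinite, hence the comparison of f + M with c - psi + M, which are
    nonnegative. *)
Lemma dual_le_plan_cost :
  (forall x y, X x -> Y y -> (f x + psi y <= c x y)%R) ->
  \int[mu]_(x in X) (f x)%:E + \int[nu]_(y in Y) (psi y)%:E <= plan_cost X Y c g.
Proof.
move=> fpsi; apply: cancel_mass; rewrite -int_f_sum -int_c_sum.
apply: ge0_le_integral => // [[x y] [/= Xx Yy]|[x y] [/= Xx Yy]].
  by rewrite /f_sum lee_fin; have := fM Xx; lra.
by rewrite /f_sum /c_sum -EFinD lee_fin /=; have := fpsi _ _ Xx Yy; lra.
Qed.

(** When the constraint is saturated g-almost everywhere the same comparison is
    an equality. *)
Lemma plan_cost_le_dual :
  g.-negligible ((X `*` Y) `&` [set z | (f z.1 + psi z.2 < c z.1 z.2)%R]) ->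
  plan_cost X Y c g <= \int[mu]_(x in X) (f x)%:E + \int[nu]_(y in Y) (psi y)%:E.
Proof.
move=> slack; apply: cancel_mass'; rewrite -int_f_sum -int_c_sum.
apply: ae_ge0_le_integral => //.
- move=> [x y] [/= Xx Yy]; rewrite /c_sum -EFinD lee_fin /=.
  by have := psiM0 Yy; have := c_ge0 Xx Yy; lra.
- by move=> [x y] [/= Xx Yy]; rewrite /f_sum lee_fin; have := fM Xx; lra.
apply: negligibleS slack => -[x y] /= /not_implyP[[Xx Yy] h]; split => //=.
rewrite ltNge; apply/negP => h'; apply: h.
by rewrite /f_sum /c_sum -EFinD lee_fin /=; move: h'; rewrite /=; lra.
Qed.

End plans.

(** * The c-transform and the inverse cost *)

Record admissible (R : realType) (d : nat) (B : set 'rV[R]_d.-1) (Y : set 'rV[R]_d)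
    (c : 'rV[R]_d.-1 * R -> 'rV[R]_d -> R) : Prop := Admissible {
  adm_compactB : compact B;
  adm_interiorB : interior B !=set0;
  adm_nonemptyY : Y !=set0;
  adm_compactY : compact Y;
  adm_ge0 : forall x y, cylinder B x -> Y y -> 0 <= c x y;
  adm_lipschitz : [locally [lipschitz c z.1 z.2 | z in cylinder B `*` Y]];
  adm_increasing : forall s y, B s -> Y y ->
    forall p p' : R, 0 <= p -> p < p' -> c (s, p) y < c (s, p') y;
  adm_unbounded : forall s y, B s -> Y y ->
    forall M : R, exists2 p : R, 0 <= p & M < c (s, p) y }.

Section cost_geometry.
Context (R : realType) (d : nat) (B : set 'rV[R]_d.-1) (Y : set 'rV[R]_d).
Variable c : 'rV[R]_d.-1 * R -> 'rV[R]_d -> R.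
Hypothesis H : admissible B Y c.

Let compactB := adm_compactB H.
Let nonemptyY := adm_nonemptyY H.
Let compactY := adm_compactY H.
Let c_ge0 := adm_ge0 H.
Let c_lipschitz := adm_lipschitz H.
Let c_increasing := adm_increasing H.
Let c_unbounded := adm_unbounded H.

Local Notation X := (cylinder B).

Lemma cost_continuous : {within X `*` Y, continuous (fun z : 'Rs[R]_d * 'rV[R]_d => c z.1 z.2)}.
Proof.
apply/within_continuousP => z XYz e e0.
have [M [_ hM]] := c_lipschitz (conj XYz XYz : ((X `*` Y) `*` (X `*` Y)) (z, z)).
have {}hM := hM (`|M| + 1) (ltr_pwDr ltr01 (ler_norm M)).
have [[U V] /= [Uz Vz] UV] := hM.
have M1 : 0 < `|M| + 1 by rewrite ltr_pwDr.
have near_e : \forall z' \near (z : 'rV[R]_d.-1 * R * 'rV[R]_d), `|z - z'| < e / (`|M| + 1).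
  by have := nbhsx_ballx z _ (divr_gt0 e0 M1); rewrite -ball_normE.
apply: filterS2 Vz near_e => z' Vz' zz' XYz'.
have := UV (z, z') (conj (nbhs_singleton Uz) Vz') (conj XYz XYz').
rewrite /= => h; apply: le_lt_trans h _.
by rewrite mulrC -ltr_pdivlMr.
Qed.

Lemma measurable_compact : measurable B.
Proof.
apply: borel_closed; first exact: borel_rV.
by apply: compact_closed => //; exact: norm_hausdorff.
Qed.

Lemma measurable_cylinder : measurable (X : set 'Rs[R]_d).
Proof.
apply: measurableX; first exact: measurable_compact.
rewrite (_ : [set p | 0 <= p] = `[0, +oo[%classic); first exact: measurable_itv.
by apply/seteqP; split=> x /=; rewrite in_itv/= andbT.
Qed.

Lemma measurable_target : measurable Y.
Proof.
apply: borel_closed; first exact: borel_rV.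
by apply: compact_closed => //; exact: norm_hausdorff.
Qed.

Lemma measurable_cost : measurable_fun (X `*` Y) (fun z : 'Rs[R]_d * 'rV[R]_d => c z.1 z.2).
Proof.
apply: within_continuous_measurable.
- exact: borel_rV_R_rV.
- by apply: measurableX; [exact: measurable_cylinder|exact: measurable_target].
- exact: cost_continuous.
Qed.

Lemma ray_continuous s y a b : B s -> Y y -> 0 <= a ->
  {within `[a, b], continuous (fun p : R => c (s, p) y)}.
Proof.
move=> Bs Yy a0; apply/within_continuousP => p /= pab e e0.
have p0 : 0 <= p by move: pab; rewrite in_itv => /andP[+ _]; exact: le_trans.
have [[U V] /= [[[U1 U2] /= [U1s U2p] U12] Vy] UV] :=
  (within_continuousP _ _).1 cost_continuous ((s, p), y) (conj (conj Bs p0) Yy) _ e0.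
apply: filterS U2p => p' U2p' p'ab.
have p'0 : 0 <= p' by move: p'ab; rewrite in_itv => /andP[+ _]; exact: le_trans.
exact: (UV ((s, p'), y) (conj (U12 (s, p') (conj (nbhs_singleton U1s) U2p')) (nbhs_singleton Vy))
  (conj (conj Bs p'0) Yy)).
Qed.

Section potential.
Variable psi : 'rV[R]_d -> R.
Hypothesis psi_cont : {within Y, continuous psi}.

(** The c-transform of psi with domain the type that carries the product
    sigma-algebra and the volume. *)
Definition ctr (x : 'Rs[R]_d) : R := c_transform Y c psi x.

Lemma ctr_attained x : X x ->
  exists2 y, Y y & ctr x = c x y - psi y /\ forall y', Y y' -> c x y - psi y <= c x y' - psi y'.
Proof. by move=> Xx; exact: (inf_attained compactY nonemptyY cost_continuous Xx psi_cont). Qed.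

Lemma ctr_le x y : X x -> Y y -> ctr x <= c x y - psi y.
Proof. by move=> Xx Yy; have [y' Yy' [-> ]] := ctr_attained Xx; exact. Qed.

Lemma ctr_continuous : {within X, continuous ctr}.
Proof.
apply: (continuous_inf compactY nonemptyY cost_continuous) => x Xx.
have [y' Yy' [_ h]] := ctr_attained Xx.
by exists (c x y' - psi y') => _ [y Yy <-]; exact: h.
Qed.

Lemma measurable_ctr : measurable_fun X ctr.
Proof.
apply: within_continuous_measurable.
- exact: borel_rV_R.
- exact: measurable_cylinder.
- exact: ctr_continuous.
Qed.

Lemma ctr_increasing s p p' : B s -> 0 <= p -> p < p' -> ctr (s, p) < ctr (s, p').
Proof.
move=> Bs p0 pp'; have Xp : X (s, p) by [].
have Xp' : X (s, p') by split => //=; rewrite (le_trans p0)// ltW.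
have [y' Yy' [-> _]] := ctr_attained Xp'.
by apply: le_lt_trans (ctr_le Xp Yy') _; rewrite ltrD2r c_increasing.
Qed.

Lemma psi_bounded : exists2 M, 0 <= M & forall y, Y y -> `|psi y| <= M.
Proof.
have [M h] := compact_continuous_bounded compactY psi_cont.
by exists `|M| => // y Yy; apply: le_trans (h _ Yy) (ler_norm _).
Qed.

Lemma ctr_ge M : (forall y, Y y -> `|psi y| <= M) -> forall x, X x -> - M <= ctr x.
Proof.
move=> psiM x Xx; have [y Yy [-> _]] := ctr_attained Xx.
by have := c_ge0 Xx Yy; have := psiM _ Yy; rewrite ler_norml => /andP[]; lra.
Qed.

(** The cost tends to infinity with the depth p, uniformly on B x Y. *)
Lemma ctr_coercive t : exists2 Q, 0 < Q & forall s p, B s -> Q <= p -> t < ctr (s, p).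
Proof.
suff [Q hQ] : exists Q, forall s y p, B s -> Y y -> Q <= p -> 0 <= p -> t < c (s, p) y - psi y.
  exists (`|Q| + 1); first by rewrite ltr_pwDr.
  move=> s p Bs Qp; have p0 : 0 <= p by apply: le_trans Qp; rewrite addr_ge0.
  have [y Yy [-> _]] := ctr_attained (conj Bs p0 : X (s, p)).
  by apply: hQ => //; apply: le_trans Qp; rewrite (le_trans (ler_norm Q))// lerDl.
have cBY : near_covering_within (B `*` Y).
  by apply/near_covering_withinP/compact_near_coveringP; exact: compact_setX.
have [|Q [_ hQ]] := cBY _ (+oo : set_system R)
    (fun p z => 0 <= p -> t < c (z.1, p) z.2 - psi z.2) _.
  move=> -[s y] [/= Bs Yy].
  have [p0 p00 hp0] := c_unbounded Bs Yy (t + psi y).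
  pose e := c (s, p0) y - (t + psi y).
  have e2 : 0 < e / 2 by rewrite divr_gt0// subr_gt0.
  have [[U V] /= [[[U1 U2] /= [U1s U2p] U12] Vy] UV] :=
    (within_continuousP _ _).1 cost_continuous ((s, p0), y) (conj (conj Bs p00) Yy) _ e2.
  have hpsi := (within_continuousP _ _).1 psi_cont y Yy _ e2.
  exists ((U1 `*` (V `&` [set y' | Y y' -> `|psi y - psi y'| < e / 2])), [set p | p0 <= p]) => /=.
    split; first by exists (U1, V `&` [set y' | Y y' -> `|psi y - psi y'| < e / 2]) => //; split => //; exact: filterI.
    by exists p0; split; [exact: num_real|move=> x /ltW].
  move=> [[s' y'] p] /= [[U1s' [Vy' hy']] p0p] [Bs' Yy'] p_ge0.
  have := UV ((s', p0), y') (conj (U12 (s', p0) (conj U1s' (nbhs_singleton U2p))) Vy') (conj (conj Bs' p00) Yy').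
  have := hy' Yy'; rewrite /= !ltr_norml => /andP[? ?] /andP[? ?].
  have : c (s', p0) y' <= c (s', p) y'.
    move: p0p; rewrite le_eqVlt => /predU1P[->//|p0p].
    by apply: ltW; exact: c_increasing.
  have eE : e = c (s, p0) y - (t + psi y) by [].
  by clearbody e; lra.
have [Q' Q'Q] : exists Q', Q < Q' by exists (Q + 1); rewrite ltrDl.
by exists Q' => s y p Bs Yy Q'p p0; apply: (hQ p _ (s, y)) => //; exact: lt_le_trans Q'p.
Qed.

(** The c-transform and the maximal inverse cost are inverse to each other on
    each vertical line: f (s, p) <= t says that c (s, p) y <= psi y + t for some
    y, that is, p is at most the inverse cost at y. At depth 0 the equivalence
    fails when q takes its default value 0. *)
Lemma le_max_q t s p : B s -> 0 < p ->
  (p <= max_q Y c (fun y => psi y + t) s) = (ctr (s, p) <= t).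
Proof.
move=> Bs p0.
have [Q Q0 hQ] := ctr_coercive t.
have qP y : Y y -> c (s, 0) y <= psi y + t ->
    0 <= q c s y (psi y + t) /\ c (s, q c s y (psi y + t)) y = psi y + t.
  move=> Yy c0; rewrite /q c0.
  suff ex : exists p, 0 <= p /\ c (s, p) y = psi y + t by exact: (xgetPex 0 ex).
  have [b b0 cb] := c_unbounded Bs Yy (psi y + t).
  have [|p'] := @IVT _ (fun p => c (s, p) y) 0 b (psi y + t) b0 (@ray_continuous s y 0 b Bs Yy (lexx 0)).
    by rewrite ge_min c0 /= le_max (ltW cb) orbT.
  by rewrite in_itv => /andP[p'0 _] <-; exists p'.
have q_ge0 y : Y y -> 0 <= q c s y (psi y + t).
  move=> Yy; have [h|h] := boolP (c (s, 0) y <= psi y + t); first exact: (qP _ Yy h).1.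
  by rewrite /q (negbTE h).
have q_lt y p' : Y y -> 0 < p' -> t < ctr (s, p') -> q c s y (psi y + t) < p'.
  move=> Yy p'0 tp'; have [h|h] := boolP (c (s, 0) y <= psi y + t); last by rewrite /q (negbTE h).
  have [q0 qE] := qP _ Yy h; rewrite ltNge; apply/negP => p'q.
  have := ctr_le (conj Bs (ltW p'0) : X (s, p')) Yy.
  have : c (s, p') y <= c (s, q c s y (psi y + t)) y.
    move: p'q; rewrite le_eqVlt => /predU1P[<-//|p'q].
    by apply: ltW; apply: c_increasing => //; exact: ltW.
  by rewrite qE; lra.
have ub : has_ubound [set q c s y (psi y + t) | y in Y].
  by exists Q => _ [y Yy <-]; apply: ltW; apply: q_lt => //; exact: hQ.
apply/idP/idP => [psup|ctrp].
  rewrite leNgt; apply/negP => tp.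
  have e0 : 0 < ctr (s, p) - t by rewrite subr_gt0.
  have [[U V] /= [Us /nbhs_ballP[r /= r0 rV]] UV] :=
    (within_continuousP _ _).1 ctr_continuous (s, p) (conj Bs (ltW p0)) _ e0.
  (* By continuity t < f still holds at a smaller depth p', which bounds all
     the q s y (psi y + t) by p' < p. *)
  pose p' := p - Num.min r p / 2.
  have m0 : 0 < Num.min r p by rewrite lt_min r0.
  have mr : Num.min r p <= r by rewrite ge_min lexx.
  have mp : Num.min r p <= p by rewrite ge_min lexx orbT.
  have p'0 : 0 < p' by rewrite /p'; lra.
  have p'p : p' < p by rewrite /p'; lra.
  have Vp' : V p'.
    by apply: rV; rewrite /ball /= /p' opprB addrC subrK gtr0_norm; lra.
  have tp' : t < ctr (s, p').
    have := UV (s, p') (conj (nbhs_singleton Us) Vp') (conj Bs (ltW p'0)).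
    by rewrite ltr_norml => /andP[_]; lra.
  suff : max_q Y c (fun y => psi y + t) s <= p' by move=> /(le_trans psup); rewrite leNgt p'p.
  apply: sup_le_ub; first by have [y Yy] := nonemptyY; exists (q c s y (psi y + t)), y.
  by move=> _ [y Yy <-]; apply: ltW; exact: q_lt.
have [y Yy [ctrE _]] := ctr_attained (conj Bs (ltW p0) : X (s, p)).
have c0p := c_increasing Bs Yy (lexx 0) p0.
have c0 : c (s, 0) y <= psi y + t by lra.
have [q0 qE] := qP _ Yy c0.
apply: (@le_trans _ _ (q c s y (psi y + t))); last by apply: ub_le_sup => //; exists y.
rewrite leNgt; apply/negP => qp.
by have := c_increasing Bs Yy q0 qp; rewrite qE; lra.
Qed.

Lemma max_q_ge0 sigma s : 0 <= max_q Y c sigma s.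
Proof.
rewrite /max_q; have [sup|nsup] := pselect (has_sup [set q c s y (sigma y) | y in Y]); last by rewrite sup_out.
have [y Yy] := nonemptyY; apply: (@le_trans _ _ (q c s y (sigma y))).
  by rewrite /q; case: ifP => // _; case: xgetP => // p _ [].
by apply: ub_le_sup; [exact: sup.2|exists y].
Qed.

End potential.
End cost_geometry.

(** * Volume and slices *)

Section lebesgue_compact.
Context (R : realType) (n : nat).

Let box (a b : 'rV[R]_n) := [set x : 'rV[R]_n | forall i, x ord0 i \in `[a ord0 i, b ord0 i]].

Let measurable_box a b : measurable (box a b).
Proof.
rewrite (_ : box a b = \bigcap_(i : 'I_n)
  ((fun x : 'rV[R]_n => x ord0 i) @^-1` `[a ord0 i, b ord0 i])); last first.
  by apply/seteqP; split=> [x xab i _|x xab i]; [exact: xab|exact: (xab i)].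
apply: fin_bigcap_measurable => [|i _]; first exact: finite_finset.
rewrite -[X in measurable X]setTI.
by apply: (measurable_coord_rV i) => //; exact: measurable_itv.
Qed.

Lemma lebesgue_rV_compact_lty (B : set 'rV[R]_n) : measurable B -> compact B ->
  (lebesgue_rV B < +oo)%E.
Proof.
move=> mB cB.
have /choice[M BM] (i : 'I_n) : exists M, forall x : 'rV[R]_n, B x -> `|x ord0 i| <= M.
  apply: compact_continuous_bounded => //; apply: continuous_subspaceT.
  exact: coord_continuous.
pose a : 'rV[R]_n := \row_i (- `|M i|); pose b : 'rV[R]_n := \row_i `|M i|.
apply: (@le_lt_trans _ _ (lebesgue_rV (box a b))).
  apply: le_measure; rewrite ?inE//.
  move=> x Bx i; rewrite !mxE in_itv/= -ler_norml.
  by apply: le_trans (BM i x Bx) (ler_norm _).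
rewrite lebesgue_rV_box ?ltry// => i; rewrite !mxE.
by have := normr_ge0 (M i); lra.
Qed.

Lemma lebesgue_rV_interior_gt0 (B : set 'rV[R]_n) : measurable B -> interior B !=set0 ->
  (0 < lebesgue_rV B)%E.
Proof.
move=> mB [s /nbhs_ballP[e /= e0 eB]].
have e2 : 0 < e / 2 by rewrite divr_gt0.
pose a : 'rV[R]_n := \row_i (s ord0 i - e / 2); pose b : 'rV[R]_n := \row_i (s ord0 i + e / 2).
apply: (@lt_le_trans _ _ (lebesgue_rV (box a b))).
  rewrite lebesgue_rV_box; last by move=> i; rewrite !mxE; lra.
  by rewrite lte_fin; apply: prodr_gt0 => i _; rewrite !mxE; lra.
apply: le_measure; rewrite ?inE//.
move=> x xs; apply: eB; split => // i j; rewrite ord1.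
have := xs j; rewrite !mxE in_itv/= => /andP[? ?].
by rewrite /ball/= ltr_distlC; apply/andP; split; lra.
Qed.

End lebesgue_compact.

Section volume_facts.
Local Open Scope ereal_scope.
Context (R : realType) (d : nat).

Notation leb := (@lebesgue_rV R d.-1).
Notation vol := (volume R d).

Lemma volumeE (A : set 'Rs[R]_d) :
  vol A = \int[leb]_s lebesgue_measure (xsection A s).
Proof. by []. Qed.

Lemma volume_null (A : set 'Rs[R]_d) :
  (forall s, lebesgue_measure (xsection A s) = 0) -> vol A = 0.
Proof. by move=> A0; rewrite volumeE; apply: integral0_eq => s _; exact: A0. Qed.

(** Such a set meets each vertical line in at most one point. *)
Lemma volume_graph_like (A : set 'Rs[R]_d) : measurable A ->
  (forall s t t', A (s, t) -> A (s, t') -> t = t') -> vol A = 0.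
Proof.
move=> mA Auniq; apply: volume_null => s; apply/eqP.
rewrite -measure_le0 -(lebesgue_measure_set1 (xget 0%R (xsection A s))).
apply: le_measure; rewrite ?inE//; first exact: measurable_xsection.
move=> t At; have /xsectionP/Auniq := At; apply; apply/xsectionP.
exact: xgetPex (ex_intro _ t At).
Qed.

Lemma volume0_slices (A : set 'Rs[R]_d) : measurable A -> vol A = 0 ->
  {ae leb, forall s, lebesgue_measure (xsection A s) = 0}.
Proof.
move=> mA A0; have mxs := measurable_fun_xsection lebesgue_measure mA.
have := (ae_eq_integral_abs leb measurableT mxs).1 _.
rewrite (eq_integral (lebesgue_measure \o xsection A)); last first.
  by move=> s _; rewrite /= gee0_abs.
move=> /(_ A0); apply: filterS => s; exact.
Qed.

Lemma volumeX (B : set 'rV[R]_d.-1) (a b : R) : measurable B -> (a <= b)%R ->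
  vol (B `*` [set t : R | (a <= t <= b)%R]) = leb B * (b - a)%:E.
Proof.
move=> mB ab.
have -> : [set t : R | (a <= t <= b)%R] = `[a, b]%classic by apply/seteqP; split=> t /=; rewrite in_itv.
rewrite /volume /= product_measure1E//=; congr (_ * _).
rewrite lebesgue_measure_itv/= lte_fin.
by move: ab; rewrite le_eqVlt => /predU1P[->|->//]; rewrite ltxx subrr.
Qed.

End volume_facts.

(** * Sublevels of the c-transform *)

Section level_sets.
Local Open Scope ereal_scope.
Context (R : realType) (d : nat) (B : set 'rV[R]_d.-1) (Y : set 'rV[R]_d).
Variable c : 'rV[R]_d.-1 * R -> 'rV[R]_d -> R.
Hypothesis H : admissible B Y c.

Notation leb := (@lebesgue_rV R d.-1).
Notation vol := (volume R d).
Local Notation X := (cylinder B : set 'Rs[R]_d).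

Let mB : measurable B := measurable_compact H.
Let mX : measurable X := measurable_cylinder H.

Lemma base_lty : leb B < +oo.
Proof. by apply: lebesgue_rV_compact_lty => //; exact: adm_compactB H. Qed.

Lemma base_gt0 : 0 < leb B.
Proof. by apply: lebesgue_rV_interior_gt0 => //; exact: adm_interiorB H. Qed.

Let msnd D : measurable D -> measurable_fun D (fun x : 'Rs[R]_d => (x.2 : R)).
Proof. by move=> mD; apply: measurable_funS measurable_snd. Qed.

Let mcomp1 D (p : 'rV[R]_d.-1 -> R) : measurable D -> D `<=` X -> measurable_fun B p ->
  measurable_fun D (fun x : 'Rs[R]_d => p x.1).
Proof.
move=> mD DX mp; apply: (measurable_comp mB) => //; first by move=> _ [x /DX [] + _ <-].
by apply: measurable_funS measurable_fst.
Qed.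

Lemma measurable_subgraph (p : 'rV[R]_d.-1 -> R) : measurable_fun B p ->
  measurable (subgraph B p).
Proof.
move=> mp; rewrite (_ : subgraph B p = X `&` [set x | (x.2 <= p x.1)%R])//.
by apply: measurable_fun_le => //; [exact: msnd|exact: mcomp1].
Qed.

Lemma measurable_slab P : measurable (B `*` [set p : R | (0 <= p <= P)%R] : set 'Rs[R]_d).
Proof.
apply: measurableX => //.
rewrite (_ : [set p | _] = `[0%R, P]%classic); first exact: measurable_itv.
by apply/seteqP; split=> x /=; rewrite in_itv.
Qed.

Lemma measurable_supergraph P (p : 'rV[R]_d.-1 -> R) : measurable_fun B p ->
  (forall s, B s -> (0 <= p s)%R) -> measurable (supergraph B P p).
Proof.
move=> mp p0.
rewrite (_ : supergraph B P p = (B `*` [set t : R | (0 <= t <= P)%R]) `&` [set x | (p x.1 <= x.2)%R]).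
  apply: measurable_fun_le => //; [exact: measurable_slab| |by apply: msnd; exact: measurable_slab].
  by apply: mcomp1 => //; [exact: measurable_slab|move=> x [Bx /andP[]]].
apply/seteqP; split=> [x [Bx /andP[px xP]]|x [[Bx /andP[_ xP]] px]]; last by split => //; apply/andP.
by split=> //; split=> //=; apply/andP; split => //; apply: le_trans px; exact: p0.
Qed.

Lemma volume_graph (p : 'rV[R]_d.-1 -> R) : measurable_fun B p ->
  vol (X `&` [set x | x.2 = p x.1]) = 0.
Proof.
move=> mp; apply: volume_graph_like.
  rewrite (_ : _ `&` _ = (X `&` [set x | (x.2 <= p x.1)%R]) `&` (X `&` [set x | (p x.1 <= x.2)%R])).
    by apply: measurableI; apply: measurable_fun_le => //; [exact: msnd|exact: mcomp1|exact: mcomp1|exact: msnd].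
  apply/seteqP; split=> [x [Xx /= ->]|x [[Xx /= h] [_ h']]]; first by split; split => //=.
  by split => //=; apply/eqP; rewrite eq_le h.
by move=> s t t' [_ /= ->] [_ /= ->].
Qed.

Lemma volume_floor : vol (X `&` [set x | x.2 = 0%R]) = 0.
Proof. exact: (@volume_graph (fun=> 0%R)). Qed.

Lemma volume_subgraph (p : 'rV[R]_d.-1 -> R) : measurable_fun B p ->
  (forall s, B s -> (0 <= p s)%R) -> vol (subgraph B p) = \int[leb]_(s in B) (p s)%:E.
Proof.
move=> mp p0; rewrite volumeE [RHS]integral_mkcond; apply: eq_integral => s _.
rewrite patchE; case: ifPn => [/set_mem Bs|/negP nBs].
  rewrite (_ : xsection _ _ = `[0%R, p s]%classic).
    rewrite lebesgue_measure_itv/= lte_fin sube0.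
    by have := p0 _ Bs; rewrite le_eqVlt => /predU1P[<-|->//]; rewrite ltxx.
  rewrite xsectionE; apply/seteqP; split=> t /=; rewrite in_itv/=.
    by move=> [[_ /= ->] ->].
  by move=> /andP[t0 tp]; split.
rewrite (_ : xsection _ _ = set0) ?measure0// xsectionE.
by apply/seteqP; split=> t //= [[Bs _] _]; apply: nBs; exact: mem_set.
Qed.

Section potential.
Variable psi : 'rV[R]_d -> R.
Hypothesis psi_cont : {within Y, continuous psi}.
Local Notation f := (ctr Y c psi).

Definition sublevel t : set 'Rs[R]_d := X `&` [set x | (f x <= t)%R].

Let mf : measurable_fun X f := measurable_ctr H psi_cont.

Lemma measurable_sublevel t : measurable (sublevel t).
Proof. by apply: measurable_fun_le. Qed.

Lemma measurable_level t : measurable (X `&` [set x | f x = t]).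
Proof.
rewrite (_ : _ `&` _ = (X `&` [set x | (f x <= t)%R]) `&` (X `&` [set x | (t <= f x)%R])).
  by apply: measurableI; apply: measurable_fun_le.
apply/seteqP; split=> [x [Xx /= ->]|x [[Xx /= h] [_ h']]]; first by split; split => //=.
by split => //=; apply/eqP; rewrite eq_le h.
Qed.

(** The c-transform is strictly increasing along vertical lines. *)
Lemma volume_level t : vol (X `&` [set x | f x = t]) = 0.
Proof.
apply: volume_graph_like; first exact: measurable_level.
move=> s a b [[/= Bs a0] fa] [[/= _ b0] fb]; have [ab|ba|//] := ltgtP a b.
  by have := ctr_increasing H psi_cont Bs a0 ab; rewrite fa fb ltxx.
by have := ctr_increasing H psi_cont Bs b0 ba; rewrite fa fb ltxx.
Qed.

Lemma sublevel_lty t : vol (sublevel t) < +oo.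
Proof.
have [Q Q0 hQ] := ctr_coercive H psi_cont t.
apply: (@le_lt_trans _ _ (vol (B `*` [set p : R | (0 <= p <= Q)%R]))).
  apply: le_measure; rewrite ?inE; [exact: measurable_sublevel|exact: measurable_slab|].
  move=> [s p] [[/= Bs p0] /= fp]; split => //=; rewrite p0 /= leNgt; apply/negP => Qp.
  by have := hQ _ _ Bs (ltW Qp); rewrite ltNge fp.
by rewrite volumeX ?(ltW Q0)//; apply: lte_mul_pinfty; rewrite ?ltry// ge0_fin_numE ?base_lty.
Qed.

Local Notation mq t := (max_q Y c (fun y => psi y + t)%R).

Lemma measurable_max_q t : measurable_fun B (mq t).
Proof.
apply: (measurability _ (RGenCInfty.measurableE R)) => _ [_ [a ->] <-].
have [a0|a0] := leP a 0%R.
  rewrite (_ : _ `&` _ = B)//; apply/seteqP; split=> [s []//|s Bs]; split => //=.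
  by rewrite in_itv/= andbT (le_trans a0)// (max_q_ge0 H).
rewrite (_ : _ `&` _ = B `&` [set s | (f (s, a) <= t)%R]); last first.
  by apply/seteqP; split=> s [Bs]; rewrite /= in_itv/= andbT (le_max_q H)//; split.
apply: measurable_fun_le => //.
apply: (measurable_comp mX (f := f) (g := fun s => (s, a : measurableTypeR R))) => //.
  by move=> _ [s Bs <-]; split => //=; exact: ltW.
by apply: measurable_funS (measurable_pair2 a).
Qed.

(** Above the floor p = 0, which is a null set, the subgraph of max_q is the
    sublevel set of the c-transform. *)
Lemma volume_subgraph_max_q t A : measurable A ->
  vol (A `&` subgraph B (mq t)) = vol (A `&` sublevel t).
Proof.
move=> mA; have mS := measurable_sublevel t.
have mG := measurable_subgraph (measurable_max_q t).
have mF : measurable (X `&` [set x | x.2 = 0%R]).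
  rewrite (_ : [set x | _] = snd @^-1` [set 0%R])//; apply: measurableI => //.
  by rewrite -[X in measurable X]setTI; apply: measurable_snd.
have same x : ~ (X `&` [set x | x.2 = 0%R]) x -> subgraph B (mq t) x <-> sublevel t x.
  case: x => s p nF; have pos : X (s, p) -> (0 < p :> R)%R.
    move=> [/= Bs p0]; rewrite lt_neqAle; apply/andP; split; last exact: p0.
    by apply/eqP => pE; apply: nF; rewrite -pE; split => //; split => //=.
  split=> -[Xx h]; split => //=.
    by rewrite -(le_max_q H psi_cont) //; [exact: Xx.1|exact: pos].
  by rewrite (le_max_q H psi_cont) //; [exact: Xx.1|exact: pos].
have le C D : measurable C -> measurable D ->
    (forall x, ~ (X `&` [set x | x.2 = 0%R]) x -> C x -> D x) -> vol (A `&` C) <= vol (A `&` D).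
  move=> mC mD CD; apply: (@le_trans _ _ (vol ((A `&` D) `|` (X `&` [set x | x.2 = 0%R])))).
    apply: le_measure; rewrite ?inE; [exact: measurableI|by apply: measurableU => //; exact: measurableI|].
    move=> x [Ax Cx]; have [|nFx] := pselect ((X `&` [set x | x.2 = 0%R]) x); first by right.
    by left; split => //; exact: CD.
  apply: le_trans (measureU2 _ _ _) _ => //; first exact: measurableI.
  by rewrite [X in _ + X]volume_floor adde0.
by apply/eqP; rewrite eq_le !le// => x /same[].
Qed.

Lemma Pac_max_q t : vol (sublevel t) = 1 <-> Pac B (mq t).
Proof.
have E : \int[leb]_(s in B) (mq t s)%:E = vol (sublevel t).
  rewrite -volume_subgraph//; [|exact: measurable_max_q|by move=> s _; exact: (max_q_ge0 H)].
  by have := volume_subgraph_max_q t measurableT; rewrite !setTI.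
split=> [h|[_ _]]; last by rewrite E.
by split; [exact: measurable_max_q|move=> s _; exact: (max_q_ge0 H)|rewrite E].
Qed.

Let le_sublevel t t' : (t <= t')%R -> vol (sublevel t) <= vol (sublevel t').
Proof.
move=> tt'; apply: le_measure; rewrite ?inE; [exact: measurable_sublevel..|].
by move=> x [Xx /= h]; split => //=; exact: le_trans tt'.
Qed.

Let sublevel_ge1 : exists t, 1 <= vol (sublevel t).
Proof.
(* The depth for which the slab has volume 1; any upper bound of the
   c-transform on this compact slab is a suitable level. *)
pose Q : R := ((fine (leb B))^-1)%R.
have lebB : leb B = (fine (leb B))%:E by rewrite fineK// ge0_fin_numE// base_lty.
have b0 : (0 < fine (leb B))%R by rewrite -lte_fin -lebB base_gt0.
have cK : compact (B `*` [set p : R | (0 <= p <= Q)%R] : set 'Rs[R]_d).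
  apply: compact_setX; first exact: adm_compactB H.
  rewrite (_ : [set p | _] = `[0%R, Q]%classic); first exact: segment_compact.
  by apply/seteqP; split=> x /=; rewrite in_itv.
have KX : B `*` [set p : R | (0 <= p <= Q)%R] `<=` X by move=> x [Bx /andP[]].
have [M hM] := compact_continuous_bounded cK (continuous_subspaceW KX (ctr_continuous H psi_cont)).
exists M; apply: (@le_trans _ _ (vol (B `*` [set p : R | (0 <= p <= Q)%R]))).
  rewrite volumeX//; last by rewrite invr_ge0 ltW.
  by rewrite lebB subr0 -EFinM /Q mulfV// gt_eqF.
apply: le_measure; rewrite ?inE; [exact: measurable_slab|exact: measurable_sublevel|].
by move=> x Kx; split; [exact: KX|apply: le_trans (hM _ Kx); exact: ler_norm].
Qed.

(** The volume of the sublevels increases continuously from 0 to +oo, since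
    the levels are null sets; the threshold is the infimum of the t for which
    the volume is at least 1. *)
Lemma exists_tau : exists t, vol (sublevel t) = 1.
Proof.
pose S := [set t | 1 <= vol (sublevel t)].
have S0 : S !=set0 by exact: sublevel_ge1.
have [M M0 psiM] := psi_bounded H psi_cont.
have lbS : has_lbound S.
  exists (- M)%R => t St; rewrite leNgt; apply/negP => tM; move: St.
  rewrite /S /= (_ : sublevel t = set0) ?measure0 ?lee_fin ?ler10//.
  apply/seteqP; split=> // x [Xx /= fx].
  by have := ctr_ge H psi_cont psiM Xx; rewrite leNgt (le_lt_trans fx tM).
pose t := inf S; exists t; apply/eqP; rewrite eq_le; apply/andP; split; last first.
  rewrite leNgt; apply/negP => lt1.
  pose F n := sublevel (t + n.+1%:R^-1)%R.
  have mF n : measurable (F n) by exact: measurable_sublevel.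
  have capF : \bigcap_n F n = sublevel t.
    apply/seteqP; split=> [x h|x [Xx /= fx] n _]; last first.
      by split => //=; apply: le_trans fx _; rewrite lerDl invr_ge0.
    have [Xx _] := h 0%N Logic.I; split => //=; apply/ler_addgt0Pr => e e0.
    have [n _ /(_ _ (leqnn n))/= hn] := near_infty_natSinv_lt (PosNum e0).
    by have [_ /= fx] := h n Logic.I; apply: le_trans fx _; rewrite lerD2l ltW.
  have ndF : nonincreasing_seq F.
    move=> m n mn; apply/subsetPset => x [Xx /= fx]; split => //=; apply: le_trans fx _.
    by rewrite lerD2l lef_pV2 ?posrE// ler_nat.
  have := @nonincreasing_cvg_mu _ _ _ vol F (sublevel_lty _) mF _ ndF.
  rewrite capF => /(_ (measurable_sublevel t)) cv.
  have [n _ /(_ _ (leqnn n))/=] := cvge_near_lt cv lt1.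
  have [s Ss st] : exists2 s, S s & (s < t + n.+1%:R^-1)%R.
    by apply: inf_adherent => //; rewrite invr_gt0.
  by rewrite ltNge; apply/negP; rewrite negbK; apply: le_trans Ss _; apply: le_sublevel; exact: ltW.
pose F n := sublevel (t - n.+1%:R^-1)%R.
have mF n : measurable (F n) by exact: measurable_sublevel.
have F1 n : vol (F n) <= 1.
  rewrite leNgt; apply/negP => /ltW h.
  have : (t <= t - n.+1%:R^-1)%R by apply: ge_inf.
  by rewrite leNgt ltrBlDr ltrDl invr_gt0 ltr0n.
have ndF : nondecreasing_seq F.
  move=> m n mn; apply/subsetPset => x [Xx /= fx]; split => //=; apply: le_trans fx _.
  by rewrite lerD2l lerN2 lef_pV2 ?posrE// ler_nat.
have mUF : measurable (\bigcup_n F n) by exact: bigcup_measurable.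
have mL := measurable_level t.
have UF1 : vol (\bigcup_n F n) <= 1.
  have cv : vol (F n) @[n --> \oo] --> vol (\bigcup_n F n).
    exact: (nondecreasing_cvg_mu mF mUF ndF).
  rewrite -(cvg_lim (@ereal_hausdorff _) cv); apply: lime_le; first exact: (cvgP _ cv).
  exact: nearW.
apply: (@le_trans _ _ (vol ((\bigcup_n F n) `|` (X `&` [set x | f x = t])))).
  apply: le_measure; rewrite ?inE; [exact: measurable_sublevel|exact: measurableU|].
  move=> x [Xx /= fx]; have [ft|ft] := eqVneq (f x) t; first by right.
  have e0 : (0 < t - f x)%R by rewrite subr_gt0 lt_neqAle ft.
  have [n _ /(_ _ (leqnn n))/= hn] := near_infty_natSinv_lt (PosNum e0).
  by left; exists n => //; split => //=; rewrite lerBrDr -lerBrDl ltW.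
apply: le_trans (measureU2 _ _ _) _ => //.
by rewrite [X in _ + X]volume_level adde0.
Qed.

Lemma sublevel_tau : vol (sublevel (tau B Y c psi)) = 1.
Proof.
apply/Pac_max_q; apply: (@xgetPex _ 0%R [set t | Pac B (mq t)]).
by have [t /Pac_max_q] := exists_tau; exists t.
Qed.

Lemma p_bar_Pac : Pac B (p_bar B Y c psi).
Proof. by apply/Pac_max_q; exact: sublevel_tau. Qed.

End potential.
End level_sets.

(** * Restricted measures and the bathtub principle *)

Lemma le_measure_null (R : realType) d (T : measurableType d) (m : {measure set T -> \bar R})
    (C D N : set T) : measurable C -> measurable D -> m.-negligible N ->
  C `<=` D `|` N -> (m C <= m D)%E.
Proof.
move=> mC mD [N' [mN' N'0 NN']] CDN; apply: (@le_trans _ _ (m (D `|` N'))).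
  apply: le_measure; rewrite ?inE//; first exact: measurableU.
  by move=> x /CDN[|/NN']; [left|right].
by apply: le_trans (measureU2 _ _ _) _ => //; rewrite [X in (_ + X)%E]N'0 adde0.
Qed.

Section measure_lemmas.
Local Open Scope ereal_scope.
Context (R : realType) d (T : measurableType d) (m : {measure set T -> \bar R}).

Lemma restrict_measureE D A : measurable D -> restrict_measure m D A = m (A `&` D).
Proof. by move=> mD; rewrite /restrict_measure; case: pselect. Qed.

Lemma integral_null_diff (D D' : set T) (f : T -> \bar R) : measurable D -> measurable D' ->
  D' `<=` D -> m (D `\` D') = 0 -> measurable_fun D f ->
  \int[m]_(x in D) f x = \int[m]_(x in D') f x.
Proof.
move=> mD mD' D'D m0 mf; rewrite -{1}(setDUK D'D) integral_setU//.
- rewrite [X in _ + X]null_set_integral ?adde0//; first exact: measurableD.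
  by apply: measurable_funS mf => //; exact: subDsetl.
- exact: measurableD.
- by rewrite setDUK.
- by apply/disj_setPS; rewrite setDIK.
Qed.

Lemma integral_restrict_measure (D X : set T) (f : T -> \bar R) : measurable D -> measurable X ->
  D `<=` X -> measurable_fun X f ->
  \int[restrict_measure m D]_(x in X) f x = \int[m]_(x in D) f x.
Proof.
move=> mD mX DX mf.
transitivity (\int[restrict_measure m D]_(x in D) f x).
  rewrite -{1}(setDUK DX) integral_setU//.
  - rewrite [X in _ + X]null_set_integral ?adde0//; first exact: measurableD.
      by apply: measurable_funS mf => //; exact: subDsetl.
    by rewrite [LHS]restrict_measureE// setDE -setIA setICl setI0 measure0.
  - exact: measurableD.
  - by rewrite setDUK.
  - by apply/disj_setPS; rewrite setDIK.
apply: eq_measure_integral => A mA AD.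
by rewrite [LHS]restrict_measureE// setIidl.
Qed.

(** Bathtub principle. The sets E \ G and G \ E have the same measure, and
    h <= k on the first one whereas h > k on the second one. *)
Section bathtub.
Variables (X E G : set T) (h : T -> R) (k : R).
Hypotheses (mE : measurable E) (mG : measurable G) (mX : measurable X) (EX : E `<=` X) (GX : G `<=` X).
Hypotheses (fin_E : m E < +oo) (EG : m G = m E) (mh : measurable_fun X h) (k0 : (0 <= k)%R)
  (h0 : forall x, X x -> (0 <= h x)%R)
  (Ek : forall x, E x -> (h x <= k)%R) (kE : forall x, X x -> ~ E x -> (k < h x)%R).

Let mEG : measurable (E `\` G). Proof. exact: measurableD. Qed.
Let mGE : measurable (G `\` E). Proof. exact: measurableD. Qed.
Let mI : measurable (E `&` G). Proof. exact: measurableI. Qed.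

Let mhE D : D `<=` X -> measurable_fun D (fun x => (h x)%:E).
Proof. by move=> DX; apply: measurable_funS mX DX _; exact/measurable_EFinP. Qed.

Let measure_diff : m (E `\` G) = m (G `\` E).
Proof.
have finI : m (E `&` G) < +oo.
  by apply: le_lt_trans fin_E; apply: le_measure; rewrite ?inE.
have finG : m G < +oo by rewrite EG.
rewrite (measureD mE mG fin_E) (measureD mG mE finG) [G `&` E]setIC.
by congr (_ - _); exact: esym EG.
Qed.

Let splitE : \int[m]_(x in E) (h x)%:E =
  \int[m]_(x in E `&` G) (h x)%:E + \int[m]_(x in E `\` G) (h x)%:E.
Proof.
rewrite -{1}(setUIDK E G) integral_setU//; first by rewrite setUIDK; exact: mhE.
by apply/disj_setPS => x [[_ Gx] [_ nGx]].
Qed.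

Let splitG : \int[m]_(x in G) (h x)%:E =
  \int[m]_(x in E `&` G) (h x)%:E + \int[m]_(x in G `\` E) (h x)%:E.
Proof.
rewrite -{1}(setUIDK G E) integral_setU//.
- by rewrite [G `&` E]setIC.
- exact: measurableI.
- by rewrite setUIDK; exact: mhE.
- by apply/disj_setPS => x [[_ Gx] [_ nGx]].
Qed.

Let le_EG : \int[m]_(x in E `\` G) (h x)%:E <= k%:E * m (E `\` G).
Proof.
rewrite -integral_cst//; apply: ge0_le_integral => //.
- by move=> x [Ex _]; rewrite lee_fin h0//; exact: EX.
- by apply: mhE => x [] /EX.
- by move=> x [Ex _]; rewrite lee_fin Ek.
Qed.

Let ge_GE : k%:E * m (G `\` E) <= \int[m]_(x in G `\` E) (h x)%:E.
Proof.
rewrite -integral_cst//; apply: ge0_le_integral => //.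
- by apply: mhE => x [] /GX.
- by move=> x [Gx nE]; rewrite lee_fin ltW// kE//; exact: GX.
Qed.

Lemma bathtub_le : \int[m]_(x in E) (h x)%:E <= \int[m]_(x in G) (h x)%:E.
Proof.
rewrite splitE splitG leeD2l//; apply: le_trans le_EG _.
by rewrite measure_diff.
Qed.

Lemma bathtub_eq : \int[m]_(x in G) (h x)%:E <= \int[m]_(x in E) (h x)%:E -> m (G `\` E) = 0.
Proof.
rewrite splitE splitG leeD2lE; last first.
  rewrite ge0_fin_numE; last by apply: integral_ge0 => x [/EX Xx _]; rewrite lee_fin h0.
  apply: (@le_lt_trans _ _ (k%:E * m (E `&` G))).
    rewrite -integral_cst//; apply: ge0_le_integral => //.
    - by move=> x [Ex _]; rewrite lee_fin h0//; exact: EX.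
    - by apply: mhE => x [] /EX.
    - by move=> x [Ex _]; rewrite lee_fin Ek.
  apply: lte_mul_pinfty; rewrite ?lee_fin//.
  by apply: le_lt_trans fin_E; apply: le_measure; rewrite ?inE.
move=> /le_trans/(_ le_EG); rewrite measure_diff => le_k.
have finGE : k%:E * m (G `\` E) < +oo.
  apply: lte_mul_pinfty; rewrite ?lee_fin//; rewrite -measure_diff.
  by apply: le_lt_trans fin_E; apply: le_measure; rewrite ?inE.
have GEX : G `\` E `<=` X by move=> x [] /GX.
have mhk : measurable_fun (G `\` E) (fun x => (h x - k)%:E).
  apply/measurable_EFinP; apply: measurable_funB => //; exact: measurable_funS mh.
have hk0 x : (G `\` E) x -> 0 <= (h x - k)%:E.
  by move=> [Gx nE]; rewrite lee_fin subr_ge0 ltW// kE//; exact: GX.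
have int0 : \int[m]_(x in G `\` E) (h x - k)%:E = 0.
  have : \int[m]_(x in G `\` E) (h x)%:E = \int[m]_(x in G `\` E) (h x - k)%:E + k%:E * m (G `\` E).
    rewrite -integral_cst// -ge0_integralD//.
    by apply: eq_integral => x _; rewrite -EFinD subrK.
  move: le_k => /[swap] ->; rewrite -[leRHS]add0e leeD2rE; last first.
    by rewrite ge0_fin_numE// mule_ge0.
  move=> h'; apply/eqP; rewrite eq_le h' /=; exact: integral_ge0.
have := (ae_eq_integral_abs m mGE mhk).1.
rewrite (eq_integral (fun x => (h x - k)%:E)); last by move=> x /set_mem/hk0; exact: gee0_abs.
move=> /(_ int0) ae0; apply/negligibleP; first exact: mGE.
apply: negligibleS ae0 => x [Gx nE] /= /(_ (conj Gx nE)) [].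
by apply/eqP; rewrite subr_eq0 gt_eqF// kE//; exact: GX.
Qed.

End bathtub.
End measure_lemmas.

(** * The value of the dual functional *)

Section dual_value.
Local Open Scope ereal_scope.
Context (R : realType) (d : nat) (B : set 'rV[R]_d.-1) (Y : set 'rV[R]_d).
Variable c : 'rV[R]_d.-1 * R -> 'rV[R]_d -> R.
Hypothesis H : admissible B Y c.

Notation leb := (@lebesgue_rV R d.-1).
Notation vol := (volume R d).
Local Notation X := (cylinder B : set 'Rs[R]_d).

Let mB : measurable B := measurable_compact H.
Let mX : measurable X := measurable_cylinder H.

Lemma Pac_measurable_subgraph p : Pac B p -> measurable (subgraph B p).
Proof. by move=> [mp _ _]; exact: (measurable_subgraph H). Qed.

Lemma Pac_volume p : Pac B p -> vol (subgraph B p) = 1.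
Proof. by move=> [mp p0 p1]; rewrite volume_subgraph. Qed.

Let subgraphX p : subgraph B p `<=` X. Proof. by move=> x []. Qed.

Lemma ae_le_subgraph (p p' : 'rV[R]_d.-1 -> R) : measurable_fun B p -> measurable_fun B p' ->
  (forall s, B s -> (0 <= p' s)%R) -> vol (subgraph B p `\` subgraph B p') = 0 ->
  {ae leb, forall s, B s -> (p s <= p' s)%R}.
Proof.
move=> mp mp' p'0 v0.
have mD : measurable (subgraph B p `\` subgraph B p').
  by apply: measurableD; exact: (measurable_subgraph H).
apply: filterS (volume0_slices mD v0) => s slice0 Bs.
rewrite leNgt; apply/negP => lt.
have : 0 < lebesgue_measure `]p' s, p s]%classic.
  by rewrite lebesgue_measure_itv/= lte_fin lt -EFinB lte_fin subr_gt0.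
apply/negP; rewrite -leNgt -slice0; apply: le_measure; rewrite ?inE//; first exact: measurable_xsection.
move=> t /=; rewrite in_itv/= => /andP[p't tp]; apply/xsectionP; split.
  by split => //; split => //=; apply: le_trans (p'0 _ Bs) (ltW p't).
by move=> [_ /=]; rewrite leNgt p't.
Qed.

Section potential.
Variable psi : 'rV[R]_d -> R.
Hypothesis psi_cont : {within Y, continuous psi}.
Local Notation f := (ctr Y c psi).
Local Notation tau := (tau B Y c psi).
Local Notation pb := (p_bar B Y c psi).
Local Notation E := (sublevel B Y c psi tau).

Let mf : measurable_fun X f := measurable_ctr H psi_cont.
Let mE : measurable E := measurable_sublevel H psi_cont tau.
Let E1 : vol E = 1 := sublevel_tau H psi_cont.
Let pbP : Pac B pb := p_bar_Pac H psi_cont.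
Let EX : E `<=` X. Proof. by move=> x []. Qed.

Let mfE D : D `<=` X -> measurable_fun D (fun x => (f x)%:E).
Proof. by move=> DX; apply: measurable_funS mX DX _; exact/measurable_EFinP. Qed.

(** A constant making both the shifted c-transform and the shifted threshold
    nonnegative. *)
Let exists_shift : exists M, [/\ (0 <= M)%R, (0 <= tau + M)%R,
  forall x, X x -> (- M <= f x)%R & forall y, Y y -> (`|psi y| <= M)%R].
Proof.
have [M M0 psiM] := psi_bounded H psi_cont.
exists (M + `|tau|)%R; split.
- by rewrite addr_ge0.
- by have := ler_norm (- tau)%R; rewrite normrN; lra.
- by move=> x Xx; have := ctr_ge H psi_cont psiM Xx; have := normr_ge0 tau; lra.
- by move=> y Yy; have := psiM _ Yy; have := normr_ge0 tau; lra.
Qed.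

Let shift D M : measurable D -> D `<=` X -> vol D = 1 -> (0 <= M)%R ->
  (forall x, X x -> (- M <= f x)%R) ->
  \int[vol]_(x in D) (f x + M)%:E = \int[vol]_(x in D) (f x)%:E + M%:E.
Proof.
move=> mD DX D1 M0 fM; have finD : vol D < +oo by rewrite [vol D]D1 ltry.
rewrite integral_shift//.
- by rewrite [vol D]D1 mule1.
- exact: measurable_funS mf.
- by move=> x /DX/fM; lra.
Qed.

Lemma dual_value_le p : Pac B p ->
  \int[vol]_(x in E) (f x)%:E <= \int[vol]_(x in subgraph B p) (f x)%:E.
Proof.
move=> pP; have [M [M0 tM fM _]] := exists_shift.
rewrite -(@leeD2rE _ M%:E)// -!shift ?Pac_volume//; last exact: Pac_measurable_subgraph.
apply: (@bathtub_le _ _ _ _ X E _ (fun x => f x + M)%R (tau + M)%R) => //.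
- exact: Pac_measurable_subgraph.
- by rewrite [X in X < _]E1 ltry.
- by rewrite [LHS]Pac_volume// [RHS]E1.
- exact: measurable_funD.
- by move=> x /fM; lra.
- by move=> x [_ /=]; lra.
- by move=> x Xx nEx; rewrite ltrD2r ltNge; apply/negP => h; apply: nEx.
Qed.

(** Equality in the bathtub principle makes the subgraph of p agree with E, and
    hence with the subgraph of p_bar, up to a null set; the slices then agree. *)
Lemma dual_value_eq p : Pac B p ->
  \int[vol]_(x in subgraph B p) (f x)%:E <= \int[vol]_(x in E) (f x)%:E ->
  {ae leb, forall s, B s -> p s = pb s}.
Proof.
move=> pP; have [M [M0 tM fM _]] := exists_shift.
have mG := Pac_measurable_subgraph pP; have mGb := Pac_measurable_subgraph pbP.
have G1 := Pac_volume pP; have Gb1 := Pac_volume pbP.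
rewrite -(@leeD2rE _ M%:E)// -!shift// => le.
have GE0 : vol (subgraph B p `\` E) = 0.
  apply: (@bathtub_eq _ _ _ _ X E _ (fun x => f x + M)%R (tau + M)%R) => //.
  - by rewrite [X in X < _]E1 ltry.
  - by rewrite [LHS]G1 [RHS]E1.
  - exact: measurable_funD.
  - by move=> x /fM; lra.
  - by move=> x [_ /=]; lra.
  - by move=> x Xx nEx; rewrite ltrD2r ltNge; apply/negP => h; apply: nEx.
have GI1 : vol (subgraph B p `&` subgraph B pb) = 1.
  rewrite [LHS](volume_subgraph_max_q H psi_cont)// -[RHS]G1.
  rewrite -[in RHS](setUIDK (subgraph B p) E) measureU//.
  - by rewrite [X in _ = _ + X]GE0 adde0.
  - exact: measurableI.
  - exact: measurableD.
  - by apply/seteqP; split=> // x [[_ ?] []].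
have D0 p1 p2 : measurable (subgraph B p1) -> measurable (subgraph B p2) ->
    vol (subgraph B p1) = 1 -> vol (subgraph B p1 `&` subgraph B p2) = 1 ->
    vol (subgraph B p1 `\` subgraph B p2) = 0.
  move=> m1 m2 v1 v12; rewrite [LHS]measureD//.
    by rewrite [X in X - _]v1 [X in _ - X]v12 subee.
  by rewrite [X in X < _]v1 ltry.
have [mp p0 _] := pP; have [mpb pb0 _] := pbP.
have := ae_le_subgraph mp mpb pb0 (D0 _ _ mG mGb G1 GI1).
have GbI1 : vol (subgraph B pb `&` subgraph B p) = 1 by rewrite setIC.
have := ae_le_subgraph mpb mp p0 (D0 _ _ mGb mG Gb1 GbI1).
apply: filterS2 => s h1 h2 Bs; apply/eqP.
by rewrite eq_le h1// h2.
Qed.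

Lemma dual_value_p_bar :
  \int[vol]_(x in subgraph B pb) (f x)%:E = \int[vol]_(x in E) (f x)%:E.
Proof.
have mGb := Pac_measurable_subgraph pbP.
transitivity (\int[vol]_(x in subgraph B pb `&` E) (f x)%:E).
  apply: integral_null_diff => //; [exact: measurableI| |exact: mfE].
  rewrite setDIr setDv set0U setDE setIC.
  by rewrite [LHS](volume_subgraph_max_q H psi_cont) ?setICl ?measure0//; exact: measurableC.
apply/esym; apply: integral_null_diff => //; [exact: measurableI| |exact: mfE].
rewrite setDIr setDv setU0 setDE setIC.
by rewrite -[LHS](volume_subgraph_max_q H psi_cont) ?setICl ?measure0//; exact: measurableC.
Qed.

Lemma dual_value_fin : \int[vol]_(x in E) (f x)%:E \is a fin_num.
Proof.
have [M [M0 tM fM _]] := exists_shift.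
apply: integrable_fin_num => //; apply: measurable_bounded_integrable => //.
- by rewrite [X in X < _]E1 ltry.
- exact: measurable_funS mf.
exists (M + `|tau|)%R; split; first exact: num_real.
move=> z /ltW Mz x [Xx /= ft]; apply: le_trans Mz; rewrite ler_norml.
have := fM _ Xx; have := normr_ge0 tau; have := ler_norm tau; move: ft => /=.
by move=> ? ? ? ?; apply/andP; split; lra.
Qed.

Variable nu : {measure set 'rV[R]_d -> \bar R}.

Lemma kantorovich_surface p : Pac B p -> kantorovich X Y c (mu_surface B p) nu psi =
  \int[vol]_(x in subgraph B p) (f x)%:E + \int[nu]_(y in Y) (psi y)%:E.
Proof.
move=> pP; rewrite /kantorovich; congr (_ + _).
by rewrite [LHS]integral_restrict_measure//; [exact: Pac_measurable_subgraph|exact: mfE].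
Qed.

(** The infimum over the densities is reached at p_bar, whose subgraph is the
    sublevel E up to a null set. *)
Lemma G_dualE : G_dual B Y c nu psi =
  \int[vol]_(x in E) (f x)%:E + \int[nu]_(y in Y) (psi y)%:E.
Proof.
apply/eqP; rewrite eq_le; apply/andP; split.
  by apply: ereal_inf_lbound; exists pb => //; rewrite kantorovich_surface// dual_value_p_bar.
apply: le_ereal_inf_tmp => _ [p pP <-]; rewrite kantorovich_surface// leeD2r//.
exact: dual_value_le.
Qed.

End potential.
End dual_value.

(** * The extended dual problem *)

Section extended_dual.
Local Open Scope ereal_scope.
Context (R : realType) (d : nat) (B : set 'rV[R]_d.-1) (Y : set 'rV[R]_d).
Variable c : 'rV[R]_d.-1 * R -> 'rV[R]_d -> R.
Hypothesis H : admissible B Y c.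
Variables (y_ext : 'rV[R]_d) (P : R).
Hypotheses (y_extNY : ~ Y y_ext) (P_gt0 : (0 < P)%R)
  (P_bound : forall psi, Cont Y psi -> forall s, B s -> (p_bar B Y c psi s <= P)%R).

Notation leb := (@lebesgue_rV R d.-1).
Notation vol := (volume R d).
Local Notation X := (cylinder B : set 'Rs[R]_d).
Local Notation S := (B `*` [set p : R | (0 <= p <= P)%R] : set 'Rs[R]_d).
Local Notation Yx := (ext_Y Y y_ext).
Local Notation cx := (ext_c c y_ext).

Let mB : measurable B := measurable_compact H.
Let mX : measurable X := measurable_cylinder H.
Let mY : measurable Y := measurable_target H.
Let mS : measurable S := measurable_slab H P.

Lemma slab_cylinder : S `<=` X.
Proof. by move=> x [Bx /andP[]]. Qed.

Lemma closed_singleton_rV n (y : 'rV[R]_n) : closed [set y].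
Proof. by apply: compact_closed; [exact: norm_hausdorff|exact: compact_set1]. Qed.

Let closedY : closed Y.
Proof. by apply: compact_closed; [exact: norm_hausdorff|exact: adm_compactY H]. Qed.

Let mpt : measurable [set y_ext].
Proof. by apply: borel_closed; [exact: borel_rV|exact: closed_singleton_rV]. Qed.

Lemma measurable_ext_Y : measurable Yx.
Proof. exact: measurableU. Qed.

Lemma compact_ext_Y : compact Yx.
Proof. by apply: compactU; [exact: adm_compactY H|exact: compact_set1]. Qed.

Let ext_Y_neq y : Yx y -> y != y_ext -> Y y.
Proof. by move=> [//|->]; rewrite eqxx. Qed.

Let Y_neq y : Y y -> (y == y_ext) = false.
Proof. by move=> Yy; apply/negP => /eqP E; apply: y_extNY; rewrite -E. Qed.

Lemma ext_c_ge0 x y : X x -> Yx y -> (0 <= cx x y)%R.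
Proof.
move=> Xx Yy; rewrite /ext_c; case: ifPn => // /(ext_Y_neq Yy).
exact: adm_ge0 H _ _ Xx.
Qed.

Let near_pt : \forall y \near y_ext, ~ Y y.
Proof. by apply: open_nbhs_nbhs; split => //; exact: closed_openC. Qed.

Let near_Y y : Y y -> \forall y' \near y, y' != y_ext.
Proof.
move=> Yy; have : nbhs y (~` [set y_ext]).
  apply: open_nbhs_nbhs; split; first by apply: closed_openC; exact: closed_singleton_rV.
  by move=> /= E; apply: y_extNY; rewrite -E.
by apply: filterS => y' /= /eqP.
Qed.

(** The added point is isolated, hence extending a function to it never
    breaks continuity. *)
Lemma ext_c_continuous : {within X `*` Yx, continuous (fun z : 'Rs[R]_d * 'rV[R]_d => cx z.1 z.2)}.
Proof.
apply/within_continuousP => -[x y] [/= Xx Yy] e e0.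
have [->|yy] := eqVneq y y_ext.
  exists (setT, ~` Y); first by split => //=; exact: filterT.
  move=> [x' y'] /= [_ nY] [_ [//|->]].
  by rewrite /ext_c eqxx subrr normr0.
have Yy' := ext_Y_neq Yy yy.
have h := (within_continuousP _ _).1 (cost_continuous H) (x, y) (conj Xx Yy') _ e0.
have h' : \forall z \near (x, y), z.2 != y_ext.
  exists (setT, [set y' | y' != y_ext]); first by split => /=; [exact: filterT|exact: near_Y].
  by move=> [x' y'] /= [].
apply: filterS2 h h' => -[x' y'] /= h ny' [Xx' Yx'].
by rewrite /ext_c (negbTE yy) (negbTE ny'); apply: h; split => //; exact: ext_Y_neq.
Qed.

Lemma Cont_ext phi : Cont Yx phi -> Cont Y phi.
Proof. by move=> cphi; apply: continuous_subspaceW cphi; exact: subsetUl. Qed.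

Lemma Cont_ext_psi psi : Cont Y psi -> Cont Yx (ext_psi B Y c y_ext psi).
Proof.
move=> cpsi; apply/within_continuousP => y Yy e e0.
have [->|yy] := eqVneq y y_ext.
  apply: filterS near_pt => y' nY [//|->].
  by rewrite subrr normr0.
have Yy' := ext_Y_neq Yy yy.
have := (within_continuousP _ _).1 cpsi y Yy' _ e0.
apply: filterS2 (near_Y Yy') => y' ny' h Yx'.
by rewrite /ext_psi (negbTE yy) (negbTE ny'); apply: h; exact: ext_Y_neq.
Qed.

Lemma measurable_ext_c : measurable_fun (X `*` Yx) (fun z : 'Rs[R]_d * 'rV[R]_d => cx z.1 z.2).
Proof.
apply: within_continuous_measurable.
- exact: borel_rV_R_rV.
- by apply: measurableX => //; exact: measurable_ext_Y.
- exact: ext_c_continuous.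
Qed.

(** The added point contributes the constant - phi y_ext to the infimum. *)
Lemma ext_c_transform phi x : Cont Y phi -> X x ->
  c_transform Yx cx phi x = Num.min (ctr Y c phi x) (- phi y_ext)%R.
Proof.
move=> cphi Xx; have [y Yy [fE fmin]] := ctr_attained H cphi Xx.
apply/eqP; rewrite eq_le; apply/andP; split.
  have lb : has_lbound [set (cx x y - phi y)%R | y in Yx].
    exists (Num.min (ctr Y c phi x) (- phi y_ext)%R) => _ [y' Yy' <-]; rewrite /ext_c.
    rewrite ge_min; have [->|ny'] := eqVneq y' y_ext; first by rewrite sub0r lexx orbT.
    by rewrite fE fmin//; exact: ext_Y_neq.
  rewrite le_min fE; apply/andP; split.
    by apply: ge_inf => //; exists y; [left|rewrite /ext_c Y_neq].
  by apply: ge_inf => //; exists y_ext; [right|rewrite /ext_c eqxx sub0r].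
apply: lb_le_inf; first by exists (cx x y - phi y)%R, y => //; left.
move=> _ [y' Yy' <-]; rewrite /ext_c ge_min.
have [->|ny'] := eqVneq y' y_ext; first by rewrite sub0r lexx orbT.
by rewrite fE fmin//; exact: ext_Y_neq.
Qed.

Lemma ctr_ext_psi psi x : ctr Y c (ext_psi B Y c y_ext psi) x = ctr Y c psi x.
Proof.
rewrite /ctr /c_transform; congr inf; apply/seteqP.
by split=> _ [y Yy <-]; exists y; rewrite //= /ext_psi Y_neq.
Qed.

Lemma volume_slab : vol S = (P * fine (leb B))%:E.
Proof.
rewrite volumeX//; last exact: ltW.
by rewrite subr0 mulrC EFinM fineK// ge0_fin_numE// (base_lty H).
Qed.

Lemma sublevel_slab psi : Cont Y psi -> sublevel B Y c psi (tau B Y c psi) `<=` S.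
Proof.
move=> cpsi [s p] [[/= Bs p0] fp]; split => //=; rewrite p0 /=.
have [->|pn0] := eqVneq (p : R) 0%R; first exact: ltW.
apply: le_trans (P_bound cpsi Bs); rewrite /p_bar (le_max_q H cpsi)//.
by rewrite lt_neqAle eq_sym pn0.
Qed.

Section slab.
Variable psi : 'rV[R]_d -> R.
Hypothesis psi_cont : Cont Y psi.
Local Notation f := (ctr Y c psi).
Local Notation tau := (tau B Y c psi).
Local Notation E := (sublevel B Y c psi tau).

Let mE : measurable E := measurable_sublevel H psi_cont tau.
Let E1 : vol E = 1 := sublevel_tau H psi_cont.
Let ES : E `<=` S := sublevel_slab psi_cont.
Let mf : measurable_fun X f := measurable_ctr H psi_cont.

(** The slab contains E, whose volume is 1, so the truncation in ext_mass is
    inactive. *)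
Lemma ext_massE : ext_mass B P = (P * fine (leb B) - 1)%R.
Proof.
apply/max_idPr; rewrite subr_ge0 -lee_fin -volume_slab -[leLHS]E1.
by apply: le_measure; rewrite ?inE.
Qed.

Lemma volume_slab_diff : vol (S `\` E) = (ext_mass B P)%:E.
Proof.
rewrite [LHS]measureD//; last by rewrite [X in X < _]volume_slab ltry.
by rewrite setIidr// [X in X - _]volume_slab [X in _ - X]E1 ext_massE EFinB.
Qed.

Let integrable_min t D : measurable D -> D `<=` S ->
  vol.-integrable D (EFin \o (fun x => Num.min (f x) t)).
Proof.
move=> mD DS; have [M M0 psiM] := psi_bounded H psi_cont.
apply: measurable_bounded_integrable => //.
- apply: (@le_lt_trans _ _ (vol S)); first by apply: le_measure; rewrite ?inE.
  by rewrite [X in X < _]volume_slab ltry.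
- apply: measurable_funS mX _ _; first by move=> x /DS/slab_cylinder.
  exact: measurable_minr.
exists (M + `|t|)%R; split; first exact: num_real.
move=> z /ltW Mz x /DS/slab_cylinder Xx; apply: le_trans Mz.
have f_ge := ctr_ge H psi_cont psiM Xx.
have t1 := ler_norm t; have t2 := ler_norm (- t)%R; rewrite normrN in t2.
rewrite ler_norml le_min ge_min -andbA; apply/and3P; split; [lra|lra|].
by apply/orP; right; lra.
Qed.

(** Bound the minimum by f on E and by t on the rest of the slab. *)
Lemma ext_slab_le t : \int[vol]_(x in S) (Num.min (f x) t)%:E <=
  \int[vol]_(x in E) (f x)%:E + (t * ext_mass B P)%:E.
Proof.
have mSE : measurable (S `\` E) by exact: measurableD.
have SES : S `\` E `<=` S by exact: subDsetl.
rewrite -{1}(setDUK ES) integral_setU//; last 2 first.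
- rewrite setDUK//; have /integrableP[] := integrable_min t mS (@subset_refl _ S); exact.
- by apply/disj_setPS; rewrite setDIK.
apply: leeD.
  apply: le_integral => //; first exact: integrable_min.
    have := integrable_min tau mE ES; apply: eq_integrable => // x /set_mem [_ /= fx].
    by rewrite /= min_l.
  by move=> x _; rewrite /= lee_fin ge_min lexx.
apply: (@le_trans _ _ (\int[vol]_(x in S `\` E) cst t%:E x)); last first.
  by rewrite integral_cst// [X in _ * X]volume_slab_diff.
apply: le_integral => //; first exact: integrable_min.
  apply: (@measurable_bounded_integrable _ _ _ _ (cst t)) => //.
    by rewrite [X in X < _]volume_slab_diff ltry.
  by exists `|t|%R; split; [exact: num_real|move=> z /ltW tz x _].
by move=> x _; rewrite /= lee_fin ge_min lexx orbT.
Qed.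

(** For t = tau both bounds are equalities, since E is where f <= tau. *)
Lemma ext_slab_eq : \int[vol]_(x in S) (Num.min (f x) tau)%:E =
  \int[vol]_(x in E) (f x)%:E + (tau * ext_mass B P)%:E.
Proof.
have mSE : measurable (S `\` E) by exact: measurableD.
rewrite -{1}(setDUK ES) integral_setU//; last 2 first.
- rewrite setDUK//; have /integrableP[] := integrable_min tau mS (@subset_refl _ S); exact.
- by apply/disj_setPS; rewrite setDIK.
congr (_ + _).
  by apply: eq_integral => x /set_mem [_ /= fx]; rewrite min_l.
rewrite EFinM -volume_slab_diff -integral_cst//; apply: eq_integral => x /set_mem [Sx nE].
rewrite min_r//; apply/ltW; rewrite ltNge; apply/negP => h; apply: nE; split => //.
exact: slab_cylinder.
Qed.

End slab.
End extended_dual.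

Section extended_kantorovich.
Local Open Scope ereal_scope.
Context (R : realType) (d : nat) (B : set 'rV[R]_d.-1) (Y : set 'rV[R]_d).
Variable c : 'rV[R]_d.-1 * R -> 'rV[R]_d -> R.
Hypothesis H : admissible B Y c.
Variables (y_ext : 'rV[R]_d) (P : R).
Hypotheses (y_extNY : ~ Y y_ext) (P_gt0 : (0 < P)%R)
  (P_bound : forall psi, Cont Y psi -> forall s, B s -> (p_bar B Y c psi s <= P)%R).
Variable nu : {measure set 'rV[R]_d -> \bar R}.
Hypotheses (nuT : nu setT = 1) (nuY : nu (~` Y) = 0).

Notation vol := (volume R d).
Local Notation X := (cylinder B : set 'Rs[R]_d).
Local Notation S := (B `*` [set p : R | (0 <= p <= P)%R] : set 'Rs[R]_d).
Local Notation Yx := (ext_Y Y y_ext).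
Local Notation cx := (ext_c c y_ext).
Local Notation mux := (ext_mu B P).
Local Notation nux := (ext_nu B y_ext P nu).
Local Notation mass := (ext_mass B P).

Let mX : measurable X := measurable_cylinder H.
Let mY : measurable Y := measurable_target H.
Let mS : measurable S := measurable_slab H P.
Let mYx : measurable Yx := measurable_ext_Y H y_ext.
Let mpt : measurable [set y_ext].
Proof. by apply: borel_closed; [exact: borel_rV|exact: closed_singleton_rV]. Qed.

Lemma ext_muE A : measurable A -> mux A = vol (A `&` S).
Proof. by move=> mA; rewrite [LHS]restrict_measureE. Qed.

Lemma ext_nuE A : nux A = nu A + mass%:E * \d_y_ext A.
Proof. exact: measure_addE. Qed.

Lemma Cont_integrable phi (m : {measure set 'rV[R]_d -> \bar R}) : Cont Yx phi ->
  m setT < +oo -> m.-integrable Yx (EFin \o phi).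
Proof.
move=> cphi mT; apply: measurable_bounded_integrable => //.
- by apply: le_lt_trans mT; apply: le_measure; rewrite ?inE.
- by apply: within_continuous_measurable => //; exact: borel_rV.
have [M hM] := compact_continuous_bounded (@compact_ext_Y _ _ _ _ _ H y_ext) cphi.
exists M; split; first exact: num_real.
by move=> x /ltW Mx y Yy; apply: le_trans Mx; exact: hM.
Qed.

Let mphi phi D : Cont Yx phi -> measurable D -> D `<=` Yx ->
  measurable_fun D (fun y => (phi y)%:E).
Proof.
move=> cphi mD DY; apply: (measurable_funS mYx DY).
have nuTy : nu setT < +oo by rewrite nuT ltry.
by have /integrableP[] := Cont_integrable cphi nuTy.
Qed.

Let integral_nux phi : Cont Yx phi -> \int[nux]_(y in Yx) (phi y)%:E =
  \int[nu]_(y in Y) (phi y)%:E + (mass * phi y_ext)%:E.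
Proof.
move=> cphi; have mT : mscale (NngNum (ext_mass_ge0 B P)) \d_y_ext [set: 'rV[R]_d] < +oo.
  by rewrite /mscale /= diracT mule1 ltry.
rewrite integral_measure_add//; last 2 first.
- by apply: Cont_integrable => //; rewrite nuT ltry.
- exact: Cont_integrable.
congr (_ + _).
  apply: integral_null_diff => //; [exact: subsetUl| |exact: mphi].
  apply/eqP; rewrite -measure_le0 -nuY; apply: le_measure; rewrite ?inE.
  - exact: measurableD.
  - exact: measurableC.
  - by move=> y [].
rewrite (@integral_null_diff _ _ _ _ _ [set y_ext])//; last 3 first.
- exact: subsetUr.
- rewrite /= /mscale /= diracE memNset ?mule0// => -[_ /=]; exact.
- exact: mphi.
rewrite (eq_integral (cst (phi y_ext)%:E)); last by move=> y /set_mem ->.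
rewrite integral_cst// mulrC EFinM; congr (_ * _).
by change (mass%:E * \d_y_ext [set y_ext] = mass%:E); rewrite diracE mem_set// mule1.
Qed.

Let cxt phi x := c_transform Yx cx phi x.

Let measurable_cxt phi : Cont Yx phi -> measurable_fun X (fun x : 'Rs[R]_d => (cxt phi x)%:E).
Proof.
move=> cphi; apply/measurable_EFinP.
apply: within_continuous_measurable => //; first exact: borel_rV_R.
have Yx0 : Yx !=set0 by exists y_ext; right.
have cK := @compact_ext_Y _ _ _ _ _ H y_ext.
apply: (continuous_inf cK Yx0 (ext_c_continuous H y_extNY)) => x Xx.
have [y Yy [_ h]] := inf_attained cK Yx0 (ext_c_continuous H y_extNY) Xx cphi.
by exists (cx x y - phi y)%R => _ [y' Yy' <-]; exact: h.
Qed.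

Let integral_mux phi : Cont Yx phi -> \int[mux]_(x in X) (cxt phi x)%:E =
  \int[vol]_(x in S) (Num.min (ctr Y c phi x) (- phi y_ext))%:E.
Proof.
move=> cphi; rewrite integral_restrict_measure//; [|exact: slab_cylinder|exact: measurable_cxt].
apply: eq_integral => x /set_mem/slab_cylinder Xx; congr EFin.
by apply: (ext_c_transform H y_extNY) => //; exact: (@Cont_ext _ _ _ _ _ cphi).
Qed.

(** The slab, which carries ext_mu, is compact, contrary to X. *)
Lemma kantorovich_slab phi : Cont Yx phi ->
  kantorovich S Yx cx mux nux phi = kantorovich X Yx cx mux nux phi.
Proof.
move=> cphi; rewrite /kantorovich; congr (_ + _).
rewrite [LHS]integral_restrict_measure//; last first.
  by apply: (measurable_funS mX (@slab_cylinder _ _ B P)); exact: measurable_cxt.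
rewrite [RHS]integral_restrict_measure//; [exact: slab_cylinder|exact: measurable_cxt].
Qed.

Lemma potential_fin (psi : 'rV[R]_d -> R) : Cont Y psi -> \int[nu]_(y in Y) (psi y)%:E \is a fin_num.
Proof.
move=> cpsi; apply: integrable_fin_num => //.
have [M M0 psiM] := psi_bounded H cpsi.
apply: measurable_bounded_integrable => //.
- by apply: (@le_lt_trans _ _ (nu setT)); [apply: le_measure; rewrite ?inE|rewrite nuT ltry].
- by apply: within_continuous_measurable => //; exact: borel_rV.
exists M; split; first exact: num_real.
by move=> x /ltW Mx y Yy; apply: le_trans Mx; exact: psiM.
Qed.

(** The value at y_ext of an extended potential is minus the threshold at
    which the c-transform is truncated; the best threshold is tau. *)
Lemma kantorovich_ext_le phi : Cont Yx phi ->
  kantorovich X Yx cx mux nux phi <= G_dual B Y c nu phi.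
Proof.
move=> cphi; have cphiY := @Cont_ext _ _ _ _ _ cphi.
rewrite /kantorovich integral_nux// [X in X + _]integral_mux// (G_dualE H cphiY).
rewrite addeCA addeC [leRHS]addeC.
have := ext_slab_le H P_gt0 P_bound cphiY (- phi y_ext)%R.
have := potential_fin cphiY; case: (\int[nu]_(y in Y) _) => // r _.
have := dual_value_fin H cphiY; case: (\int[vol]_(x in sublevel _ _ _ _ _) _) => // v _.
case: (\int[vol]_(x in S) _) => [u| |] //=; rewrite -?EFinD ?lee_fin//.
  by rewrite mulNr mulrC; lra.
by move=> _; exact: leNye.
Qed.

Lemma kantorovich_ext_psi psi : Cont Y psi ->
  kantorovich X Yx cx mux nux (ext_psi B Y c y_ext psi) = G_dual B Y c nu psi.
Proof.
move=> cpsi; have cphi := @Cont_ext_psi _ _ _ _ _ H _ y_extNY _ cpsi.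
rewrite /kantorovich integral_nux// [X in X + _]integral_mux// (G_dualE H cpsi).
have -> : ext_psi B Y c y_ext psi y_ext = (- tau B Y c psi)%R by rewrite /ext_psi eqxx.
rewrite (eq_integral (fun x => (Num.min (ctr Y c psi x) (tau B Y c psi))%:E)); last first.
  by move=> x _; rewrite ctr_ext_psi// opprK.
rewrite (ext_slab_eq H P_gt0 P_bound cpsi).
rewrite (@eq_integral _ _ _ nu Y (fun y => (psi y)%:E)); last first.
  move=> y /set_mem Yy; rewrite /ext_psi ifF//.
  by apply/negP => /eqP E; apply: y_extNY; rewrite -E.
have := potential_fin cpsi; case: (\int[nu]_(y in Y) _) => // r _.
have := dual_value_fin H cpsi; case: (\int[vol]_(x in sublevel _ _ _ _ _) _) => // v _.
by rewrite -!EFinD; congr EFin; ring.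
Qed.

(** Every function on Y extends, and the restriction to Y of an extended
    potential does at least as well. *)
Lemma argmax_ext psi : Cont Y psi ->
  argmax (Cont Y) (G_dual B Y c nu) psi <->
  argmax (Cont Yx) (kantorovich X Yx cx mux nux) (ext_psi B Y c y_ext psi).
Proof.
move=> cpsi; split=> -[_ h]; split => //.
- exact: Cont_ext_psi.
- move=> phi cphi; rewrite kantorovich_ext_psi//.
  by apply: le_trans (kantorovich_ext_le cphi) _; apply: h; exact: (@Cont_ext _ _ _ _ _ cphi).
- move=> psi' cpsi'; rewrite -!kantorovich_ext_psi//.
  by apply: h; exact: Cont_ext_psi.
Qed.

End extended_kantorovich.

(** * Plans of the extended problem *)

Section extended_plans.
Local Open Scope ereal_scope.
Context (R : realType) (d : nat) (B : set 'rV[R]_d.-1) (Y : set 'rV[R]_d).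
Variable c : 'rV[R]_d.-1 * R -> 'rV[R]_d -> R.
Hypothesis H : admissible B Y c.
Variables (y_ext : 'rV[R]_d) (P : R).
Hypotheses (y_extNY : ~ Y y_ext) (P_gt0 : (0 < P)%R)
  (P_bound : forall psi, Cont Y psi -> forall s, B s -> (p_bar B Y c psi s <= P)%R).
Variable nu : {measure set 'rV[R]_d -> \bar R}.
Hypotheses (nuT : nu setT = 1) (nuY : nu (~` Y) = 0).

Local Notation X := (cylinder B : set 'Rs[R]_d).
Local Notation S := (B `*` [set p : R | (0 <= p <= P)%R] : set 'Rs[R]_d).
Local Notation Yx := (ext_Y Y y_ext).
Local Notation cx := (ext_c c y_ext).
Local Notation mux := (ext_mu B P).
Local Notation nux := (ext_nu B y_ext P nu).

Let mX : measurable X := measurable_cylinder H.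
Let mY : measurable Y := measurable_target H.
Let mS : measurable S := measurable_slab H P.
Let mYx : measurable Yx := @measurable_ext_Y _ _ _ _ _ H y_ext.
Let SX : S `<=` X := @slab_cylinder _ _ B P.

Lemma weak_duality p psi (g : {measure set ('Rs[R]_d * 'rV[R]_d) -> \bar R}) :
  Pac B p -> Cont Y psi -> couplings (mu_surface B p) nu g ->
  kantorovich X Y c (mu_surface B p) nu psi <= plan_cost X Y c g.
Proof.
move=> pP cpsi cg; have [M M0 psiM] := psi_bounded H cpsi.
have mG := Pac_measurable_subgraph H pP.
apply: (@dual_le_plan_cost _ _ _ _ _ _ _ _ _ _ mX mY _ nuY _ cg c _ psi M) => //.
- rewrite [LHS]restrict_measureE//.
  by rewrite (_ : _ `&` _ = set0) ?measure0//; apply/seteqP; split=> // x [nX [/nX]].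
- by rewrite [X in X < _]restrict_measureE// setTI [X in X < _](Pac_volume pP) ltry.
- exact: adm_ge0 H.
- exact: measurable_cost H.
- have mf : measurable_fun X (ctr Y c psi) := measurable_ctr H cpsi.
  exact: mf.
- by apply: within_continuous_measurable => //; exact: borel_rV.
- by move=> x Xx; exact: (ctr_ge H cpsi psiM Xx).
- by move=> x y Xx Yy; rewrite -lerBrDr; exact: (ctr_le H cpsi Xx Yy).
Qed.

Let mux_fin : mux setT < +oo.
Proof. by rewrite [X in X < _](ext_muE H) // setTI [X in X < _](volume_slab H P_gt0) ltry. Qed.

Let nux_fin : nux setT < +oo.
Proof. by rewrite [X in X < _]ext_nuE nuT diracT mule1 -EFinD ltry. Qed.

Let muxS : mux (~` S) = 0.
Proof. by rewrite [LHS](ext_muE H) ?setICl ?measure0//; exact: measurableC. Qed.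

Let muxX : mux (~` X) = 0.
Proof.
apply/eqP; rewrite -measure_le0 -muxS; apply: le_measure; rewrite ?inE; [exact: measurableC..|].
exact: subsetC.
Qed.

Let nuxYx : nux (~` Yx) = 0.
Proof.
rewrite [LHS]ext_nuE diracE memNset ?mule0 ?adde0; last by apply; right.
apply/eqP; rewrite -measure_le0 -nuY; apply: le_measure; rewrite ?inE; [exact: measurableC..|].
by apply: subsetC; exact: subsetUl.
Qed.

Section potential.
Variable psi : 'rV[R]_d -> R.
Hypothesis cpsi : Cont Y psi.
Local Notation phi := (ext_psi B Y c y_ext psi).
Local Notation tau := (tau B Y c psi).
Local Notation f := (ctr Y c psi).
Local Notation E := (sublevel B Y c psi tau).

Let cphi : Cont Yx phi := @Cont_ext_psi _ _ _ _ _ H _ y_extNY _ cpsi.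

Let trE x : X x -> c_transform Yx cx phi x = Num.min (f x) tau.
Proof.
move=> Xx; rewrite (ext_c_transform H y_extNY)//; last exact: (@Cont_ext _ _ _ _ _ cphi).
by rewrite ctr_ext_psi// /ext_psi eqxx opprK.
Qed.

Let phiY y : Y y -> phi y = psi y.
Proof.
by move=> Yy; rewrite /ext_psi ifF//; apply/negP => /eqP e; apply: y_extNY; rewrite -e.
Qed.

Let phix : phi y_ext = (- tau)%R.
Proof. by rewrite /ext_psi eqxx. Qed.

Let mtr : measurable_fun X (fun x : 'Rs[R]_d => c_transform Yx cx phi x).
Proof.
apply: (@eq_measurable_fun _ _ _ _ _ (fun x => Num.min (f x) tau)) => [x /set_mem Xx|].
  by rewrite trE.
have mf : measurable_fun X f := measurable_ctr H cpsi.
exact: measurable_minr.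
Qed.

Let mphi : measurable_fun Yx phi.
Proof. by apply: within_continuous_measurable => //; exact: borel_rV. Qed.

Let exists_bound : exists M, [/\ (0 <= M)%R,
  forall x, X x -> (- M <= c_transform Yx cx phi x)%R &
  forall y, Yx y -> (`|phi y| <= M)%R].
Proof.
have [M M0 psiM] := psi_bounded H cpsi; exists (M + `|tau|)%R; split.
- by rewrite addr_ge0.
- move=> x Xx; rewrite trE// le_min; have := ctr_ge H cpsi psiM Xx.
  have := normr_ge0 tau; have := ler_norm (- tau)%R; rewrite normrN.
  by move=> ? ? ?; apply/andP; split; lra.
- move=> y [Yy|->]; last by rewrite phix normrN lerDr.
  by rewrite phiY// (le_trans (psiM _ Yy))// lerDl.
Qed.

Let ineq x y : X x -> Yx y -> (c_transform Yx cx phi x + phi y <= cx x y)%R.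
Proof.
move=> Xx [Yy|->]; rewrite trE//.
  rewrite phiY// /ext_c ifF; last by apply/negP => /eqP e; apply: y_extNY; rewrite -e.
  by rewrite -lerBrDr ge_min (ctr_le H cpsi).
by rewrite phix /ext_c eqxx subr_le0 ge_min lexx orbT.
Qed.

Lemma ext_weak_duality (g : {measure set ('Rs[R]_d * 'rV[R]_d) -> \bar R}) :
  couplings mux nux g -> G_dual B Y c nu psi <= plan_cost X Yx cx g.
Proof.
move=> cg; have [M [M0 trM phiM]] := exists_bound.
rewrite -(kantorovich_ext_psi H y_extNY P_gt0 P_bound nuT nuY cpsi).
apply: (@dual_le_plan_cost _ _ _ _ _ _ _ _ _ _ mX mYx muxX nuxYx mux_fin cg cx _ phi M) => //.
- by move=> x y; exact: (ext_c_ge0 H).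
- exact: (measurable_ext_c H).
Qed.

Hypothesis psi_max : argmax (Cont Y) (G_dual B Y c nu) psi.

(** The attained duality theorem applied on the slab, the potential being
    ext_psi. *)
Lemma ext_optimal_plan : exists g : {measure set ('Rs[R]_d * 'rV[R]_d) -> \bar R},
  [/\ couplings mux nux g, plan_cost X Yx cx g <= G_dual B Y c nu psi &
    g.-negligible ((S `*` Yx) `&`
      [set z | (c_transform Yx cx phi z.1 + phi z.2 < cx z.1 z.2)%R])].
Proof.
have [s0 Bs0] : B !=set0 by have [s /interior_subset] := adm_interiorB H; exists s.
have cS : compact S.
  apply: compact_setX; first exact: adm_compactB H.
  rewrite (_ : [set p | _] = `[0%R, P]%classic); first exact: segment_compact.
  by apply/seteqP; split=> x /=; rewrite in_itv.
have S0 : S !=set0 by exists (s0, 0%R); split => //=; rewrite lexx ltW.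
have Yx0 : Yx !=set0 by exists y_ext; right.
have ccx : {within S `*` Yx, continuous (fun z : 'Rs[R]_d * 'rV[R]_d => cx z.1 z.2)}.
  apply: continuous_subspaceW (ext_c_continuous H y_extNY).
  by move=> z [/SX].
have kmax h : {within Yx, continuous h} ->
    kantorovich S Yx cx mux nux h <= kantorovich S Yx cx mux nux phi.
  move=> ch; rewrite !(kantorovich_slab H)//.
  by have [_] := (argmax_ext H y_extNY P_gt0 P_bound nuT nuY cpsi).1 psi_max; exact.
have [g [cg slack]] := kantorovich_attained (@borel_rV_R R d.-1) (@borel_rV R d)
  mux_fin nux_fin cS (@compact_ext_Y _ _ _ _ _ H y_ext) mS mYx S0 Yx0 muxS nuxYx
  (fun x y Sx => ext_c_ge0 H (SX Sx)) ccx cphi kmax.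
exists g; split => //.
have [M [M0 trM phiM]] := exists_bound.
rewrite -(kantorovich_ext_psi H y_extNY P_gt0 P_bound nuT nuY cpsi).
apply: (@plan_cost_le_dual _ _ _ _ _ _ _ _ _ _ mX mYx muxX nuxYx mux_fin cg cx _ phi M) => //.
- by move=> x y; exact: (ext_c_ge0 H).
- exact: (measurable_ext_c H).
have nS : g.-negligible (~` S `*` setT).
  apply/negligibleP; first by apply: measurableX => //; exact: measurableC.
  by rewrite [LHS]cg.1//; exact: measurableC.
apply: negligibleS (negligibleU slack nS) => -[x y] [[/= Xx Yy] h].
by have [Sx|nSx] := pselect (S x); [left|right].
Qed.

End potential.
End extended_plans.

Section plan_extension.
Local Open Scope ereal_scope.
Context (R : realType) (d : nat) (B : set 'rV[R]_d.-1) (Y : set 'rV[R]_d).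
Variable c : 'rV[R]_d.-1 * R -> 'rV[R]_d -> R.
Hypothesis H : admissible B Y c.
Variables (y_ext : 'rV[R]_d) (P : R).
Hypotheses (y_extNY : ~ Y y_ext) (P_gt0 : (0 < P)%R)
  (P_bound : forall psi, Cont Y psi -> forall s, B s -> (p_bar B Y c psi s <= P)%R).
Variable nu : {measure set 'rV[R]_d -> \bar R}.
Hypotheses (nuT : nu setT = 1) (nuY : nu (~` Y) = 0).
Variable psi : 'rV[R]_d -> R.
Hypothesis cpsi : Cont Y psi.

Notation leb := (@lebesgue_rV R d.-1).
Notation vol := (volume R d).
Local Notation X := (cylinder B : set 'Rs[R]_d).
Local Notation S := (B `*` [set p : R | (0 <= p <= P)%R] : set 'Rs[R]_d).
Local Notation Yx := (ext_Y Y y_ext).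
Local Notation cx := (ext_c c y_ext).
Local Notation mux := (ext_mu B P).
Local Notation nux := (ext_nu B y_ext P nu).
Local Notation mass := (ext_mass B P).
Local Notation tau := (tau B Y c psi).
Local Notation f := (ctr Y c psi).
Local Notation E := (sublevel B Y c psi tau).

Let mB : measurable B := measurable_compact H.
Let mX : measurable X := measurable_cylinder H.
Let mY : measurable Y := measurable_target H.
Let mS : measurable S := measurable_slab H P.
Let mYx : measurable Yx := @measurable_ext_Y _ _ _ _ _ H y_ext.
Let SX : S `<=` X := @slab_cylinder _ _ B P.
Let mTY : measurable (setT `*` Y : set ('Rs[R]_d * 'rV[R]_d)).
Proof. exact: measurableX. Qed.

Let ext_c_Y x y : Y y -> cx x y = c x y.
Proof. by move=> Yy; rewrite /ext_c ifF//; apply/negP => /eqP e; apply: y_extNY; rewrite -e. Qed.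

(** By complementary slackness an optimal plan of the extended problem sends
    the sublevel E to Y and the rest of the slab to the added point: at
    (x, y_ext) saturation says tau <= f x, and at (x, y) with y in Y it forces
    f x <= tau. Its restriction to X x Y is thus a plan for the density p_bar. *)
Lemma F_primal_le_G_dual : argmax (Cont Y) (G_dual B Y c nu) psi ->
  F_primal B Y c nu (p_bar B Y c psi) <= G_dual B Y c nu psi.
Proof.
move=> psi_max.
have [g [cg gle slack]] := ext_optimal_plan H y_extNY P_gt0 P_bound nuT nuY cpsi psi_max.
apply: le_trans gle.
pose g' := restrict_measure g (setT `*` Y : set ('Rs[R]_d * 'rV[R]_d)).
have g'E A : g' A = g (A `&` setT `*` Y) by rewrite [LHS]restrict_measureE.
have mf : measurable_fun X f := measurable_ctr H cpsi.
have mE : measurable E := measurable_sublevel H cpsi tau.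
have mGb := Pac_measurable_subgraph H (p_bar_Pac H cpsi).
have ES : E `<=` S := sublevel_slab H P_gt0 P_bound cpsi.
have mL : measurable (X `&` [set x | f x = tau]) := measurable_level H cpsi tau.
(* Outside of the null set N the constraint is saturated, x lies in the slab,
   y in Yx, and f x differs from tau. *)
pose N : set ('Rs[R]_d * 'rV[R]_d) := ((S `*` Yx) `&`
  [set z | (c_transform Yx cx (ext_psi B Y c y_ext psi) z.1 + ext_psi B Y c y_ext psi z.2 < cx z.1 z.2)%R])
  `|` (~` S `*` setT `|` (setT `*` ~` Yx `|` (X `&` [set x | f x = tau]) `*` setT)).
have muxS : mux (~` S) = 0.
  by rewrite [LHS](ext_muE H) ?setICl ?measure0//; exact: measurableC.
have nuxYx : nux (~` Yx) = 0.
  rewrite [LHS]ext_nuE diracE memNset ?mule0 ?adde0; last by apply; right.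
  apply/eqP; rewrite -measure_le0 -nuY; apply: le_measure; rewrite ?inE; [exact: measurableC..|].
  by apply: subsetC; exact: subsetUl.
have nN : g.-negligible N.
  apply: negligibleU => //; apply: negligibleU; last apply: negligibleU.
  - apply/negligibleP; first by apply: measurableX => //; exact: measurableC.
    by rewrite [LHS]cg.1//; exact: measurableC.
  - apply/negligibleP; first by apply: measurableX => //; exact: measurableC.
    by rewrite [LHS]cg.2//; exact: measurableC.
  - apply/negligibleP; first exact: measurableX.
    rewrite [LHS]cg.1// (ext_muE H)//; apply/eqP; rewrite -measure_le0 -(volume_level H cpsi tau).
    by apply: le_measure; rewrite ?inE; [exact: measurableI|exact: mL|exact: subIsetl].
have trE x : X x -> c_transform Yx cx (ext_psi B Y c y_ext psi) x = Num.min (f x) tau.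
  move=> Xx; rewrite (ext_c_transform H y_extNY)//.
    by rewrite ctr_ext_psi// /ext_psi eqxx opprK.
  by apply: (@Cont_ext _ _ _ y_ext); exact: (@Cont_ext_psi _ _ _ _ _ H _ y_extNY _ cpsi).
have psiE y : Y y -> ext_psi B Y c y_ext psi y = psi y.
  by move=> Yy; rewrite /ext_psi ifF//; apply/negP => /eqP e; apply: y_extNY; rewrite -e.
have to_Y x y : Y y -> ~ N (x, y) -> E x.
  move=> Yy nN'; have Sx : S x by apply: contrapT => nSx; apply: nN'; right; left.
  have Xx := SX Sx; split=> //=; rewrite leNgt; apply/negP => fx; apply: nN'; left.
  split; first by split => //; left.
  rewrite /= trE// psiE// ext_c_Y// min_r; last exact: ltW.
  by have := ctr_le H cpsi Xx Yy; lra.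
have to_E x y : E x -> ~ N (x, y) -> Y y.
  move=> [Xx /= fx] nN'; have Sx : S x by apply: contrapT => nSx; apply: nN'; right; left.
  have [//|/= yE] : Yx y by apply: contrapT => nYx; apply: nN'; right; right; left.
  exfalso; move: nN'; rewrite yE; apply.
  have [ft|ft] := eqVneq (f x) tau; first by right; right; right.
  left; split; first by split => //; right.
  rewrite /= trE// min_l// /ext_psi /ext_c !eqxx subr_lt0.
  by rewrite lt_neqAle ft.
apply: (@le_trans _ _ (plan_cost X Y c g')); last first.
  rewrite /plan_cost (@eq_measure_integral _ _ _ _ g g'); last first.
    move=> A mA AXY; rewrite [LHS]g'E setIidl// => z /AXY[_ Yz]; split => //.
  rewrite (@eq_integral _ _ _ g _ (fun z => (cx z.1 z.2)%:E)); last first.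
    by move=> z /set_mem [_ Yz]; rewrite ext_c_Y.
  apply: ge0_subset_integral => //.
  - exact: measurableX.
  - exact: measurableX.
  - by apply/measurable_EFinP; exact: (measurable_ext_c H).
  - by move=> z [Xz Yz]; rewrite lee_fin (ext_c_ge0 H).
  - by move=> z [Xz Yz]; split => //; left.
apply: ereal_inf_lbound; exists g' => //; split=> A mA.
  rewrite [LHS]g'E [RHS]restrict_measureE// (volume_subgraph_max_q H cpsi)//.
  transitivity (g ((A `&` E) `*` setT)); last first.
    rewrite [LHS]cg.1; last exact: measurableI.
    rewrite (ext_muE H); last exact: measurableI.
    by rewrite -setIA (setIidl ES).
  have mAY : measurable (A `*` setT `&` setT `*` Y : set ('Rs[R]_d * 'rV[R]_d)).
    by apply: measurableI => //; exact: measurableX.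
  have mAE : measurable ((A `&` E) `*` setT : set ('Rs[R]_d * 'rV[R]_d)).
    by apply: measurableX => //; exact: measurableI.
  apply/eqP; rewrite eq_le; apply/andP; split.
    apply: (le_measure_null mAY mAE nN) => -[x y] [[/= Ax _] [_ /= Yy]].
    by have [Nxy|nNxy] := pselect (N (x, y)); [right|left; split => //=; split => //; exact: to_Y nNxy].
  apply: (le_measure_null mAE mAY nN) => -[x y] [[/= Ax Ex] _].
  by have [Nxy|nNxy] := pselect (N (x, y)); [right|left; split => //=; split => //; exact: to_E nNxy].
rewrite [LHS]g'E -setXI setTI [LHS]cg.2; last exact: measurableI.
rewrite [LHS]ext_nuE diracE memNset ?mule0 ?adde0; last by move=> [].
apply/eqP; rewrite eq_le; apply/andP; split.
  by apply: le_measure; rewrite ?inE; [exact: measurableI|exact: mA|exact: subIsetl].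
apply: (@le_measure_null _ _ _ _ _ _ (~` Y)) => //; first exact: measurableI.
  by apply/negligibleP => //; exact: measurableC.
by move=> y Ay; have [Yy|nYy] := pselect (Y y); [left|right].
Qed.

Variable p : 'rV[R]_d.-1 -> R.
Hypotheses (pP : Pac B p) (p_le : {ae leb, forall s, B s -> (p s <= P)%R}).
Local Notation sup := (supergraph B P p).

Let mp : measurable_fun B p. Proof. by case: pP. Qed.
Let p_ge0 s : B s -> (0 <= p s)%R. Proof. by case: pP => _ + _; exact. Qed.
Let msup : measurable sup := measurable_supergraph H P mp p_ge0.
Let mG : measurable (subgraph B p) := Pac_measurable_subgraph H pP.

Lemma volume_above : vol (subgraph B p `\` S) = 0.
Proof.
have mD : measurable (subgraph B p `\` S) by exact: measurableD.
rewrite volumeE (ae_eq_integral (cst 0)) ?integral0//.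
  exact: (measurable_fun_xsection lebesgue_measure mD).
apply: filterS p_le => s h _ /=.
rewrite (_ : xsection _ _ = set0) ?measure0//; apply/seteqP; split=> // t /xsectionP[[[/= Bs t0] /= tp]].
by apply; split => //=; rewrite t0 (le_trans tp)// h.
Qed.

(** The subgraph and the supergraph of p split the slab, up to the graph of p
    and to the part of the subgraph above P, which are null sets. *)
Lemma surface_split A : measurable A ->
  mu_surface B p A + restrict_measure vol sup A = mux A.
Proof.
move=> mA.
rewrite [X in X + _]restrict_measureE// [X in _ + X]restrict_measureE// [RHS](ext_muE H)//.
have ngr : vol.-negligible (X `&` [set x | x.2 = p x.1]).
  exists (X `&` [set x | x.2 = p x.1]); split => //; last exact: (volume_graph H).
  rewrite (_ : _ `&` _ = (subgraph B p `&` (X `&` [set x | (p x.1 <= x.2)%R]))).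
    apply: measurableI => //; apply: measurable_fun_le => //.
      apply: (measurable_comp mB) => //; first by move=> _ [x [] + _ <-].
      by apply: measurable_funS measurable_fst.
    by apply: measurable_funS measurable_snd.
  apply/seteqP; split=> [x [Xx /= E]|x [[Xx h] [_ /= h']]].
    by split; [split => //; rewrite E|split => //=; rewrite E].
  by split => //=; apply/eqP; rewrite eq_le h.
have nab : vol.-negligible (subgraph B p `\` S).
  by apply/negligibleP; [exact: measurableD|exact: volume_above].
have mAG : measurable (A `&` subgraph B p) by exact: measurableI.
have mAs : measurable (A `&` sup) by exact: measurableI.
have mAS : measurable (A `&` S) by exact: measurableI.
have mASG : measurable (A `&` S `&` subgraph B p) by exact: measurableI.
have mASGD : measurable (A `&` S `\` subgraph B p) by exact: measurableD.
rewrite -[in RHS](setUIDK (A `&` S) (subgraph B p)) measureU//; last first.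
  by apply/seteqP; split=> // x [[_ ?] []].
congr (_ + _); apply/eqP; rewrite eq_le; apply/andP; split.
- apply: (le_measure_null mAG mASG nab) => x [Ax Gx].
  by have [Sx|nSx] := pselect (S x); [left|right].
- by apply: le_measure; rewrite ?inE// => x [[Ax Sx] Gx].
- apply: (le_measure_null mAs mASGD ngr) => x [Ax [Bx /andP[px xP]]].
  have x0 : (0 <= x.2 :> R)%R by apply: le_trans px; exact: p_ge0.
  have [xp|xp] := eqVneq (x.2 : R) (p x.1); first by right.
  left; split; first by split => //; split => //=; rewrite x0.
  by move=> [_ /=]; rewrite leNgt lt_neqAle eq_sym xp px.
- apply: le_measure; rewrite ?inE// => x [[Ax [Bx /= /andP[x0 xP]]] nG].
  split => //; split => //; rewrite xP andbT; apply/ltW; rewrite ltNge; apply/negP => h.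
  by apply: nG.
Qed.

Lemma volume_supergraph : restrict_measure vol sup setT = mass%:E.
Proof.
have := surface_split measurableT.
rewrite [X in X + _]restrict_measureE// setTI [X in X + _](Pac_volume pP).
rewrite [X in _ = X](ext_muE H)// setTI [X in _ = X](volume_slab H P_gt0).
rewrite (ext_massE H P_gt0 P_bound cpsi).
by case: (restrict_measure vol sup setT) => [r| |] //= [] rE; congr EFin; lra.
Qed.

Variable gamma : {measure set ('Rs[R]_d * 'rV[R]_d) -> \bar R}.
Local Notation gx := (ext_gamma B y_ext P p gamma).

Let gxE A : gx A = gamma A + (restrict_measure vol sup \x \d_y_ext) A.
Proof. exact: measure_addE. Qed.

Let gx1 A : measurable A -> gx (A `*` setT) = gamma (A `*` setT) + restrict_measure vol sup A.
Proof.
move=> mA; rewrite [LHS]gxE; congr (_ + _).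
by rewrite product_measure1E// [X in _ * X]diracT mule1.
Qed.

Let gx2 A : measurable A -> gx (setT `*` A) = gamma (setT `*` A) + mass%:E * \d_y_ext A.
Proof.
move=> mA; rewrite [LHS]gxE; congr (_ + _).
by rewrite product_measure1E// [X in X * _]volume_supergraph.
Qed.

(** The added part of ext_gamma has marginals the restriction of the volume to
    the supergraph and the mass at y_ext, which are finite and can thus be added
    or cancelled. *)
Lemma ext_gamma_couplings : couplings (mu_surface B p) nu gamma <-> couplings mux nux gx.
Proof.
have sup_fin A : measurable A -> restrict_measure vol sup A \is a fin_num.
  move=> mA; rewrite ge0_fin_numE//; apply: (@le_lt_trans _ _ (restrict_measure vol sup setT)).
    by apply: le_measure; rewrite ?inE.
  by rewrite [X in X < _]volume_supergraph ltry.
split=> -[h1 h2]; split=> A mA.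
- by rewrite gx1// h1// surface_split.
- by rewrite gx2// h2// ext_nuE.
- have /(congr1 (fun z => z - restrict_measure vol sup A)) := h1 A mA.
  by rewrite gx1// -surface_split// !addeK ?sup_fin.
- have /(congr1 (fun z => z - mass%:E * \d_y_ext A)) := h2 A mA.
  have dfin : mass%:E * \d_y_ext A \is a fin_num by rewrite diracE -EFinM.
  by rewrite gx2// ext_nuE !addeK.
Qed.

(** The added part of the plan is carried by X x {y_ext}, where the extended
    cost vanishes. *)
Lemma ext_gamma_cost : gamma (~` (X `*` Y)) = 0 ->
  plan_cost X Yx cx gx = plan_cost X Y c gamma.
Proof.
move=> g0; have mXY : measurable (X `*` Y) by exact: measurableX.
have mXYx : measurable (X `*` Yx) by exact: measurableX.
have mcx : measurable_fun (X `*` Yx) (fun z => (cx z.1 z.2)%:E).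
  by apply/measurable_EFinP; exact: (measurable_ext_c H).
have mpt : measurable [set y_ext].
  by apply: borel_closed; [exact: borel_rV|exact: closed_singleton_rV].
rewrite /plan_cost ge0_integral_measure_add//; last first.
  by move=> z [Xz Yz]; rewrite lee_fin (ext_c_ge0 H).
rewrite [X in X + _](@integral_null_diff _ _ _ gamma _ (X `*` Y))//; last 2 first.
- by move=> z [Xz Yz]; split => //; left.
- apply/eqP; rewrite -measure_le0 -g0; apply: le_measure; rewrite ?inE.
  + exact: measurableD.
  + exact: measurableC.
  + by move=> z [].
rewrite [X in _ + X](@integral_null_diff _ _ _ _ _ (X `*` [set y_ext]))//; last 3 first.
- exact: measurableX.
- by move=> z [Xz Yz]; split => //; right.
- apply/eqP; rewrite -measure_le0.
  have <- : (restrict_measure vol sup \x \d_y_ext) (setT `*` ~` [set y_ext]) = 0.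
    rewrite product_measure1E//; last exact: measurableC.
    by rewrite [X in _ * X]diracE memNset ?mule0//; exact.
  apply: le_measure; rewrite ?inE.
  + by apply: measurableD => //; exact: measurableX.
  + by apply: measurableX => //; exact: measurableC.
  + by move=> [x y] [[/= Xx _] nXy]; split => //= yE; apply: nXy.
rewrite [X in _ + X]integral0_eq ?adde0; last first.
  by move=> z [_ /= ->]; rewrite /ext_c eqxx.
by apply: eq_integral => z /set_mem [_ Yz]; rewrite ext_c_Y.
Qed.

End plan_extension.

(** * Equivalence of the two problems *)

Theorem theorem5p1 (R : realType) (d : nat) (hd : (2 <= d)%N)
    (B : set 'rV[R]_d.-1) (compactB : compact B) (interiorB : interior B !=set0)
    (Y : set 'rV[R]_d) (nonemptyY : Y !=set0) (compactY : compact Y)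
    (c : 'rV[R]_d.-1 * R -> 'rV[R]_d -> R)
    (c_ge0 : forall x y, cylinder B x -> Y y -> 0 <= c x y)
    (c_lipschitz : [locally [lipschitz c z.1 z.2 | z in cylinder B `*` Y]])
    (c_increasing : forall s y, B s -> Y y ->
      forall p p' : R, 0 <= p -> p < p' -> c (s, p) y < c (s, p') y)
    (c_unbounded : forall s y, B s -> Y y ->
      forall M : R, exists2 p : R, 0 <= p & M < c (s, p) y)
    (c_equicontinuous : @equicontinuous (subspace B) R (R * 'rV[R]_d)
      [set py | 0 <= py.1 /\ Y py.2] (fun py s => c (s, py.1) py.2))
    (y_ext : 'rV[R]_d) (y_extNY : ~ Y y_ext)
    (P : R) (P_gt0 : 0 < P)
    (P_bound : forall psi, Cont Y psi -> forall s, B s -> p_bar B Y c psi s <= P)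
    (nu : probability 'rV[R]_d R) (nuY : nu Y = 1%E)
    (p : 'rV[R]_d.-1 -> R) (p_Pac : Pac B p)
    (psi : 'rV[R]_d -> R) (psi_cont : Cont Y psi)
    (gamma : probability ('Rs[R]_d * 'rV[R]_d)%type R)
    (gammaXY : gamma (cylinder B `*` Y) = 1%E) :
  [/\ argmin (Pac B) (F_primal B Y c nu) p,
      argmax (Cont Y) (G_dual B Y c nu) psi &
      optimal_plans (cylinder B) Y c (mu_surface B p) nu gamma]
  <->
  [/\ {ae @lebesgue_rV R d.-1, forall s, B s ->
        p s = max_q Y c (fun y => ext_psi B Y c y_ext psi y
                                  - ext_psi B Y c y_ext psi y_ext) s},
      argmax (Cont (ext_Y Y y_ext))
        (kantorovich (cylinder B) (ext_Y Y y_ext) (ext_c c y_ext)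
           (ext_mu B P) (ext_nu B y_ext P nu))
        (ext_psi B Y c y_ext psi) &
      optimal_plans (cylinder B) (ext_Y Y y_ext) (ext_c c y_ext)
        (ext_mu B P) (ext_nu B y_ext P nu) (ext_gamma B y_ext P p gamma)].
Proof.
have H : admissible B Y c by [].
have nuT : nu setT = 1%E := probability_setT nu.
have mX := measurable_cylinder H; have mY := measurable_target H.
have mXY : measurable (cylinder B `*` Y : set ('Rs[R]_d * 'rV[R]_d)) by exact: measurableX.
have nuY0 : nu (~` Y) = 0%E by rewrite probability_setC// nuY subee.
have gamma0 : gamma (~` (cylinder B `*` Y)) = 0%E by rewrite probability_setC// gammaXY subee.
have E : (fun s => max_q Y c (fun y => ext_psi B Y c y_ext psi y - ext_psi B Y c y_ext psi y_ext) s) =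
    p_bar B Y c psi.
  apply/funext => s; rewrite /p_bar /max_q; congr sup; apply/seteqP.
  have yE y : Y y -> ext_psi B Y c y_ext psi y - ext_psi B Y c y_ext psi y_ext = psi y + tau B Y c psi.
    move=> Yy; rewrite /ext_psi eqxx opprK ifF//.
    by apply/negP => /eqP yE; apply: y_extNY; rewrite -yE.
  by split=> _ [y Yy <-]; exists y; rewrite ?yE.
have p_le : {ae @lebesgue_rV R d.-1, forall s, B s -> p s = p_bar B Y c psi s} ->
    {ae @lebesgue_rV R d.-1, forall s, B s -> p s <= P}.
  by apply: filterS => s h Bs; rewrite h//; exact: P_bound.
have psi_max_ext := argmax_ext H y_extNY P_gt0 P_bound nuT nuY0 psi_cont.
have G_le_F p' : Pac B p' -> (G_dual B Y c nu psi <= F_primal B Y c nu p')%E.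
  move=> p'P; apply: le_ereal_inf_tmp => _ [g cg <-].
  apply: le_trans (weak_duality H nuY0 p'P psi_cont cg).
  by apply: ereal_inf_lbound; exists p'.
(* First implication: G psi <= kantorovich (mu_surface p) psi <= F p
   <= F (p_bar psi) <= G psi, so all of them are equal. Second implication:
   plan_cost gamma = plan_cost (ext_gamma p gamma) <= G psi <= F p' for every
   density p', and F p <= plan_cost gamma. *)
split=> [[[_ p_min] psi_max [cgamma gamma_min]]|[p_eq psi_max [cgamma gamma_min]]].
  have FE : plan_cost (cylinder B) Y c gamma = F_primal B Y c nu p.
    apply/eqP; rewrite eq_le; apply/andP; split.
      by apply: le_ereal_inf_tmp => _ [g cg <-]; exact: gamma_min.
    by apply: ereal_inf_lbound; exists gamma.
  have F_le : (F_primal B Y c nu p <= G_dual B Y c nu psi)%E.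
    apply: le_trans (p_min _ (p_bar_Pac H psi_cont)) _.
    exact: (F_primal_le_G_dual H y_extNY P_gt0 P_bound nuT nuY0 psi_cont psi_max).
  have p_eq : {ae @lebesgue_rV R d.-1, forall s, B s -> p s = p_bar B Y c psi s}.
    apply: (dual_value_eq H psi_cont p_Pac).
    have := weak_duality H nuY0 p_Pac psi_cont cgamma; rewrite FE => /le_trans/(_ F_le).
    rewrite (kantorovich_surface H psi_cont)// (G_dualE H psi_cont) leeD2rE//.
    exact: (potential_fin H nuT).
  split.
  - by apply: filterS p_eq => s h Bs; rewrite h// -E.
  - exact/psi_max_ext.
  - split.
      exact: (ext_gamma_couplings H y_ext P_gt0 P_bound nu psi_cont p_Pac (p_le p_eq) gamma).1.
    move=> g cg; rewrite (ext_gamma_cost H)//.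
    rewrite FE; apply: le_trans F_le _.
    exact: (ext_weak_duality H y_extNY P_gt0 P_bound nuT nuY0 psi_cont cg).
have {}psi_max := psi_max_ext.2 psi_max.
have {}p_eq : {ae @lebesgue_rV R d.-1, forall s, B s -> p s = p_bar B Y c psi s}.
  by apply: filterS p_eq => s h Bs; rewrite h// -E.
have {}cgamma := (ext_gamma_couplings H y_ext P_gt0 P_bound nu psi_cont p_Pac (p_le p_eq) gamma).2 cgamma.
have gamma_le : (plan_cost (cylinder B) Y c gamma <= G_dual B Y c nu psi)%E.
  have [g [cg gle _]] := ext_optimal_plan H y_extNY P_gt0 P_bound nuT nuY0 psi_cont psi_max.
  by rewrite -(ext_gamma_cost H P y_extNY p gamma0) (le_trans (gamma_min _ cg)).
have gamma_F : (plan_cost (cylinder B) Y c gamma <= F_primal B Y c nu p)%E.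
  exact: le_trans gamma_le (G_le_F _ p_Pac).
split => //; split => //.
- move=> p' p'P; apply: le_trans (G_le_F _ p'P); apply: le_trans gamma_le.
  by apply: ereal_inf_lbound; exists gamma.
- by move=> g cg; apply: le_trans gamma_F _; apply: ereal_inf_lbound; exists g.
Qed.
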